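(* Let $d\ge1$, $A\ge1$, $0<\mu\le1$, $\nu>0$ with $\mu+\nu\ge1$, and $0\le\delta\le\frac{1-\mu}{\nu}\le1$. Let $\rho:\mathbb{R}^d\to(0,+\infty)$ be a positive contraction mapping such that there exist constants $m>0$, $R>0$ with $$\forall x\in\mathbb{R}^d,\quad 0<m\le\rho(x)\le R\langle x\rangle^\delta.$$ Let $\omega$ be a measurable subset of $\mathbb{R}^d$. If $\omega$ is thick with respect to $\rho$ (that is, $\gamma$-thick with respect to $\rho$ for some $0<\gamma\le1$), then for all $0<\varepsilon\le1$ there exists a positive constant $C_{\varepsilon,A}>0$ such that for all $f\in\mathcal{S}(\mathbb{R}^d)$, $$\|f\|^2_{L^2(\mathbb{R}^d)}\le C_{\varepsilon,A}\|f\|^2_{L^2(\omega)}+\varepsilon\sup_{p\in\mathbb{N},\,\beta\in\mathbb{N}^d}\bigg(\frac{\|\langle x\rangle^p\partial_x^\beta f\|_{L^2(\mathbb{R}^d)}}{A^{p+|\beta|}(p!)^\nu(|\beta|!)^\mu}\bigg)^2,$$ where, when $\delta<\frac{1-\mu}{\nu}$, there exists a constant $K=K(d,\gamma,\rho,\mu,\nu)\ge1$ (independent of $A$ and $\varepsilon$) such that $$0<C_{\varepsilon,A}\le e^{K\left(1-\log\varepsilon+A^{\frac{2}{1-\mu-\delta\nu}}\right)},$$ whereas, when $\delta=\frac{1-\mu}{\nu}$, there exists a constant $K=K(d,\gamma,\rho,\mu,\nu)\ge1$ (independent of $A$ and $\varepsilon$) such that $$0<C_{\varepsilon,A}\le e^{K(1-\log\varepsilon+\log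 A)e^{KA^2}}.$$
   Context: $\mathbb{N}$ is the set of non-negative integers, $\langle x\rangle=(1+\|x\|^2)^{1/2}$ with $\|\cdot\|$ the Euclidean norm, $\mathcal{S}(\mathbb{R}^d)$ is the Schwartz space, $|A|$ denotes the Lebesgue measure of a measurable set, $B(x,L)$ the Euclidean ball centered at $x$ with radius $L$. For $0<\gamma\le1$, a measurable $\omega\subset\mathbb{R}^d$ is $\gamma$-thick with respect to $\rho:\mathbb{R}^d\to(0,+\infty)$ if $|\omega\cap B(x,\rho(x))|\ge\gamma|B(x,\rho(x))|$ for all $x\in\mathbb{R}^d$; it is thick with respect to $\rho$ if this holds for some $0<\gamma\le1$. A positive function $\rho$ is a contraction mapping if there is $0\le L<1$ with $|\rho(x)-\rho(y)|\le L\|x-y\|$ for all $x,y\in\mathbb{R}^d$. The supremum in the estimate may be $+\infty$, in which case the inequality is trivial. *)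

(* Defs.v *)
From HB Require Import structures.
From mathcomp Require Import all_boot all_order all_algebra.
From mathcomp Require Import complex.
From mathcomp Require Import all_classical all_reals all_analysis.

Set Implicit Arguments.
Unset Strict Implicit.
Unset Printing Implicit Defensive.

Import Order.TTheory GRing.Theory Num.Theory.
Import numFieldNormedType.Exports.

Local Open Scope classical_set_scope.
Local Open Scope ring_scope.

(* The space R^n is ['rV[R]_n]. Its Borel sigma-algebra is generated by the
   coordinate maps. Lebesgue measure is first built on Borel sets, as an
   iterated product of the one-dimensional [lebesgue_measure], and then
   completed by Caratheodory's construction, so that the measurable sets of
   the final measure are the Lebesgue measurable ones. *)

Section borel_rV.
Context (R : realType) (n : nat).

Definition rV_coord (i : 'I_n) (x : 'rV[R]_n) : measurableTypeR R := x ord0 i.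

Let rV_set0 : g_sigma_preimage rV_coord set0.
Proof. exact: sigma_algebra0. Qed.

Let rV_setC A : g_sigma_preimage rV_coord A -> g_sigma_preimage rV_coord (~` A).
Proof. exact: sigma_algebraC. Qed.

Let rV_bigcup (F : (set 'rV[R]_n)^nat) :
  (forall i, g_sigma_preimage rV_coord (F i)) ->
  g_sigma_preimage rV_coord (\bigcup_i (F i)).
Proof. exact: sigma_algebra_bigcup. Qed.

HB.instance Definition _ := @isMeasurable.Build
  (measure_tuple_display default_measure_display)
  'rV[R]_n (g_sigma_preimage rV_coord) rV_set0 rV_setC rV_bigcup.

Lemma measurable_rV_coord (i : 'I_n) :
  measurable_fun [set: 'rV[R]_n] (rV_coord i).
Proof.
move=> _ Y mY; rewrite setTI; apply: sub_sigma_algebra => /=.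
rewrite -bigcup_seq/=; exists i => /=; first by rewrite mem_index_enum.
by exists Y => //; rewrite setTI.
Qed.

Lemma measurable_fun_rV d (T : measurableType d) (f : T -> 'rV[R]_n) :
  (forall i, measurable_fun [set: T] (rV_coord i \o f)) ->
  measurable_fun [set: T] f.
Proof.
move=> mf.
suff H : g_sigma_preimage (fun i => rV_coord i \o f) `<=` measurable.
  move: H; rewrite g_sigma_preimage_comp => H _ A mA.
  by apply: H; exists A.
apply: smallest_sub; first exact: sigma_algebra_measurable.
rewrite -bigcup_seq => A [i _] [B mB <-]; exact: mf.
Qed.

End borel_rV.

Section cons_rV.
Context (R : realType) (n : nat).

Definition cons_rV (p : measurableTypeR R * 'rV[R]_n) : 'rV[R]_n.+1 :=
  row_mx p.1%:M p.2.

Definition uncons_rV (x : 'rV[R]_n.+1) : measurableTypeR R * 'rV[R]_n :=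
  (x ord0 ord0, rsubmx (x : 'rV_(1 + n))).

Lemma cons_rV0 p : cons_rV p ord0 ord0 = p.1.
Proof.
have -> : (ord0 : 'I_n.+1) = lshift n (ord0 : 'I_1) by exact/val_inj.
by rewrite /cons_rV (@row_mxEl _ 1 1 n) mxE eqxx mulr1n.
Qed.

Lemma cons_rVS p (j : 'I_n) : cons_rV p ord0 (rshift 1 j) = p.2 ord0 j.
Proof. by rewrite /cons_rV (@row_mxEr _ 1 1 n). Qed.

Lemma cons_rVK : cancel cons_rV uncons_rV.
Proof. by case=> a x; rewrite /uncons_rV cons_rV0 row_mxKr. Qed.

Lemma measurable_cons_rV : measurable_fun setT cons_rV.
Proof.
apply: measurable_fun_rV => i; have [j ->|j ->] := @split_ordP 1 n i.
  rewrite (_ : _ \o _ = fst) ?funeqE; first exact: measurable_fst.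
  move=> p; rewrite -cons_rV0/= /rV_coord; congr (cons_rV p _ _).
  by rewrite ord1; exact/val_inj.
rewrite (_ : _ \o _ = rV_coord j \o snd) ?funeqE.
  by apply: measurableT_comp; [exact: measurable_rV_coord|exact: measurable_snd].
by move=> p; exact: cons_rVS.
Qed.

Lemma measurable_uncons_rV : measurable_fun setT uncons_rV.
Proof.
apply/measurable_fun_pairP; split; first exact: (measurable_rV_coord ord0).
apply: measurable_fun_rV => i.
rewrite (_ : _ \o _ = rV_coord (rshift 1 i : 'I_n.+1)) ?funeqE.
  exact: measurable_rV_coord.
by move=> x; rewrite /rV_coord/= mxE.
Qed.

Variable mu : {sigma_finite_measure set 'rV[R]_n -> \bar R}.

Definition lebesgue_cons : set 'rV[R]_n.+1 -> \bar R :=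
  pushforward (@lebesgue_measure R \x mu)%E cons_rV.

Let lebesgue_cons0 : lebesgue_cons set0 = 0%E.
Proof. by rewrite /lebesgue_cons /pushforward preimage_set0 measure0. Qed.

Let lebesgue_cons_ge0 A : (0 <= lebesgue_cons A)%E.
Proof. exact: (@measure_ge0 _ _ _ (@lebesgue_measure R \x mu)%E). Qed.

Let lebesgue_cons_sigma_additive : semi_sigma_additive lebesgue_cons.
Proof.
exact: (@measure_semi_sigma_additive _ _ _
  (measure_function_pushforward__canonical__measure_function_Measure
    (@lebesgue_measure R \x mu)%E measurable_cons_rV)).
Qed.

HB.instance Definition _ := isMeasure.Build _ _ _ lebesgue_cons
  lebesgue_cons0 lebesgue_cons_ge0 lebesgue_cons_sigma_additive.

Let lebesgue_cons_sigma_finite : sigma_finite setT lebesgue_cons.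
Proof.
have /sigma_finiteP[F [TF ndF mF]] := sigma_finiteT (@lebesgue_measure R).
have /sigma_finiteP[G [TG ndG mG]] := sigma_finiteT mu.
exists (fun k => uncons_rV @^-1` (F k `*` G k)).
  rewrite -preimage_bigcup (_ : \bigcup_k _ = setT) ?preimage_setT//.
  rewrite -subTset => -[a x] _.
  have [k _ Fka] : (\bigcup_k F k) a by rewrite -TF.
  have [l _ Glx] : (\bigcup_k G k) x by rewrite -TG.
  exists (maxn k l) => //; split => /=.
    by move: a Fka; exact/subsetPset/ndF/leq_maxl.
  by move: x Glx; exact/subsetPset/ndG/leq_maxr.
move=> k; have [? ?] := mF k; have [? ?] := mG k; split.
  rewrite -[X in measurable X]setTI; apply: measurable_uncons_rV => //.
  exact: measurableX.
rewrite /lebesgue_cons /pushforward -comp_preimage.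
rewrite (_ : _ \o _ = id); last by rewrite funeqE => p; exact: cons_rVK.
by rewrite preimage_id product_measure1E// lte_mul_pinfty// ge0_fin_numE.
Qed.

HB.instance Definition _ := Measure_isSigmaFinite.Build _ _ _ lebesgue_cons
  lebesgue_cons_sigma_finite.

End cons_rV.

Fixpoint borel_lebesgue_rV (R : realType) (n : nat) :
    {sigma_finite_measure set 'rV[R]_n -> \bar R} :=
  match n with
  | 0 => @dirac _ _ (0 : 'rV[R]_0) R
  | n'.+1 => lebesgue_cons (borel_lebesgue_rV R n')
  end.

Definition lebesgue_rV (R : realType) (n : nat) :=
  @completed_measure_extension _ _ _ (borel_lebesgue_rV R n).
Arguments lebesgue_rV : clear implicits.
HB.instance Definition _ (R : realType) (n : nat) :=
  Measure.on (lebesgue_rV R n).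

Definition lebesgue_measurable (R : realType) (n : nat) (A : set 'rV[R]_n) :=
  ((borel_lebesgue_rV R n)^*)%mu.-cara.-measurable A.

Section euclidean.
Context (R : realType) (d : nat).
Implicit Types x y : 'rV[R]_d.

(* The library norm [`|x|] on ['rV[R]_d] is the max norm. *)
Definition enorm x : R := Num.sqrt (\sum_(i < d) x ord0 i ^+ 2).

Definition eball x (r : R) : set 'rV[R]_d := [set y | enorm (y - x) < r].

Definition jbracket x : R := Num.sqrt (1 + enorm x ^+ 2).

Definition contraction_mapping (rho : 'rV[R]_d -> R) : Prop :=
  (forall x, 0 < rho x) /\
  exists2 L : R, 0 <= L < 1 &
    forall x y, `|rho x - rho y| <= L * enorm (x - y).

Definition gamma_thick (gamma : R) (rho : 'rV[R]_d -> R)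
    (omega : set 'rV[R]_d) : Prop :=
  forall x, (gamma%:E * lebesgue_rV R d (eball x (rho x)) <=
             lebesgue_rV R d (omega `&` eball x (rho x)))%E.

End euclidean.

Section schwartz.
Context (R : realType) (d : nat).

Definition partial (j : 'I_d) (g : 'rV[R]_d -> R) : 'rV[R]_d -> R :=
  'D_(delta_mx ord0 j) g.

Definition smooth (g : 'rV[R]_d -> R) : Prop :=
  forall s : seq 'I_d,
    continuous (foldr partial g s) /\
    forall j x, derivable (foldr partial g s) x (delta_mx ord0 j).

Definition msize (beta : 'I_d -> nat) : nat := (\sum_(j < d) beta j)%N.

Definition mpartial (beta : 'I_d -> nat) (g : 'rV[R]_d -> R) :
    'rV[R]_d -> R :=
  foldr (fun j => iter (beta j) (partial j)) g (enum 'I_d).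

(* Derivatives of a complex-valued function are taken componentwise. *)
Definition cpartial (beta : 'I_d -> nat) (f : 'rV[R]_d -> R[i]) :
    'rV[R]_d -> R[i] :=
  fun x => Complex (mpartial beta (fun y => complex.Re (f y)) x)
                   (mpartial beta (fun y => complex.Im (f y)) x).

Definition schwartz (f : 'rV[R]_d -> R[i]) : Prop :=
  [/\ smooth (fun x => complex.Re (f x)), smooth (fun x => complex.Im (f x)) &
    forall (p : nat) (beta : 'I_d -> nat), exists M : R,
      forall x, jbracket x ^+ p * ComplexField.Normc.normc (cpartial beta f x) <= M].

(* [g \_ D] is [g] on [D] and [point], which is 0 in [\bar R], elsewhere. *)
Definition L2norm (D : set 'rV[R]_d) (f : 'rV[R]_d -> R[i]) : \bar R :=
  'N[lebesgue_rV R d]_2%:E[(fun x => (ComplexField.Normc.normc (f x))%:E) \_ D].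

Definition weighted_partial (p : nat) (beta : 'I_d -> nat)
    (f : 'rV[R]_d -> R[i]) : 'rV[R]_d -> R[i] :=
  fun x => real_complex R (jbracket x ^+ p) * cpartial beta f x.

Definition factorial_weight (A mu nu : R) (p k : nat) : R :=
  A ^+ (p + k) * p`!%:R `^ nu * k`!%:R `^ mu.

(* The supremum is taken in [\bar R] and may be +oo. *)
Definition weighted_sup (A mu nu : R) (f : 'rV[R]_d -> R[i]) : \bar R :=
  ereal_sup [set ((L2norm setT (weighted_partial pb.1 pb.2 f)
                   / (factorial_weight A mu nu pb.1 (msize pb.2))%:E) ^+ 2)%E
            | pb in [set: nat * ('I_d -> nat)]].

End schwartz.

(* Main.v *)
Require Import Defs.
From mathcomp Require Import all_boot all_order all_algebra.
From mathcomp Require Import all_classical all_reals all_analysis.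
From mathcomp Require Import complex.
From mathcomp Require Import ring lra zify measurable_realfun.
Import Order.TTheory GRing.Theory Num.Theory.
Import numFieldNormedType.Exports.

Local Open Scope classical_set_scope.
Local Open Scope ring_scope.
Set Implicit Arguments.
Unset Strict Implicit.
Unset Printing Implicit Defensive.

(** The theorem is proved by polynomial interpolation on segments, carried to
    boxes by Fubini and to the whole space by a covering. All estimates are
    linear in the squares of [f] and of its derivatives, so that inequalities on
    segments may be integrated and summed.

    One segment. Let [E] occupy a proportion [gam] of a segment of length [l]. On
    half of [E] the function is at most of the order of its quadratic mean on [E],
    and this half contains [N] points at mutual distance [gam * l / (4 * N)].
    Lagrange interpolation at these points amplifies by at most a power
    [(8 * e / gam) ^ N], and leaves a remainder of size [l ^ N / N!] times the
    [N]-th derivative (lemma [observability_step]).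

    Size of the remainder. The boxes of the covering have width at most
    [c * rho <= c * R0 * <x> ^ delta] near [x]. Hence [l ^ n] times a derivative of
    order [n] is bounded by [<x> ^ p] times that derivative with [p] about
    [delta * n], and in terms of the weighted supremum it grows like
    [(const * A ^ 2) ^ n * n! ^ s] with [s = mu + delta * nu <= 1]. If [s < 1], the
    [1 / N!] of the remainder wins as soon as [N] exceeds a multiple of
    [A ^ (2 / (1 - s))], and one interpolation suffices; its constant is
    exponential in [N]. If [s = 1] the factorials cancel, and smallness can only
    come from shorter segments: the segment is cut into [M] pieces, [M] being a
    multiple of [A ^ 2], of which one keeps its share of [E]; the control spreads
    from this piece to its neighbours, one step at a time ([line_chain]). Each step
    multiplies the exponent of the constant, which becomes [T ^ M] and yields the
    double exponential.

    Tolerances. To chain such inequalities, the error of one must be made small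
    with respect to the constant of the next. The notion [ctrl w X T Q] records an
    inequality available at every tolerance [eta] with the constant
    [exp (T * (1 - ln eta + X))], where [X] is [A ^ (2 / (1 - s))] or [ln A];
    composition multiplies the exponents [T] ([ctrl_comp]), and integration with
    respect to parameters preserves them ([ctrl_integral]).

    Dimension. A subset [E] of positive density in a box meets many lines parallel
    to the first axis in positive density, by Fubini. These good lines are
    controlled by [E], and by induction on the dimension the box is controlled by
    the good lines ([box_obsS]). Only pure derivatives occur.

    Globalisation. Since [rho] is a contraction with constant less than 1, it is
    comparable to a constant on balls slightly larger than [B(x, rho x)]. There
    thickness and the pigeonhole principle give a box around [x] in which [omega]
    has a fixed density, and boxes chosen according to the dyadic size of [rho] and
    a grid of that size overlap boundedly ([covering]). Summing over the boxes
    gives [main_estimate]. *)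

(** * Remainder of Lagrange interpolation *)

Lemma rolle_path (R : realType) (f df : R -> R) (x : R) (s : seq R) :
  (forall t, is_derive t (1 : R) f (df t)) ->
  path <%R x s -> all (fun t => f t == 0) (x :: s) ->
  exists s' : seq R, [/\ size s' = size s, path <%R x s',
    all (fun t => df t == 0) s' & all (fun t => t <= last x s) s'].
Proof.
move=> Hf; elim: s x => [|y s IH] x /=; first by exists [::].
move=> /andP[xy ys] /and3P[/eqP fx /eqP fy fs].
have [s' [ss' ps' zs' ls']] := IH y ys (introT andP (conj (introT eqP fy) fs)).
have [c] : exists2 c, c \in `]x, y[%R & is_derive c 1 f 0.
  apply: Rolle; [exact: xy | by move=> t _; case: (Hf t) | | by rewrite fx fy].
  by apply: derivable_within_continuous => t _; case: (Hf t).
rewrite in_itv /= => /andP[xc cy] dc.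
exists (c :: s'); split => /=.
- by rewrite ss'.
- rewrite xc /=; case: s' ps' {ss' zs' ls'} => //= z s' /andP[yz ->].
  by rewrite (lt_trans cy yz).
- rewrite zs' andbT; apply/eqP.
  have := Hf c => /@derive_val <-; exact: (@derive_val _ _ _ _ _ _ _ dc).
- rewrite ls' andbT; apply: (le_trans (ltW cy)).
  have := ys; rewrite lt_path_sortedE => /andP[/allP H _].
  have := mem_last y s; rewrite inE => /orP[/eqP ->//|/H /ltW//].
Qed.

(** Carrying the derivatives as a sequence, instead of iterating a derivation
    operator, allows the restrictions to lines of the partial derivatives of a
    function of several variables to be used as they are. *)
Definition deriv_chain (R : realType) (g : nat -> R -> R) : Prop :=
  forall n t, is_derive t (1 : R) (g n) (g n.+1 t).

(** Rolle applied [n] times: each differentiation loses one of the [n.+1] zeros. *)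
Lemma rolle_iter (R : realType) (g : nat -> R -> R) (a b : R) (n k : nat)
    (s : seq R) : deriv_chain g -> sorted <%R s -> size s = n.+1 ->
  all (fun t => g k t == 0) s -> all (fun t => a <= t <= b) s ->
  exists2 c, a <= c <= b & g (k + n)%N c = 0.
Proof.
move=> Hg; elim: n k s => [|n IH] k [//|x s] /= ps.
  case: s ps => // _ _ /andP[/eqP gx _] /andP[abx _].
  by exists x => //; rewrite addn0.
move=> [] ss zs abs.
have [s' [ss' ps' zs' ls']] := rolle_path (Hg k) ps zs.
have Hs' : all (fun t => a <= t <= b) s'.
  apply/allP => t ts'.
  have xt : x < t.
    by have := ps'; rewrite lt_path_sortedE => /andP[/allP H _]; exact: H.
  have tl := allP ls' _ ts'.
  have /andP[al lb] : a <= last x s <= b.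
    have /allP H : all (fun t => a <= t <= b) (x :: s) := abs.
    exact/H/mem_last.
  have /andP[ax xb] : a <= x <= b by case/andP: abs.
  by rewrite (le_trans ax (ltW xt)) (le_trans tl lb).
rewrite addnS -addSn; apply: (IH k.+1 s') => //; last by rewrite ss' ss.
exact: path_sorted ps'.
Qed.

(** Remainder of Lagrange interpolation, in norm. Let [L] be the interpolation
    polynomial and [W] the monic polynomial vanishing at the nodes. With
    [c = (g 0 t - L(t)) / W(t)], the function [g 0 - L - c W] vanishes at the
    nodes and at [t], so its [N]-th derivative [g N - c N!] vanishes somewhere:
    the error [c W(t)] is [g N xi / N! * W(t)]. *)
Lemma interpolation_error (R : realType) (g : nat -> R -> R) (a b M t : R)
    (N : nat) (x : nat -> R) : deriv_chain g ->
  (forall i j, (i < j < N)%N -> x i < x j) ->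
  (forall i, (i < N)%N -> a <= x i <= b) -> a <= t <= b ->
  (forall c, a <= c <= b -> `|g N c| <= M) ->
  `|g 0%N t| <= \sum_(i < N) `|g 0%N (x i)| *
      \prod_(j < N | j != i) (`|t - x j| / `|x i - x j|)
    + M / N`!%:R * \prod_(i < N) `|t - x i|.
Proof.
move=> Hg xlt xab tab gM.
have xneq (i j : 'I_N) : i != j -> x i != x j.
  rewrite -val_eqE neq_ltn => /orP[] h.
    by rewrite lt_eqF // xlt // h ltn_ord.
  by rewrite gt_eqF // xlt // h ltn_ord.
pose ell (i : 'I_N) : {poly R} :=
  \prod_(j < N | j != i) ((x i - x j)^-1 *: ('X - (x j)%:P)).
pose L := \sum_(i < N) g 0%N (x i) *: ell i.
pose W : {poly R} := \prod_(i < N) ('X - (x i)%:P).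
have ellE i u : (ell i).[u] = \prod_(j < N | j != i) ((u - x j) / (x i - x j)).
  rewrite /ell horner_prod; apply: eq_bigr => j _.
  by rewrite hornerZ hornerXsubC mulrC.
have LE (i : 'I_N) : L.[x i] = g 0%N (x i).
  rewrite /L horner_sum (bigD1 i) //= big1 ?addr0 => [|k ki].
    rewrite hornerZ ellE big1 ?mulr1 // => j ji.
    by rewrite divff // subr_eq0 xneq // eq_sym.
  rewrite hornerZ ellE (bigD1 i) /=; last by rewrite eq_sym.
  by rewrite subrr mul0r mul0r mulr0.
have WE u : W.[u] = \prod_(i < N) (u - x i).
  by rewrite /W horner_prod; apply: eq_bigr => i _; rewrite hornerXsubC.
have szL : (size L <= N)%N.
  apply: (leq_trans (size_sum _ _ _)); apply/bigmax_leqP => i _.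
  apply: (leq_trans (size_scale_leq _ _)).
  rewrite /ell scaler_prod; apply: (leq_trans (size_scale_leq _ _)).
  apply: (leq_trans (size_prod_leq _ _)).
  rewrite (eq_bigr (fun=> 2%N)) => [|j _]; last by rewrite size_XsubC.
  rewrite sum_nat_const (_ : #|_| = N.-1); last by rewrite cardC1 card_ord.
  by have := ltn_ord i; lia.
have szW : (size (W - 'X^N)%R <= N)%N.
  have sW : size W = N.+1 by rewrite /W size_prod_XsubC /index_enum -enumT size_enum_ord.
  have mW : W \is monic by exact: monic_prod_XsubC.
  apply/leq_sizeP => j; rewrite leq_eqVlt => /orP[/eqP <-|Nj].
    rewrite coefB coefXn eqxx; have := mW.
    by rewrite monicE /lead_coef sW /= => /eqP ->; rewrite subrr.
  by rewrite coefB coefXn (gtn_eqF Nj) subr0 nth_default // sW.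
have dW u : (derivn N W).[u] = N`!%:R.
  rewrite -(subrK 'X^N W) derivnD derivn_poly0 // add0r derivnXn subnn expr0.
  by rewrite ffactnn hornerMn hornerC.
(* If [t] is a node the remainder vanishes and the sum reduces to [g 0 t]. *)
have [/eqP Wt0|Wt0] := boolP (W.[t] == 0).
  have /eqP := Wt0; rewrite WE prodf_seq_eq0 => /hasP[i _ /=]; rewrite subr_eq0 => /eqP ti.
  rewrite [X in _ <= _ + X](_ : _ = 0); last first.
    by rewrite (bigD1 i) //= ti subrr normr0 mul0r mulr0.
  rewrite addr0 (bigD1 i) //= [X in _ * X]big1; last first.
    by move=> j ji; rewrite ti divff // normr_eq0 subr_eq0 xneq // eq_sym.
  rewrite mulr1 ti lerDl; apply: sumr_ge0 => j _; apply: mulr_ge0 => //.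
  by apply: prodr_ge0 => k _; apply: divr_ge0.
pose c := (g 0%N t - L.[t]) / W.[t].
pose p := L + c *: W.
pose phi n u := g n u - (derivn n p).[u].
have Hphi : deriv_chain phi.
  move=> n u; rewrite /phi derivnS; apply: is_deriveB; exact: Hg.
pose s0 := t :: [seq x i | i : 'I_N].
have us0 : uniq s0.
  rewrite /= map_inj_in_uniq ?enum_uniq ?andbT; last first.
    move=> i j _ _ /eqP xij; apply/eqP; apply: contraLR xij; exact: xneq.
  apply/negP => /mapP[i _ ti]; move/negP: Wt0; apply; apply/eqP.
  by rewrite WE (bigD1 i) //= ti subrr mul0r.
have [] := @rolle_iter _ phi a b N 0%N (sort <=%R s0) Hphi.
- by rewrite sort_lt_sorted.
- by rewrite size_sort /= size_map size_enum_ord.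
- rewrite all_sort /=; apply/andP; split.
    rewrite /phi derivn0 /p hornerD hornerZ /c divfK //.
    by apply/eqP; ring.
  apply/allP => _ /mapP[i _ ->]; rewrite /phi derivn0 /p hornerD hornerZ LE WE.
  by rewrite (bigD1 i) //= subrr mul0r mulr0 addr0 subrr.
- rewrite all_sort /= tab; apply/allP => _ /mapP[i _ ->]; exact: xab.
move=> xi xiab; rewrite add0n /phi => /eqP.
rewrite /p derivnD derivnZ derivn_poly0 // add0r hornerZ dW subr_eq0 => /eqP gNxi.
have gt : g 0%N t = L.[t] + g N xi / N`!%:R * W.[t].
  rewrite gNxi mulfK; last by rewrite pnatr_eq0 -lt0n fact_gt0.
  by rewrite /c divfK //; ring.
rewrite gt; apply: (le_trans (ler_normD _ _)); apply: lerD.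
  rewrite /L horner_sum; apply: (le_trans (ler_norm_sum _ _ _)).
  apply: ler_sum => i _; rewrite hornerZ normrM ellE normr_prod.
  by under [X in _ * X <= _]eq_bigr => j _ do rewrite normrM normfV.
rewrite normrM WE normr_prod ler_wpM2r ?prodr_ge0 //.
rewrite normrM normfV [X in _ / X]ger0_norm //.
by rewrite ler_wpM2r ?invr_ge0 // gM.
Qed.

(** * Square integrals on a segment *)

Definition sqint d (T : measurableType d) (R : realType)
    (mu : {measure set T -> \bar R}) (D : set T) (f : T -> R) : \bar R :=
  (\int[mu]_(x in D) ((f x) ^+ 2)%:E)%E.

Lemma sqint_ge0 d (T : measurableType d) (R : realType)
  (mu : {measure set T -> \bar R}) D (f : T -> R) : (0 <= sqint mu D f)%E.
Proof. by apply: integral_ge0 => x _; rewrite lee_fin sqr_ge0. Qed.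

Lemma measurable_sqr d (T : measurableType d) (R : realType) (D : set T)
  (f : T -> R) : measurable_fun D f ->
  measurable_fun D (fun x => ((f x) ^+ 2)%:E).
Proof. by move=> mf; apply/measurable_EFinP; exact: measurable_funX. Qed.

Lemma sqint_subset d (T : measurableType d) (R : realType)
    (mu : {measure set T -> \bar R}) (D D' : set T) (f : T -> R) :
  measurable D -> measurable D' -> measurable_fun D' f -> D `<=` D' ->
  (sqint mu D f <= sqint mu D' f)%E.
Proof.
move=> mD mD' mf DD'; apply: ge0_subset_integral => //.
  exact: measurable_sqr.
by move=> x _; rewrite lee_fin sqr_ge0.
Qed.

Lemma integral_sqrD d (T : measurableType d) (R : realType)
    (mu : {measure set T -> \bar R}) (D : set T) (c1 c2 : R) (f h : T -> R) :
  measurable D -> measurable_fun D f -> measurable_fun D h ->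
  0 <= c1 -> 0 <= c2 ->
  (\int[mu]_(x in D) (c1 * f x ^+ 2 + c2 * h x ^+ 2)%:E =
   c1%:E * sqint mu D f + c2%:E * sqint mu D h)%E.
Proof.
move=> mD mf mh c10 c20.
under eq_integral => x _ do rewrite EFinD (EFinM c1) (EFinM c2).
have sq0 (k : T -> R) x : (0 <= ((k x) ^+ 2)%:E)%E by rewrite lee_fin sqr_ge0.
have msq (k : T -> R) c : measurable_fun D k ->
    measurable_fun D (fun x => c%:E * ((k x) ^+ 2)%:E)%E.
  by move=> mk; apply: measurable_funeM; exact: measurable_sqr.
rewrite ge0_integralD //; [|by move=> *; exact: mule_ge0|exact: msq|
  by move=> *; exact: mule_ge0|exact: msq].
by rewrite !ge0_integralZl //; exact: measurable_sqr.
Qed.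

Section deriv_chain.
Context (R : realType).
Implicit Types (g : nat -> R -> R) (a b : R).
Notation lam := (@lebesgue_measure R).

Lemma deriv_chain_continuous g n : deriv_chain g -> continuous (g n).
Proof.
by move=> Hg t; apply/differentiable_continuous/derivable1_diffP; case: (Hg n t).
Qed.

Lemma deriv_chain_measurable g n : deriv_chain g -> measurable_fun setT (g n).
Proof.
by move=> Hg; apply: continuous_measurable_fun; exact: deriv_chain_continuous.
Qed.

Lemma sqint_fin g n a b : deriv_chain g -> sqint lam `[a, b] (g n) \is a fin_num.
Proof.
move=> Hg; apply: integrable_fin_num => //.
apply: (@continuous_compact_integrable R (fun x => g n x ^+ 2)).
  exact: segment_compact.
apply: continuous_subspaceT => x.
by apply: continuousM; exact: deriv_chain_continuous.
Qed.

Lemma lebesgue_segment a b : a <= b -> lam `[a, b] = (b - a)%:E.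
Proof.
move=> ab; rewrite lebesgue_measure_itv /= lte_fin.
by case: ltgtP ab => // -> _; rewrite subrr.
Qed.

(** The derivative of [g n ^ 2] is [2 * g n * g n.+1], at most
    [g n ^ 2 / l + l * g n.+1 ^ 2] for [l = b - a]; with these
    weights both terms scale alike under dilation. *)
Lemma sqr_increment g n a b u v : deriv_chain g -> a < b ->
  a <= u -> u < v -> v <= b ->
  (`|((g n v) ^+ 2 - (g n u) ^+ 2)%:E| <=
   (b - a)^-1%:E * sqint lam `[a, b] (g n) +
   (b - a)%:E * sqint lam `[a, b] (g n.+1))%E.
Proof.
move=> Hg ab au uv vb.
pose F x := (g n x) ^+ 2; pose f x := 2 * g n x * g n.+1 x.
have dF x : is_derive x (1:R) F (f x).
  have -> : F = g n * g n by apply/funext => y; rewrite /F fctE expr2.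
  have dg := Hg n x; apply: is_derive_eq.
  by rewrite /f /GRing.scale /=; ring.
have cf : continuous f.
  rewrite /f => x; apply: cvgM; last exact: deriv_chain_continuous.
  by apply: cvgM; [exact: cvg_cst | exact: deriv_chain_continuous].
have mg k := deriv_chain_measurable k Hg.
have mS (S : set R) k : measurable_fun S (g k) by exact: measurable_funTS.
have -> : ((F v - F u)%:E = \int[lam]_(x in `[u, v]) (f x)%:E)%E.
  rewrite EFinB; apply/esym/continuous_FTC2 => //.
  - by apply: continuous_subspaceT.
  - have cF : continuous F.
      by rewrite /F => x; apply: cvgM; exact: deriv_chain_continuous.
    split; first by move=> x _; case: (dF x).
      by apply/cvg_at_right_filter; exact: cF.
    by apply/cvg_at_left_filter; exact: cF.
  - by move=> x _; rewrite derive1E; apply: derive_val; exact: dF.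
have mf : measurable_fun `[u, v] (fun x => (f x)%:E).
  apply/measurable_EFinP; apply: measurable_funTS.
  exact: continuous_measurable_fun.
have muv : measurable (`[u, v] : set R) by [].
apply: (le_trans (le_abse_integral lam muv mf)).
pose G x := ((b - a)^-1 * (g n x) ^+ 2 + (b - a) * (g n.+1 x) ^+ 2)%:E.
have mG (S : set R) : measurable_fun S G.
  apply/measurable_EFinP; apply: measurable_funD; apply: measurable_funM => //;
  exact: measurable_funX.
have G0 x : (0 <= G x)%E.
  rewrite lee_fin addr_ge0 // mulr_ge0 ?sqr_ge0 ?invr_ge0 // subr_ge0 ltW //.
have le1 : (\int[lam]_(x in `[u, v]) `|(f x)%:E| <= \int[lam]_(x in `[u, v]) G x)%E.
  apply: ge0_le_integral => //.
  - by apply: measurableT_comp.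
  - exact: mG.
  - move=> x _; rewrite lee_fin /f !normrM (ger0_norm (ler0n _ 2)).
    rewrite -[X in _ <= _ * X + _]real_normK ?num_real //.
    rewrite -[X in _ <= _ + _ * X]real_normK ?num_real //.
    set p := `|g n x|; set q := `|g n.+1 x|.
    have l0 : 0 < b - a by rewrite subr_gt0.
    rewrite -subr_ge0.
    have -> : (b - a)^-1 * p ^+ 2 + (b - a) * q ^+ 2 - 2 * p * q
            = (b - a)^-1 * (p - (b - a) * q) ^+ 2 by field; rewrite gt_eqF.
    by rewrite mulr_ge0 ?sqr_ge0 // invr_ge0 ltW.
apply: (le_trans le1).
apply: (@le_trans _ _ (\int[lam]_(x in `[a, b]) G x)%E).
  apply: ge0_subset_integral => //.
    exact: mG.
  move=> x /=; rewrite !in_itv /= => /andP[ux xv].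
  by rewrite (le_trans au ux) (le_trans xv vb).
by rewrite integral_sqrD ?invr_ge0 ?subr_ge0 ?(ltW ab) //; exact: mS.
Qed.

(** Sobolev embedding on a segment: the minimum of [g n ^ 2] is below its mean,
    and the increment from the minimum is controlled by [sqr_increment]. *)
Lemma sup_sqr_le g n a b t : deriv_chain g -> a < b -> a <= t <= b ->
  (((g n t) ^+ 2)%:E <= (2 / (b - a))%:E * sqint lam `[a, b] (g n)
    + (b - a)%:E * sqint lam `[a, b] (g n.+1))%E.
Proof.
move=> Hg ab /andP[at_ tb].
have [|y] := @EVT_min R (fun x => (g n x) ^+ 2) a b (ltW ab).
  apply: continuous_subspaceT => x.
  by apply: continuousM; exact: deriv_chain_continuous.
rewrite in_itv /= => /andP[ay yb] ymin.
have l0 : 0 < b - a by rewrite subr_gt0.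
have gy : (((g n y) ^+ 2)%:E <= (b - a)^-1%:E * sqint lam `[a, b] (g n))%E.
  have lK z : ((b - a)%:E * ((b - a)^-1%:E * z) = z)%E.
    by rewrite muleA -EFinM divff ?gt_eqF // mul1e.
  rewrite -(@lee_pmul2l _ (b - a)%:E) // lK muleC -(lebesgue_segment (ltW ab)) -integral_cst //.
  apply: ge0_le_integral => //.
  - by move=> x _; rewrite lee_fin sqr_ge0.
  - exact: measurable_sqr (measurable_funTS (deriv_chain_measurable n Hg)).
have inc : (`|((g n t) ^+ 2 - (g n y) ^+ 2)%:E| <=
   (b - a)^-1%:E * sqint lam `[a, b] (g n) +
   (b - a)%:E * sqint lam `[a, b] (g n.+1))%E.
  case: (ltgtP y t) => [yt|ty|->].
  - exact: sqr_increment.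
  - by rewrite -abseN -EFinN opprB; exact: sqr_increment.
  - rewrite subrr abse0 adde_ge0 // mule_ge0 ?sqint_ge0 // lee_fin ?invr_ge0 ltW //.
have -> : (g n t) ^+ 2 = (g n y) ^+ 2 + ((g n t) ^+ 2 - (g n y) ^+ 2) by rewrite addrC subrK.
rewrite EFinD.
have -> : (2 / (b - a))%:E = ((b - a)^-1%:E + (b - a)^-1%:E)%E.
  by rewrite -EFinD mulr_natl mulr2n.
rewrite ge0_muleDl ?lee_fin ?invr_ge0 ?(ltW l0) // -addeA; apply: leeD => //.
by apply: le_trans inc; rewrite lee_abs.
Qed.

(** Greedy choice: take a point within [tau] of the infimum and discard what lies
    within [tau] of it. Each point costs a measure of at most [2 * tau]. *)
Lemma separated_points (S : set R) (a tau : R) (N : nat) : 0 < tau ->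
  measurable S -> (forall t, S t -> a <= t) ->
  ((N%:R * (2 * tau))%:E <= lam S)%E ->
  exists x : nat -> R, (forall i, (i < N)%N -> S (x i)) /\
    forall i j, (i < j < N)%N -> x i + tau * (j - i)%:R <= x j.
Proof.
move=> tau0; elim: N S => [|N IH] S mS Sa lS.
  by exists (fun=> 0); split=> // i j; rewrite ltn0 andbF.
have S0 : S !=set0.
  apply/set0P/eqP => S0; move: lS; rewrite S0 measure0 lee_fin leNgt.
  by rewrite mulr_gt0 // ?mulr_gt0 // ltr0n.
have [|x0 Sx0 x0s] := @inf_adherent R S tau tau0.
  by split => //; exists a.
pose S' := S `&` `[x0 + tau, +oo[.
have mS' : measurable S' by exact: measurableI.
have infS t : S t -> inf S <= t by move=> St; apply: ge_inf => //; exists a.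
have [||x' [Sx' x'sep]] := IH S' mS'.
- by move=> t [/Sa].
- have SS : (lam S <= lam `[inf S, (x0 + tau)%R] + lam S')%E.
    apply: le_trans (measureU2 _ _ _) => //.
    apply: le_measure; rewrite ?inE //; first exact: measurableU.
    move=> t St; have [h|h] := leP t (x0 + tau).
      by left; rewrite /= in_itv /= h andbT; exact: infS.
    by right; split => //; rewrite /= in_itv /= andbT ltW.
  have := le_trans lS SS; rewrite lebesgue_segment; last first.
    by rewrite (le_trans (infS _ Sx0)) // lerDl ltW.
  move=> H; have : ((N.+1%:R * (2 * tau))%:E <= (2 * tau)%:E + lam S')%E.
    by apply: (le_trans H); apply: leeD2r; rewrite lee_fin; lra.
  rewrite -leeBlDl // -EFinB.
  by rewrite -natr1 mulrDl mul1r addrK.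
exists (fun i => if i is k.+1 then x' k else x0); split=> [[|i] iN //|[|i] [|j] //].
  by move: iN; rewrite ltnS => /Sx'[].
- rewrite subn0 ltnS => jN.
  have [_] := Sx' 0%N (leq_ltn_trans (leq0n j) jN); rewrite /= in_itv /= andbT => h0.
  case: j jN => [|j] jN; first by rewrite mulr1.
  have := x'sep 0%N j.+1; rewrite jN subn0 => /(_ isT) h1.
  by rewrite -natr1; lra.
- by rewrite !ltnS subSS; exact: x'sep.
Qed.
End deriv_chain.

(** * One interpolation step on a segment *)

(** Half of the Stirling formula; [(1 + 1/n) ^ n <= e] is the induction step. *)
Lemma expnn_le_fact (R : realType) (N : nat) :
  (N%:R ^+ N : R) <= expR N%:R * N`!%:R.
Proof.
elim: N => [|N IH]; first by rewrite expr0 expR0 fact0 mul1r.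
case: N IH => [|N] IH.
  by rewrite expr1 mulr1 (le_trans _ (expR_ge1Dx 1)) // lerDl.
set n := N.+1 in IH *.
have n0 : 0 < n%:R :> R by rewrite ltr0n.
have h1 : n.+1%:R = n%:R * (1 + n%:R^-1) :> R.
  by rewrite mulrDr mulr1 divff ?gt_eqF // natr1.
have h2 : (1 + n%:R^-1 : R) ^+ n <= expR 1.
  rewrite -[X in expR X](@divff _ n%:R) ?gt_eqF // mulrC expRM_natr.
  by rewrite lerXn2r ?nnegrE ?expR_ge0 ?addr_ge0 ?invr_ge0 ?expR_ge1Dx.
have -> : n.+1%:R ^+ n.+1 = n.+1%:R * ((1 + n%:R^-1) ^+ n * n%:R ^+ n) :> R.
  by rewrite exprS [in X in _ * X = _]h1 exprMn [X in _ * X]mulrC.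
have -> : expR n.+1%:R * n.+1`!%:R
    = n.+1%:R * (expR 1 * (expR n%:R * n`!%:R)) :> R.
  by rewrite factS natrM -[in X in expR X]natr1 expRD; ring.
by rewrite ler_wpM2l // ler_pM ?exprn_ge0 ?ler0n ?addr_ge0 ?invr_ge0.
Qed.

Lemma prod_subn (i : nat) : (\prod_(0 <= j < i) (i - j) = i`!)%N.
Proof.
elim: i => [|i IH]; first by rewrite big_geq.
by rewrite big_nat_recl // subn0 factS -IH.
Qed.

(** The denominator of the [i]-th Lagrange coefficient for the nodes [0 .. N-1];
    [(i - j) + (j - i)] is the distance, one of the two truncated differences
    being zero. *)
Lemma prod_dist (N i : nat) : (i < N)%N ->
  (\prod_(j < N | val j != i) ((i - j) + (j - i)) = i`! * (N.-1 - i)`!)%N.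
Proof.
move=> iN.
rewrite -(big_mkord (fun j => j != i) (fun j => (i - j) + (j - i))%N).
rewrite (@big_cat_nat _ _ _ i) ?(ltnW iN) //=.
rewrite [X in (_ * X)%N](@big_ltn_cond _ _ _ i) // eqxx /=.
congr (_ * _)%N.
  rewrite -prod_subn big_nat_cond [RHS]big_nat_cond.
  by apply: eq_big => j; lia.
rewrite -[i.+1]add1n big_addn fact_prod (_ : (N.-1 - i).+1 = N - i)%N; last by lia.
rewrite big_nat_cond [RHS]big_nat_cond.
by apply: eq_big => j; lia.
Qed.

(** Nodes that are [tau]-separated are at least as far apart as those of an
    arithmetic progression of step [tau], for which the denominators are
    [tau ^ N.-1 * i! * (N.-1 - i)!]; the binomial coefficients that appear add
    up to [2 ^ N.-1]. *)
Lemma lagrange_coef_bound (R : realType) (N : nat) (x : nat -> R) (tau l t : R) :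
  0 < tau -> 0 <= l ->
  (forall i j, (i < j < N)%N -> x i + tau * (j - i)%:R <= x j) ->
  (forall i, (i < N)%N -> `|t - x i| <= l) -> (0 < N)%N ->
  \sum_(i < N) \prod_(j < N | j != i) (`|t - x j| / `|x i - x j|)
  <= (2 * l / tau) ^+ N.-1 / (N.-1)`!%:R.
Proof.
move=> tau0 l0 xsep tx N0.
have dist (i j : 'I_N) : i != j -> tau * ((i - j) + (j - i))%:R <= `|x i - x j|.
  rewrite -val_eqE neq_ltn => /orP[] ij.
    rewrite (eqP (ltnW ij)) add0n distrC; apply: le_trans (ler_norm _).
    by rewrite lerBrDl; apply: xsep; rewrite ij ltn_ord.
  rewrite (eqP (ltnW ij)) addn0; apply: le_trans (ler_norm _).
  by rewrite lerBrDl; apply: xsep; rewrite ij ltn_ord.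
have step (i : 'I_N) : \prod_(j < N | j != i) (`|t - x j| / `|x i - x j|) <=
   (l / tau) ^+ N.-1 / (N.-1)`!%:R * ('C(N.-1, i))%:R.
  have iN : (i <= N.-1)%N by have := ltn_ord i; lia.
  apply: (@le_trans _ _ (\prod_(j < N | j != i) ((l / tau) * (((i - j) + (j - i))%:R)^-1))).
    apply: ler_prod => j ji; rewrite divr_ge0 //=.
    have d0 : (0 : R) < ((i - j) + (j - i))%:R.
      by rewrite ltr0n; move: ji; rewrite -val_eqE /=; lia.
    rewrite -mulrA -invfM; apply: ler_pM => //; first exact: tx.
    have p0 : 0 < tau * ((i - j) + (j - i))%:R by rewrite mulr_gt0.
    rewrite lef_pV2 ?posrE //; first by apply: dist; rewrite eq_sym.
    by apply: lt_le_trans p0 _; apply: dist; rewrite eq_sym.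
  rewrite big_split /= prodr_const cardC1 card_ord -mulrA ler_wpM2l //.
    by rewrite exprn_ge0 // divr_ge0 // ltW.
  rewrite prodfV -natr_prod prod_dist ?ltn_ord // -(bin_fact iN) !natrM.
  have f0 k : k`!%:R != 0 :> R by rewrite pnatr_eq0 -lt0n fact_gt0.
  have c0 : 'C(N.-1, i)%:R != 0 :> R by rewrite pnatr_eq0 -lt0n bin_gt0.
  by rewrite !invfM mulrAC mulVf // mul1r.
apply: (le_trans (ler_sum _ (fun i _ => step i))).
rewrite -mulr_sumr -natr_sum.
have -> : (\sum_(i < N) 'C(N.-1, i) = 2 ^ N.-1)%N.
  case: (N) N0 => // n _ /=; rewrite -[2%N]/(1 + 1)%N expnDn.
  by apply: eq_bigr => i _; rewrite !exp1n !muln1.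
by rewrite natrX mulrAC -exprMn [l / tau * 2]mulrC mulrA.
Qed.

Section one_step.
Context (R : realType).
Notation lam := (@lebesgue_measure R).

(** Chebyshev: the points where [f ^ 2 > 2 * m / c] have measure at most [c / 2]. *)
Lemma large_subset_small_values (E : set R) (f : R -> R) (c m : R) :
  measurable E -> measurable_fun setT f -> 0 < c -> 0 < m ->
  (c%:E <= lam E)%E -> (sqint lam E f <= m%:E)%E ->
  let E' := E `&` [set t | f t ^+ 2 <= 2 * m / c] in
  measurable E' /\ ((c / 2)%:E <= lam E')%E.
Proof.
move=> mE mf c0 m0 cE fm E'.
have mf2 D : measurable_fun D (fun t => f t ^+ 2).
  by apply: measurable_funX; exact: measurable_funTS.
have mE' : measurable E'.
  apply: (@measurable_fun_le _ _ _ E (fun t => f t ^+ 2) (cst (2 * m / c))) => //.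
pose F := E `\` E'.
have mF : measurable F by exact: measurableD.
have Fgt t : F t -> 2 * m / c <= f t ^+ 2.
  by move=> [Et nE']; rewrite leNgt; apply/negP => /ltW h; exact: nE'.
split=> //.
have cm0 : 0 < 2 * m / c by rewrite divr_gt0 // mulr_gt0.
have lF : (lam F <= (c / 2)%:E)%E.
  rewrite -(@lee_pmul2l _ (2 * m / c)%:E) // -EFinM.
  have -> : 2 * m / c * (c / 2) = m by field; rewrite gt_eqF.
  apply: le_trans fm; rewrite -integral_cst //.
  apply: (@le_trans _ _ (sqint lam F f)).
    apply: ge0_le_integral => //.
    - by move=> t _; rewrite lee_fin ltW.
    - exact: measurable_sqr (measurable_funTS mf).
  by apply: sqint_subset => //; [exact: measurable_funTS | move=> t []].
have : (lam E <= lam E' + lam F)%E.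
  apply: le_trans (measureU2 _ _ _) => //.
  apply: le_measure; rewrite ?inE //; first exact: measurableU.
  by move=> t Et; have [h|h] := pselect (E' t); [left | right].
move=> /(le_trans cE) /le_trans/(_ (leeD2l _ lF)).
by rewrite -leeBlDr // -EFinB {1}[c]splitr addrK.
Qed.

(** The basic step, with the order [N] left free. Half of [E], by measure, consists
    of points where [g 0] is at most of the order of its mean on [E]; interpolate
    at [N] of them at mutual distance [tau = gam * l / (4 * N)]. The sum of the
    Lagrange coefficients is then at most [(8 * N / gam) ^ N.-1 / (N.-1)!], hence
    exponential in [N], while the remainder carries [l ^ N / N!] and the supremum
    of [g N], which is turned into square integrals by [sup_sqr_le]. *)
Lemma observability_step (g : nat -> R -> R) (a b gam : R) (E : set R) (N : nat) :
  deriv_chain g -> a < b -> 0 < gam <= 1 -> measurable E -> E `<=` `[a, b] ->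
  ((gam * (b - a))%:E <= lam E)%E -> (0 < N)%N ->
  (sqint lam `[a, b] (g 0%N) <=
   ((8 * expR 1 / gam) ^+ (2 * N))%:E * sqint lam E (g 0%N) +
   ((b - a) ^+ (2 * N) / N`!%:R ^+ 2)%:E *
     (4%:E * sqint lam `[a, b] (g N) +
      (2 * (b - a) ^+ 2)%:E * sqint lam `[a, b] (g N.+1)))%E.
Proof.
move=> Hg ab /andP[gam0 gam1] mE Eab lE N0.
have l0 : 0 < b - a by rewrite subr_gt0.
set l := b - a in l0 lE *.
have mg k := deriv_chain_measurable k Hg.
set Lam := (8 * expR 1 / gam) ^+ (2 * N).
have Lam0 : 0 < Lam by rewrite exprn_gt0 // divr_gt0 // mulr_gt0 ?expR_gt0.
set J := sqint lam `[a, b] (g N); set J' := sqint lam `[a, b] (g N.+1).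
have fJ : J \is a fin_num by exact: sqint_fin.
have fJ' : J' \is a fin_num by exact: sqint_fin.
have J0 : (0 <= J)%E by exact: sqint_ge0.
have J'0 : (0 <= J')%E by exact: sqint_ge0.
have EJ : J = (fine J)%:E by rewrite fineK.
have EJ' : J' = (fine J')%:E by rewrite fineK.
have j0 : 0 <= fine J by rewrite -lee_fin -EJ.
have j'0 : 0 <= fine J' by rewrite -lee_fin -EJ'.
set j := fine J in EJ j0; set j' := fine J' in EJ' j'0.
have fE : sqint lam E (g 0%N) \is a fin_num.
  rewrite ge0_fin_numE ?sqint_ge0 //.
  apply: le_lt_trans (_ : sqint lam `[a, b] (g 0%N) < +oo)%E.
    by apply: sqint_subset => //; exact: measurable_funTS (mg _).
  by rewrite -ge0_fin_numE ?sqint_ge0 //; exact: sqint_fin.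
rewrite EJ EJ' -[sqint lam E _](fineK fE) -!EFinM -EFinD.
(* The slack [e] makes the mean [m] positive, so that points with
   [g 0 ^ 2 <= 2 * m / (gam * l)] exist even if [g 0] vanishes on [E]. *)
apply/lee_addgt0Pr => e e0.
set m0 := fine _; pose m := m0 + e / Lam.
have m00 : 0 <= m0 by rewrite fine_ge0 // sqint_ge0.
have m_gt0 : 0 < m by rewrite ltr_wpDl // divr_gt0.
have c0 : 0 < gam * l by rewrite mulr_gt0.
have [|mE' lE'] := @large_subset_small_values E (g 0%N) _ m mE (mg 0%N) c0 m_gt0 lE.
  by rewrite -(fineK fE) lee_fin -/m0 lerDl divr_ge0 // ltW.
set E' := E `&` _ in mE' lE'.
pose tau := gam * l / (4 * N%:R).
have N0R : (0 : R) < N%:R by rewrite ltr0n.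
have tau0 : 0 < tau by rewrite divr_gt0 // mulr_gt0.
have [||x [xE' xsep]] := @separated_points R E' a tau N tau0 mE'.
- by move=> t [/Eab]; rewrite /= in_itv /= => /andP[].
- apply: le_trans lE'; rewrite lee_fin /tau.
  by rewrite [leLHS](_ : _ = gam * l / 2) //; field; rewrite gt_eqF.
have xab i : (i < N)%N -> a <= x i <= b.
  by move=> /xE'[/Eab]; rewrite /= in_itv.
pose S := Num.sqrt (2 / l * j + l * j').
have S2 : S ^+ 2 = 2 / l * j + l * j'.
  by rewrite sqr_sqrtr // addr_ge0 // mulr_ge0 // ?divr_ge0 // ltW.
have gS c : a <= c <= b -> `|g N c| <= S.
  move=> cab; have := @sup_sqr_le R g N a b c Hg ab cab.
  rewrite -/J -/J' EJ EJ' -!EFinM -EFinD lee_fin -/l -S2 => h.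
  rewrite -(@ler_pXn2r _ 2) ?nnegrE ?sqrtr_ge0 // real_normK ?num_real //.
pose B := (8 / gam) ^+ N.-1 * expR N%:R.
pose th := Num.sqrt (2 * m / (gam * l)).
have th2 : th ^+ 2 = 2 * m / (gam * l).
  by rewrite sqr_sqrtr // divr_ge0 ?mulr_ge0 // ltW.
have gt t : a <= t <= b -> `|g 0%N t| <= B * th + S / N`!%:R * l ^+ N.
  move=> tab; have tx i : (i < N)%N -> `|t - x i| <= l.
    move=> /xab /andP[h1 h2]; case/andP: tab => h3 h4.
    by rewrite ler_norml /l; apply/andP; split; lra.
  apply: (le_trans (interpolation_error Hg _ xab tab gS)).
    move=> i k ik; apply: lt_le_trans (xsep _ _ ik).
    by rewrite ltrDl mulr_gt0 // ltr0n subn_gt0; case/andP: ik.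
  apply: lerD; last first.
    rewrite ler_wpM2l ?divr_ge0 ?sqrtr_ge0 //.
    apply: (@le_trans _ _ (\prod_(i < N) l)).
      by apply: ler_prod => i _; rewrite normr_ge0 /= tx.
    by rewrite prodr_const card_ord.
  apply: (@le_trans _ _ (\sum_(i < N) th * \prod_(j < N | j != i)
            (`|t - x j| / `|x i - x j|))).
    apply: ler_sum => i _; apply: ler_wpM2r.
      by apply: prodr_ge0 => k _; rewrite divr_ge0.
    have [_ /= h] := xE' i (ltn_ord i).
    rewrite -(@ler_pXn2r _ 2) ?nnegrE ?sqrtr_ge0 // real_normK ?num_real //.
    by rewrite th2.
  rewrite -mulr_sumr mulrC ler_wpM2r ?sqrtr_ge0 //.
  apply: (le_trans (lagrange_coef_bound tau0 (ltW l0) xsep tx N0)).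
  have -> : 2 * l / tau = 8 / gam * N%:R by rewrite /tau; field; rewrite !gt_eqF.
  rewrite exprMn /B -mulrA ler_wpM2l ?exprn_ge0 ?divr_ge0 // ?(ltW gam0) //.
  rewrite ler_pdivrMr ?ltr0n ?fact_gt0 //.
  have := expnn_le_fact R N.
  have -> : N%:R ^+ N = N%:R * N%:R ^+ N.-1 :> R by rewrite -exprS prednK.
  have -> : (N`! = N * (N.-1)`!)%N by case: (N) N0.
  by rewrite natrM mulrCA ler_pM2l.
have l2N : l ^+ (2 * N) = (l ^+ N) ^+ 2 by rewrite mulnC exprM.
pose D := 2 * (B * th) ^+ 2 + 2 * (S / N`!%:R * l ^+ N) ^+ 2.
apply: (@le_trans _ _ (D%:E * lam `[a, b])%E).
  rewrite -integral_cst //; apply: ge0_le_integral => //.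
  - by move=> t _; rewrite lee_fin sqr_ge0.
  - exact: measurable_sqr (measurable_funTS (mg _)).
  - move=> t; rewrite /= in_itv /= => /gt h; rewrite lee_fin -[X in X <= _]real_normK ?num_real //.
    have h2 := lerXn2r 2 (normr_ge0 _ : _ \in Num.nneg) (le_trans (normr_ge0 _) h) h.
    apply: (le_trans h2); rewrite /D -subr_ge0.
    by rewrite [X in 0 <= X](_ : _ = (B * th - S / N`!%:R * l ^+ N) ^+ 2) ?sqr_ge0 //; ring.
rewrite lebesgue_segment ?(ltW ab) // -/l -EFinM lee_fin.
have BL : 4 * B ^+ 2 / gam <= Lam.
  have -> : Lam = (8 / gam) ^+ (2 * N) * expR N%:R ^+ 2.
    rewrite -[X in expR X](mul1r N%:R) expRM_natr -exprM [(N * 2)%N]mulnC -exprMn.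
    by rewrite /Lam mulrAC.
  have -> : 4 * B ^+ 2 / gam = (8 / gam) ^+ (2 * N.-1) * (4 / gam) * expR N%:R ^+ 2.
    by rewrite /B exprMn [in RHS]mulnC exprM; ring.
  have g8 : 1 <= 8 / gam by rewrite ler_pdivlMr // mul1r; lra.
  apply: ler_wpM2r; first by rewrite exprn_ge0 // expR_ge0.
  apply: (@le_trans _ _ ((8 / gam) ^+ (2 * N.-1 + 1))).
    rewrite exprD expr1 ler_wpM2l ?exprn_ge0 ?(le_trans ler01 g8) //.
    by rewrite ler_wpM2r ?invr_ge0 ?(ltW gam0) // ler_nat.
  apply: ler_weXn2l => //.
  by case: (N) N0 => // n _; rewrite mulnS addn1 addnC addn2 leqnSn.
have lN0 : l != 0 by rewrite gt_eqF.
have f0 : N`!%:R != 0 :> R by rewrite pnatr_eq0 -lt0n fact_gt0.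
have -> : D * l = 4 * B ^+ 2 / gam * m +
    l ^+ (2 * N) / N`!%:R ^+ 2 * (4 * j + 2 * l ^+ 2 * j').
  by rewrite /D !exprMn th2 S2 l2N; field; rewrite f0 lN0 gt_eqF.
rewrite [X in _ <= X]addrAC; apply: lerD => //.
apply: (le_trans (ler_wpM2r (ltW m_gt0) BL)).
by rewrite /m mulrDr [_ * (e / _)]mulrCA divff ?gt_eqF // mulr1.
Qed.
End one_step.

(** * Inequalities with a tolerance *)

Lemma expR_ge1 (R : realType) (x : R) : (1 <= expR x) = (0 <= x).
Proof. by rewrite -[X in X <= _]expR0 ler_expR. Qed.

Section ctrl.
Context (R : realType) (w : nat -> R) (X : R).
Hypothesis (X0 : 0 <= X).
Implicit Types (Q : \bar R -> \bar R -> (nat -> \bar R) -> Prop) (s : seq (nat * R)).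

(** An error functional is a finite list of pairs (order of derivative,
    coefficient); [Z n] stands for the contribution of the derivatives of order
    [n]. The weight [w n] is what [Z n] is eventually compared with, so that
    [cost] is the final coefficient of the error. *)
Definition err s (Z : nat -> \bar R) : \bar R := (\sum_(p <- s) p.2%:E * Z p.1)%E.

Definition cost s : R := \sum_(p <- s) p.2 * w p.1.

(** [Q x y Z] reads: [x] is a quantity to be bounded, [y] what is observed, and
    [Z] the available errors. At tolerance [eta] the constant is
    [exp (T * (1 - ln eta + X))]; the number [X] is the price that does not depend
    on the tolerance, and [T] is the exponent whose growth under repeated use
    decides the final constant. The error functional must be the same for all
    [x], [y] and [Z]; this is what allows integration over parameters. *)
Definition ctrl (T : R) Q : Prop := forall eta, 0 < eta <= 1 ->
  exists s, [/\ all (fun p => 0 <= p.2) s, cost s <= eta &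
    forall x y Z, (0 <= y)%E -> (forall n, (0 <= Z n)%E) -> Q x y Z ->
      (x <= (expR (T * (1 - ln eta + X)))%:E * y + err s Z)%E].

Definition rescale (c : R) s := [seq (p.1, c * p.2) | p <- s].

Lemma err_ge0 s Z : all (fun p => 0 <= p.2) s -> (forall n, (0 <= Z n)%E) ->
  (0 <= err s Z)%E.
Proof.
move=> /allP s0 Z0; rewrite /err big_seq; apply: sume_ge0 => p ps.
by rewrite mule_ge0 // lee_fin s0.
Qed.

Lemma err_cat s1 s2 Z : err (s1 ++ s2) Z = (err s1 Z + err s2 Z)%E.
Proof. by rewrite /err big_cat. Qed.

Lemma err_rescale c s Z : 0 <= c -> all (fun p => 0 <= p.2) s ->
  (forall n, (0 <= Z n)%E) -> err (rescale c s) Z = (c%:E * err s Z)%E.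
Proof.
move=> c0 /allP s0 Z0; rewrite /err big_map /= big_seq [in RHS]big_seq.
rewrite ge0_sume_distrr => [|p ps]; last by rewrite mule_ge0 // lee_fin s0.
by apply: eq_bigr => p _; rewrite EFinM muleA.
Qed.

Lemma all_rescale c s : 0 <= c -> all (fun p => 0 <= p.2) s ->
  all (fun p => 0 <= p.2) (rescale c s).
Proof. by move=> c0 /allP s0; apply/allP => _ /mapP[p /s0 ? ->]; rewrite mulr_ge0. Qed.

Lemma cost_rescale c s : cost (rescale c s) = c * cost s.
Proof. by rewrite /cost big_map mulr_sumr; apply: eq_bigr => p _; rewrite mulrA. Qed.

Lemma err_le s Z Z' : all (fun p => 0 <= p.2) s ->
  (forall n, (Z n <= Z' n)%E) -> (err s Z <= err s Z')%E.
Proof.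
move=> /allP s0 ZZ; rewrite /err big_seq [leRHS]big_seq; apply: lee_sum => p ps.
by apply: lee_wpmul2l; rewrite ?lee_fin ?s0.
Qed.

Lemma gain_ge1 eta : 0 < eta <= 1 -> 1 <= 1 - ln eta + X.
Proof.
move=> /andP[e0 e1]; have : ln eta <= 0 by exact: ln_le0.
by move: X0; lra.
Qed.

Lemma ln2_le1 : ln 2 <= 1 :> R.
Proof. by have := @le_ln1Dx R 1; rewrite (_ : 1 + 1 = 2) //; apply; lra. Qed.

Lemma ctrl_weaken T T' Q Q' : T <= T' -> ctrl T Q ->
  (forall x y Z, Q' x y Z -> Q x y Z) -> ctrl T' Q'.
Proof.
move=> TT cQ QQ eta eta01; have [s [s0 sc H]] := cQ eta eta01.
exists s; split=> // x y Z y0 Z0 /QQ /(H x y Z y0 Z0) /le_trans; apply.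
apply: leeD => //; apply: lee_wpmul2r => //; rewrite lee_fin ler_expR.
by rewrite ler_wpM2r // (le_trans ler01 (gain_ge1 eta01)).
Qed.

(** Observing [y'] from [y] and then [x] from [y'] multiplies the exponents.
    The second inequality is used at tolerance [eta / 2], with a constant [C2];
    the first must then be used at tolerance [eta / (2 * C2)], whose logarithm is
    itself of size [T2 * (1 - ln eta + X)]. *)
Lemma ctrl_comp T1 T2 Q1 Q2 Q : 1 <= T1 -> 1 <= T2 ->
  ctrl T1 Q1 -> ctrl T2 Q2 ->
  (forall x y Z, (0 <= y)%E -> (forall n, (0 <= Z n)%E) -> Q x y Z ->
    exists y', [/\ (0 <= y')%E, Q2 x y' Z & Q1 y' y Z]) ->
  ctrl (6 * T1 * T2) Q.
Proof.
move=> T11 T21 c1 c2 HQ eta eta01.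
have U1 := gain_ge1 eta01; case/andP: (eta01) => e0 e1.
set U := 1 - ln eta + X in U1 *.
have e2 : 0 < eta / 2 <= 1 by apply/andP; split; lra.
have [s2 [s20 s2c H2]] := c2 _ e2.
set C2 := expR _ in H2.
have lnC2 : ln C2 <= T2 * (2 * U).
  rewrite /C2 expRK ler_wpM2l ?(le_trans ler01) // lnM ?posrE ?invr_gt0 // lnV ?posrE //.
  by have := ln2_le1; move: U1; rewrite /U; lra.
have C20 : 0 < C2 by exact: expR_gt0.
have C21 : 1 <= C2.
  by rewrite /C2 expR_ge1 mulr_ge0 ?(le_trans ler01 (gain_ge1 e2)) ?(le_trans ler01).
have e3 : 0 < eta / (2 * C2) <= 1.
  rewrite divr_gt0 ?mulr_gt0 //= ler_pdivrMr ?mulr_gt0 // mul1r; lra.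
have [s1 [s10 s1c H1]] := c1 _ e3.
set C1 := expR _ in H1.
exists (s2 ++ rescale C2 s1); split.
- by rewrite all_cat s20 all_rescale // ltW.
- rewrite /cost big_cat /= -/(cost s2) -/(cost (rescale C2 s1)) cost_rescale.
  have : C2 * cost s1 <= C2 * (eta / (2 * C2)) by rewrite ler_pM2l.
  rewrite (_ : C2 * (eta / (2 * C2)) = eta / 2); last by field; rewrite gt_eqF.
  by lra.
- move=> x y Z y0 Z0 /(HQ x y Z y0 Z0)[y' [y'0 h2 h1]].
  apply: (le_trans (H2 _ _ _ y'0 Z0 h2)).
  rewrite err_cat err_rescale // ?(ltW C20) //.
  have h := lee_wpmul2l (ltW C20 : (0 <= C2%:E)%E) (H1 _ _ _ y0 Z0 h1).
  apply: (le_trans (leeD2r _ h)).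
  rewrite ge0_muleDr ?mule_ge0 ?err_ge0 ?lee_fin ?expR_ge0 //.
  rewrite -addeA [X in (_ + X)%E]addeC; apply: leeD => //.
  rewrite muleA; apply: lee_wpmul2r => //; rewrite -EFinM lee_fin.
  rewrite -{1}(lnK C20) /C1 -expRD ler_expR.
  have -> : ln (eta / (2 * C2)) = ln eta - (ln 2 + ln C2).
    by rewrite lnM ?posrE ?invr_gt0 ?mulr_gt0 // lnV ?posrE ?mulr_gt0 // lnM ?posrE.
  have h3 : 1 - (ln eta - (ln 2 + ln C2)) + X <= 2 * U + T2 * (2 * U).
    by have := ln2_le1; move: U1 lnC2; rewrite /U; lra.
  have h4 : T1 * (1 - (ln eta - (ln 2 + ln C2)) + X) <= T1 * (2 * U + T2 * (2 * U)).
    by rewrite ler_wpM2l ?(le_trans ler01).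
  apply: (le_trans (lerD lnC2 h4)).
  have TU : 0 <= (T1 - 1) * (T2 * U) by rewrite !mulr_ge0 ?subr_ge0 ?(le_trans ler01).
  have TU' : 0 <= (T2 - 1) * (T1 * U) by rewrite !mulr_ge0 ?subr_ge0 ?(le_trans ler01).
  rewrite -subr_ge0 (_ : _ - _ = 2 * ((T1 - 1) * (T2 * U)) + 2 * ((T2 - 1) * (T1 * U))); last by ring.
  by rewrite addr_ge0 // mulr_ge0.
Qed.

(** The two added pieces are used at tolerance [eta / 2] with a constant [C >= 1];
    since [1 + 2 * C <= e ^ 2 * C], only the exponent changes. *)
Lemma ctrl_grow T Q1 Q : 1 <= T -> ctrl T Q1 ->
  (forall x y Z, (0 <= y)%E -> (forall n, (0 <= Z n)%E) -> Q x y Z ->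
    exists x1 x2, [/\ (x <= y + x1 + x2)%E, Q1 x1 y Z & Q1 x2 y Z]) ->
  ctrl (4 * T) Q.
Proof.
move=> T1 c1 HQ eta eta01.
have U1 := gain_ge1 eta01; case/andP: (eta01) => e0 e1.
set U := 1 - ln eta + X in U1 *.
have e2 : 0 < eta / 2 <= 1 by apply/andP; split; lra.
have [s [s0 sc H]] := c1 _ e2.
set C := expR _ in H.
have C0 : 0 < C by exact: expR_gt0.
have C1 : 1 <= C.
  by rewrite /C expR_ge1 mulr_ge0 ?(le_trans ler01 (gain_ge1 e2)) ?(le_trans ler01).
exists (rescale 2 s); split.
- by rewrite all_rescale.
- by rewrite cost_rescale; lra.
- move=> x y Z y0 Z0 /(HQ x y Z y0 Z0)[x1 [x2 [xy h1 h2]]].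
  apply: (le_trans xy); rewrite -addeA.
  apply: (le_trans (leeD2l _ (leeD (H _ _ _ y0 Z0 h1) (H _ _ _ y0 Z0 h2)))).
  rewrite err_rescale //.
  have e0' := err_ge0 s0 Z0.
  have Cy0 : (0 <= C%:E * y)%E by rewrite mule_ge0 // lee_fin ltW.
  rewrite (_ : (2%:E * err s Z = err s Z + err s Z)%E); last first.
    by rewrite -[2]/(1 + 1) EFinD ge0_muleDl ?lee_fin // mul1e.
  rewrite [X in (y + X)%E]addeACA [X in (X <= _)%E]addeA; apply: leeD => //.
  rewrite -ge0_muleDl ?lee_fin ?(ltW C0) // -{1}[y]mul1e -ge0_muleDl ?lee_fin ?(ltW C0) ?addr_ge0 ?(ltW C0) //.
  rewrite -EFinD; apply: lee_wpmul2r => //; rewrite lee_fin.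
  have h3 : 1 + (C + C) <= expR 2 * C.
    have : 3 <= expR 2 :> R by have := expR_ge1Dx (2 : R); lra.
    nra.
  apply: (le_trans h3); rewrite /C -expRD ler_expR lnM ?posrE ?invr_gt0 // lnV ?posrE //.
  have h4 : T * (1 - (ln eta - ln 2) + X) <= T * (2 * U).
    rewrite ler_wpM2l ?(le_trans ler01) //.
    by have := ln2_le1; move: U1; rewrite /U; lra.
  nra.
Qed.

Lemma ctrl_refl (Q : \bar R -> \bar R -> (nat -> \bar R) -> Prop) :
  (forall x y Z, Q x y Z -> (x <= y)%E) -> ctrl 1 Q.
Proof.
move=> HQ eta eta01; exists [::]; split => //.
  by rewrite /cost big_nil; case/andP: eta01 => /ltW.
move=> x y Z y0 Z0 /HQ xy; rewrite /err big_nil adde0.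
apply: (le_trans xy); rewrite -{1}[y]mul1e; apply: lee_wpmul2r => //.
by rewrite lee_fin expR_ge1 mul1r (le_trans ler01 (gain_ge1 eta01)).
Qed.

(** Both sides are linear in [(x, y, Z)] with coefficients independent of a
    parameter, so a controlled relation may be integrated. *)
Lemma ctrl_integral T Q d (S : measurableType d) (m : {measure set S -> \bar R}) :
  ctrl T Q ->
  ctrl T (fun x y Z => exists (D : set S) (xt yt : S -> \bar R) (Zt : nat -> S -> \bar R),
    [/\ measurable D,
        [/\ measurable_fun D xt, measurable_fun D yt & forall n, measurable_fun D (Zt n)],
        [/\ forall t, D t -> (0 <= xt t)%E, forall t, D t -> (0 <= yt t)%E &
            forall n t, D t -> (0 <= Zt n t)%E],
        forall t, D t -> Q (xt t) (yt t) (Zt ^~ t) &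
        [/\ x = (\int[m]_(t in D) xt t)%E, (\int[m]_(t in D) yt t <= y)%E &
            forall n, ((\int[m]_(t in D) Zt n t) <= Z n)%E]]).
Proof.
move=> cQ eta eta01; have [s [s0 sc H]] := cQ _ eta01.
set C := expR _ in H *.
exists s; split=> // x y Z y0 Z0 [D [xt [yt [Zt [mD [mx my mZ] [x0 yt0 Zt0] HQ [-> yle HZ]]]]]].
have C0 : (0 <= C%:E)%E by rewrite lee_fin expR_ge0.
have ps p : p \in s -> (0 <= p.2%:E)%E by move=> /(allP s0); rewrite lee_fin.
have mterm p : measurable_fun D (fun t => p.2%:E * Zt p.1 t)%E by apply: measurable_funeM.
have e0 p t : p \in s -> D t -> (0 <= p.2%:E * Zt p.1 t)%E.
  by move=> /ps h Dt; rewrite mule_ge0 // Zt0.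
apply: (@le_trans _ _ (\int[m]_(t in D) (C%:E * yt t + err s (Zt ^~ t)))%E).
  apply: ge0_le_integral => //.
    apply: emeasurable_funD; first exact: measurable_funeM.
    by apply: emeasurable_sum => p _; exact: mterm.
  by move=> t Dt; apply: H; [exact: yt0|move=> n; exact: Zt0|exact: HQ].
rewrite ge0_integralD //; last 4 first.
- by move=> t Dt; rewrite mule_ge0 // yt0.
- exact: measurable_funeM.
- by move=> t Dt; apply: err_ge0 => // n; exact: Zt0.
- by apply: emeasurable_sum => p _; exact: mterm.
rewrite ge0_integralZl //; apply: leeD; first exact: lee_wpmul2l.
apply: (@le_trans _ _ (err s (fun n => \int[m]_(t in D) Zt n t)%E)); last exact: err_le.
suff -> : (\int[m]_(t in D) err s (Zt ^~ t) = err s (fun n => \int[m]_(t in D) Zt n t))%E by [].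
rewrite {HZ sc H}/err.
elim: s s0 ps e0 => [|p s IH] s0 ps e0.
  by rewrite big_nil; under eq_integral do rewrite big_nil; rewrite integral0.
have sub q : q \in s -> q \in p :: s by rewrite inE orbC => ->.
rewrite big_cons -IH; last 3 first.
- by case/andP: s0.
- by move=> q /sub; exact: ps.
- by move=> q t /sub; exact: e0.
under eq_integral do rewrite big_cons.
rewrite ge0_integralD //; last 3 first.
- by move=> t Dt; apply: e0 => //; rewrite inE eqxx.
- move=> t Dt; rewrite big_seq; apply: sume_ge0 => q qs.
  by apply: e0 => //; exact: sub.
- by apply: emeasurable_sum => q _; exact: mterm.
rewrite ge0_integralZl //; first by move=> t Dt; exact: Zt0.
by apply: ps; rewrite inE eqxx.
Qed.
End ctrl.

(** * Observability on a segment *)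

(** This finds, among the pieces of a finite cover, one which keeps its share of a
    given set. *)
Lemma measure_pigeonhole d (T : measurableType d) (R : realType)
    (mu : {measure set T -> \bar R}) (I : finType) (P : I -> set T) (E : set T)
    (c : R) : (0 < #|I|)%N ->
  measurable E -> (forall i, measurable (P i)) ->
  (forall x, E x -> exists i, P i x) ->
  ((c * #|I|%:R)%:E <= mu E)%E -> exists i, (c%:E <= mu (E `&` P i))%E.
Proof.
move=> I0 mE mP EP cE.
have /card_gt0P[i0 _] := I0.
pose F i := mu (E `&` P i).
have mF i : measurable (E `&` P i) by exact: measurableI.
case: (@Order.TotalTheory.arg_maxP _ _ _ i0 xpredT F) => // i _ Fmax.
exists i; rewrite -(@lee_pmul2r _ (#|I|%:R)%:E) ?lte_fin ?ltr0n //.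
rewrite -EFinM; apply: (le_trans cE).
apply: (@le_trans _ _ (\sum_(j in I) F j)%E).
  have [mU leU] : measurable (\big[setU/set0]_(j in I) (E `&` P j)) /\
      (mu (\big[setU/set0]_(j in I) (E `&` P j)) <= \sum_(j in I) F j)%E.
    elim/big_ind2 : _ => [|A x B y [mA Ax] [mB By]|j _]; first by rewrite measure0.
      split; first exact: measurableU.
      by apply: (le_trans (measureU2 _ mA mB)); exact: leeD.
    by split => //; exact: mF.
  apply: le_trans leU; apply: le_measure; rewrite ?inE //.
  move=> x Ex; have [j Pj] := EP x Ex.
  by rewrite -bigcup_pred; exists j.
apply: (@le_trans _ _ (\sum_(j in I) F i)%E).
  by apply: lee_sum => j _; exact: Fmax.
by rewrite sumr_const muleC mule_natl.
Qed.

Lemma sqint_setU d (T : measurableType d) (R : realType)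
    (mu : {measure set T -> \bar R}) (A B : set T) (f : T -> R) :
  measurable A -> measurable B -> measurable_fun setT f ->
  (sqint mu (A `|` B) f <= sqint mu A f + sqint mu B f)%E.
Proof.
move=> mA mB mf.
have mf' D : measurable_fun D f by exact: measurable_funTS.
have -> : A `|` B = A `|` (B `\` A).
  by apply/seteqP; split=> x [] => [|Bx|Ax|[]]; rewrite /setU /=; have [|] := pselect (A x); tauto.
have mBA : measurable (B `\` A) by exact: measurableD.
rewrite /sqint ge0_integral_setU //.
- by apply: leeD => //; apply: sqint_subset => // x [].
- exact: measurable_sqr.
- by move=> x _; rewrite lee_fin sqr_ge0.
- by apply/disj_setPS => x [Ax []].
Qed.

Section line.
Context (R : realType) (w : nat -> R) (X : R).
Hypothesis (X0 : 0 <= X).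
Notation lam := (@lebesgue_measure R).

(** The errors are scaled by a length [L] which may exceed that of the segment:
    in a segment of length [L] cut into [M] pieces the observations are made on
    pieces, with [theta] of order [1 / M], while the errors refer to the whole.
    It is the factor [theta ^ (2 * n)] thus gained that saves the critical case. *)
Definition line_obs (theta gam : R) (x y : \bar R) (Z : nat -> \bar R) : Prop :=
  exists g a b (E : set R) L, [/\ deriv_chain g, a < b /\ b - a <= theta * L,
    [/\ measurable E, E `<=` `[a, b] & ((gam * (b - a))%:E <= lam E)%E] &
    [/\ x = sqint lam `[a, b] (g 0%N), (sqint lam E (g 0%N) <= y)%E &
     forall n, ((L ^+ (2 * n))%:E * sqint lam `[a, b] (g n) <= Z n)%E]].

(** The interpolation order that suits a given tolerance: small enough for the
    constant of [observability_step], large enough for the weighted cost of the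
    remainder to stay below the tolerance. *)
Definition good_order (theta T0 : R) : Prop := forall eta, 0 < eta <= 1 ->
  exists N, [/\ (0 < N)%N, N%:R <= T0 * (1 - ln eta + X) &
    4 * theta ^+ (2 * N) / N`!%:R ^+ 2 * w N +
    2 * theta ^+ (2 * N.+1) / N`!%:R ^+ 2 * w N.+1 <= eta].

(** [(8 * e / gam) ^ (2 * N) = exp (step_gain gam * N)]. *)
Definition step_gain (gam : R) := 2 * ln (8 * expR 1 / gam).

Lemma step_gain_ge1 gam : 0 < gam <= 1 -> 1 <= step_gain gam.
Proof.
move=> /andP[g0 g1]; rewrite /step_gain.
have : 1 <= ln (8 * expR 1 / gam).
  rewrite -[X in X <= _]expRK ler_ln ?posrE ?expR_gt0 ?divr_gt0 ?mulr_gt0 ?expR_gt0 //.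
  by rewrite ler_pdivlMr // mulrC ler_pM2r ?expR_gt0 //; lra.
by lra.
Qed.

Lemma line_step theta gam T0 : 0 <= theta -> 0 < gam <= 1 ->
  good_order theta T0 -> ctrl w X (T0 * step_gain gam) (line_obs theta gam).
Proof.
move=> th0 gam01 HN eta eta01; have [N [N0 NT Nw]] := HN _ eta01.
have f0 : 0 <= (N`!%:R ^+ 2)^-1 :> R by rewrite invr_ge0 exprn_ge0 ?ler0n.
exists [:: (N, 4 * theta ^+ (2 * N) / N`!%:R ^+ 2);
           (N.+1, 2 * theta ^+ (2 * N.+1) / N`!%:R ^+ 2)]; split.
- by rewrite /= andbT !mulr_ge0 ?exprn_ge0.
- by rewrite /cost !big_cons big_nil /= addr0.
move=> x y Z y0 Z0 [g [a [b [E [L [Hg [ab baL] [mE Eab lE] [xE Ey HZ]]]]]]]; rewrite xE.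
have l0 : 0 < b - a by rewrite subr_gt0.
have tL0 : 0 <= theta * L by rewrite (le_trans (ltW l0)).
apply: (le_trans (observability_step Hg ab gam01 mE Eab lE N0)); apply: leeD.
  apply: lee_pmul => //; rewrite ?sqint_ge0 // ?lee_fin.
    by case/andP: gam01 => g0 _; rewrite exprn_ge0 // divr_ge0 ?mulr_ge0 ?expR_ge0 // ltW.
  have C0 : 0 < 8 * expR 1 / gam.
    by case/andP: gam01 => g0 _; rewrite divr_gt0 ?mulr_gt0 ?expR_gt0.
  rewrite -[X in X ^+ _](lnK C0) -expRM_natr ler_expR natrM mulrCA.
  rewrite [leRHS](_ : _ = step_gain gam * (T0 * (1 - ln eta + X))); last by ring.
  rewrite mulrA [X in X <= _](_ : _ = step_gain gam * N%:R); last by rewrite /step_gain; ring.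
  by rewrite ler_wpM2l // (le_trans ler01) // step_gain_ge1.
rewrite /err !big_cons big_nil /= adde0.
have pw k : (b - a) ^+ (2 * k) <= theta ^+ (2 * k) * L ^+ (2 * k).
  by rewrite -exprMn lerXn2r // nnegrE // ltW.
have step c k : 0 <= c ->
   ((c * (b - a) ^+ (2 * k))%:E * sqint lam `[a, b] (g k) <=
    (c * theta ^+ (2 * k))%:E * Z k)%E.
  move=> c0; apply: (@le_trans _ _ ((c * theta ^+ (2 * k))%:E *
     ((L ^+ (2 * k))%:E * sqint lam `[a, b] (g k)))%E).
    rewrite muleA -EFinM; apply: lee_wpmul2r; first exact: sqint_ge0.
    by rewrite lee_fin -mulrA ler_wpM2l.
  by apply: lee_wpmul2l => //; rewrite lee_fin mulr_ge0 // exprn_ge0.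
rewrite ge0_muleDr ?mule_ge0 ?sqint_ge0 ?lee_fin ?mulr_ge0 ?exprn_ge0 ?(ltW l0) //.
rewrite !muleA -!EFinM; apply: leeD.
  rewrite [X in (X%:E * _ <= _)%E](_ : _ = 4 / N`!%:R ^+ 2 * (b - a) ^+ (2 * N)); last by ring.
  rewrite [X in (_ <= X%:E * _)%E](_ : _ = 4 / N`!%:R ^+ 2 * theta ^+ (2 * N)); last by ring.
  by apply: step; rewrite mulr_ge0.
rewrite [X in (X%:E * _ <= _)%E](_ : _ = 2 / N`!%:R ^+ 2 * (b - a) ^+ (2 * N.+1)); last first.
  by rewrite mulnS exprD; ring.
rewrite [X in (_ <= X%:E * _)%E](_ : _ = 2 / N`!%:R ^+ 2 * theta ^+ (2 * N.+1)); last by ring.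
by apply: step; rewrite mulr_ge0.
Qed.

(** What [k] steps of propagation achieve. The errors refer to the fixed ambient
    segment, so that they keep the same form along the induction on [k]. *)
Definition line_grow (M k : nat) (x y : \bar R) (Z : nat -> \bar R) : Prop :=
  exists g a b u v u' v', [/\ deriv_chain g,
    [/\ a < b, a <= u', u' <= u, v <= v' & v' <= b],
    [/\ (b - a) / M%:R <= v - u, u - u' <= k%:R * ((b - a) / M%:R) &
         v' - v <= k%:R * ((b - a) / M%:R)] &
    [/\ x = sqint lam `[u', v'] (g 0%N), y = sqint lam `[u, v] (g 0%N) &
     forall n, (((b - a) ^+ (2 * n))%:E * sqint lam `[a, b] (g n) <= Z n)%E]].

(** From [ [u2, v2] ] one more step on the left is gained by observing
    [ [u2 - h, u2 + h] ] from its right half, and symmetrically; the density of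
    the observed half is [1/2], whence the bound on [gam]. *)
Lemma line_chain (M k : nat) (T gam : R) : (0 < M)%N -> 1 <= T -> 0 < gam <= 2^-1 ->
  ctrl w X T (line_obs (2 / M%:R) gam) ->
  ctrl w X ((24 * T) ^+ k) (line_grow M k).
Proof.
move=> M0 T1 gam01 cT; elim: k => [|k IH].
  rewrite expr0; apply: ctrl_refl => // x y Z.
  move=> [g [a [b [u [v [u' [v' [Hg [ab au u'u vv' vb] [h1 h2 h3] [-> -> _]]]]]]]]].
  have -> : u = u' by move: h2; rewrite mul0r; lra.
  by have -> : v = v' by move: h3; rewrite mul0r; lra.
have Tk1 : 1 <= (24 * T) ^+ k by rewrite exprn_ege1 //; lra.
have c4 : ctrl w X (4 * T) (fun x y Z => exists x1 x2,
   [/\ (x <= y + x1 + x2)%E, line_obs (2 / M%:R) gam x1 y Z &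
        line_obs (2 / M%:R) gam x2 y Z]).
  by apply: ctrl_grow cT _.
rewrite exprS (_ : 24 * T * _ = 6 * (24 * T) ^+ k * (4 * T)); last by ring.
apply: (ctrl_comp X0 Tk1 _ IH c4); first by lra.
move=> x y Z _ Z0 [g [a [b [u [v [u' [v' [Hg [ab au u'u vv' vb] [h1 h2 h3] [-> -> HZ]]]]]]]]].
set h := (b - a) / M%:R in h1 h2 h3 *.
have MR : (0 : R) < M%:R by rewrite ltr0n.
have h0 : 0 < h by rewrite divr_gt0 // subr_gt0.
have sub n (c d c' d' : R) : c' <= c -> d <= d' ->
    (sqint lam `[c, d] (g n) <= sqint lam `[c', d'] (g n))%E.
  move=> cc dd; apply: sqint_subset => //.
    exact: measurable_funTS (deriv_chain_measurable n Hg).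
  move=> t; rewrite /= !in_itv /= => /andP[t1 t2].
  by rewrite (le_trans cc t1) (le_trans t2 dd).
have mS (S : set R) : measurable_fun S (g 0%N).
  exact: measurable_funTS (deriv_chain_measurable 0%N Hg).
move: h2 h3; rewrite -natr1 mulrDl mul1r => h2 h3.
have kh0 : 0 <= k%:R * h by rewrite mulr_ge0 // ltW.
(* [ [u2, v2] ] stops one step short of [ [u', v'] ]. *)
pose u2 := Num.min u (u' + h); pose v2 := Num.max v (v' - h).
have [u2a u2b u2c u2d] : [/\ u' <= u2, u2 <= u, u - u2 <= k%:R * h & u2 <= u' + h].
  by rewrite /u2; case: (leP u (u' + h)) => ?; split; lra.
have [v2a v2b v2c v2d] : [/\ v2 <= v', v <= v2, v2 - v <= k%:R * h & v' - h <= v2].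
  by rewrite /v2; case: (leP v (v' - h)) => ?; split; lra.
clearbody u2 v2.
exists (sqint lam `[u2, v2] (g 0%N)); split; first exact: sqint_ge0.
- exists (sqint lam `[u', u2 + h] (g 0%N)), (sqint lam `[v2 - h, v'] (g 0%N)).
  have thL : 2 / M%:R * (b - a) = 2 * h by rewrite /h; ring.
  split.
  + apply: (@le_trans _ _ (sqint lam ((`[u2, v2] `|` `[u', u2 + h]) `|` `[v2 - h, v']) (g 0%N))).
      apply: sqint_subset; [by []|by apply: measurableU => //; exact: measurableU|exact: mS|].
      move=> t; rewrite /= /setU /= !in_itv /= => /andP[t1 t2].
      case: (leP t (u2 + h)) => h4; first by left; right; rewrite t1.
      case: (leP (v2 - h) t) => h5; first by right; rewrite t2.
      by left; left; apply/andP; split; lra.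
    apply: (le_trans (sqint_setU lam _ _ (mS setT))) => //; first exact: measurableU.
    by apply: leeD => //; apply: sqint_setU => //; exact: mS.
  + exists g, u', (u2 + h), `[u2, u2 + h]%classic, (b - a); split => //.
    * by split; [lra | rewrite thL; lra].
    * split => //.
        move=> t; rewrite /= !in_itv /= => /andP[t1 t2]; apply/andP; split; lra.
      rewrite lebesgue_segment; last by lra.
      rewrite lee_fin (addrC u2) addrK.
      apply: (@le_trans _ _ (2^-1 * (2 * h))).
        case/andP: gam01 => g0 g1; apply: ler_pM; lra.
      by rewrite mulrA mulVf ?mul1r.
    * split => //.
        by apply: sub; lra.
      move=> n; apply: le_trans (HZ n); apply: lee_wpmul2l; first by rewrite lee_fin exprn_ge0 //; lra.
      by apply: sub; lra.
  + exists g, (v2 - h), v', `[v2 - h, v2]%classic, (b - a); split => //.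
    * by split; [lra | rewrite thL; lra].
    * split => //.
        move=> t; rewrite /= !in_itv /= => /andP[t1 t2]; apply/andP; split; lra.
      rewrite lebesgue_segment; last by lra.
      rewrite lee_fin [leRHS](_ : _ = h); last by ring.
      apply: (@le_trans _ _ (2^-1 * (2 * h))).
        case/andP: gam01 => g0 g1; apply: ler_pM; lra.
      by rewrite mulrA mulVf ?mul1r.
    * split => //.
        by apply: sub; lra.
      move=> n; apply: le_trans (HZ n); apply: lee_wpmul2l; first by rewrite lee_fin exprn_ge0 //; lra.
      by apply: sub; lra.
- exists g, a, b, u, v, u2, v2; split => //; split => //; lra.
Qed.

(** Here the errors are scaled by the length of the segment itself. *)
Definition segment_obs (gam : R) (x y : \bar R) (Z : nat -> \bar R) : Prop :=
  exists g a b (E : set R), [/\ deriv_chain g, a < b,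
    [/\ measurable E, E `<=` `[a, b] & ((gam * (b - a))%:E <= lam E)%E] &
    [/\ x = sqint lam `[a, b] (g 0%N), y = sqint lam E (g 0%N) &
     forall n, (((b - a) ^+ (2 * n))%:E * sqint lam `[a, b] (g n) <= Z n)%E]].

(** One of the [M] pieces keeps its share of [E]; it is observed from [E], and the
    whole segment from it in [M] steps, which costs the power [M] of the exponent. *)
Lemma segment_obs_chain (M : nat) (T gam : R) : (0 < M)%N -> 1 <= T ->
  0 < gam <= 2^-1 -> ctrl w X T (line_obs (2 / M%:R) gam) ->
  ctrl w X ((24 * T) ^+ M.+1) (segment_obs gam).
Proof.
move=> M0 T1 gam01 cT.
have TM1 : 1 <= (24 * T) ^+ M by rewrite exprn_ege1 //; lra.
apply: (@ctrl_weaken _ w X X0 (6 * T * (24 * T) ^+ M) _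
  (segment_obs gam) (segment_obs gam)) => //.
  by rewrite exprS ler_wpM2r ?(le_trans ler01) //; lra.
apply: (ctrl_comp X0 T1 TM1 cT (line_chain M M0 T1 gam01 cT)).
move=> x y Z _ Z0 [g [a [b [E [Hg ab [mE Eab lE] [-> -> HZ]]]]]].
set h := (b - a) / M%:R.
have MR : (0 : R) < M%:R by rewrite ltr0n.
have h0 : 0 < h by rewrite divr_gt0 // subr_gt0.
have Mh : M%:R * h = b - a by rewrite /h mulrCA divff ?mulr1 // gt_eqF.
have iM (i : nat) : (i <= M)%N -> i%:R * h <= b - a.
  by move=> iM; rewrite -Mh ler_pM2r // ler_nat.
pose P (i : 'I_M) : set R := `[a + i%:R * h, a + i%:R * h + h]%classic.
have [|||||i Hi] := @measure_pigeonhole _ _ R lam 'I_M P E (gam * h).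
- by rewrite card_ord.
- by [].
- by move=> i; exact: measurable_itv.
- move=> t /Eab; rewrite /= in_itv /= => /andP[at_ tb].
  pose q := (t - a) / h.
  have q0 : 0 <= q by rewrite divr_ge0 ?subr_ge0 // ltW.
  have qh : q * h = t - a by rewrite divfK ?gt_eqF.
  have [tlt|tge] := ltnP (Num.truncn q) M.
    exists (Ordinal tlt); rewrite /P /= in_itv /=.
    have /andP[h1 h2] := truncn_itv q0.
    have h3 : (Num.truncn q)%:R * h <= q * h by rewrite ler_pM2r.
    have h4 : q * h <= ((Num.truncn q)%:R + 1) * h by rewrite ler_pM2r // natr1 ltW.
    by apply/andP; split; lra.
  (* The right end point [b] is put in the last piece. *)
  have M1 : (M.-1 < M)%N by rewrite prednK.
  exists (Ordinal M1); rewrite /P /= in_itv /=.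
  have e1 : M.-1%:R * h + h = b - a by rewrite -{2}[h]mul1r -mulrDl natr1 prednK.
  have h1 : M%:R * h <= q * h.
    by rewrite ler_pM2r // -truncn_ge_nat.
  by apply/andP; split; lra.
- by rewrite card_ord -mulrA [h * _]mulrC Mh.
have ih0 : 0 <= i%:R * h by rewrite mulr_ge0 // ltW.
have ih1 : i%:R * h + h <= b - a.
  by rewrite -{2}[h]mul1r -mulrDl natr1; apply: iM.
have mEP : measurable (E `&` P i).
  by apply: measurableI => //; exact: measurable_itv.
exists (sqint lam (P i) (g 0%N)); split; first exact: sqint_ge0.
- exists g, a, b, (a + i%:R * h), (a + i%:R * h + h), a, b; split => //.
    by split; lra.
  by split; rewrite -/h ?Mh; lra.
- exists g, (a + i%:R * h), (a + i%:R * h + h), (E `&` P i), (b - a); split => //.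
  + split; first by lra.
    by rewrite (_ : 2 / M%:R * (b - a) = 2 * h); [lra | rewrite /h; ring].
  + split; [exact: mEP | by move=> t [] |].
    by rewrite [X in (gam * X)%R](_ : _ = h); [exact: Hi | ring].
  + split => //.
      apply: sqint_subset => //.
      exact: measurable_funTS (deriv_chain_measurable 0%N Hg).
    move=> n; apply: le_trans (HZ n); apply: lee_wpmul2l.
      by rewrite lee_fin exprn_ge0 //; lra.
    apply: sqint_subset => //.
      exact: measurable_funTS (deriv_chain_measurable n Hg).
    by move=> t; rewrite /P /= !in_itv /= => /andP[t1 t2]; apply/andP; split; lra.
Qed.

Lemma segment_obs_step (T gam : R) :
  ctrl w X T (line_obs 1 gam) -> ctrl w X T (segment_obs gam).
Proof.
move=> cT; apply: (ctrl_weaken X0 (lexx T) cT) => x y Z.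
move=> [g [a [b [E [Hg ab [mE Eab lE] [-> -> HZ]]]]]].
by exists g, a, b, E, (b - a); split => //; split => //; rewrite mul1r.
Qed.
End line.

(** * Fubini for square integrals, and boxes *)

Section fubini_sqint.
Context d1 d2 (T1 : measurableType d1) (T2 : measurableType d2) (R : realType).
Variables (m1 : {sigma_finite_measure set T1 -> \bar R})
          (m2 : {sigma_finite_measure set T2 -> \bar R}).
Implicit Types (S : set (T1 * T2)) (h : T1 * T2 -> R).

Let f S h := (fun z => ((h z) ^+ 2)%:E) \_ S.

Let f0 S h z : (0 <= f S h z)%E.
Proof. by rewrite /f patchE; case: ifP => // _; rewrite lee_fin sqr_ge0. Qed.

Let mf S h : measurable S -> measurable_fun setT h -> measurable_fun setT (f S h).
Proof.
move=> mS mh; apply/(measurable_restrictT _ mS).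
by apply: measurable_sqr; exact: measurable_funTS.
Qed.

Let fubini_FE S h : fubini_F m2 (f S h) =
  fun x => sqint m2 [set y | S (x, y)] (fun y => h (x, y)).
Proof.
apply/funext => x; rewrite /fubini_F /sqint [RHS]integral_mkcond.
apply: eq_integral => y _; rewrite /f !patchE.
by rewrite (_ : ((x, y) \in S) = (y \in [set y | S (x, y)])) //; apply/idP/idP; rewrite !inE.
Qed.

Let fubini_GE S h : fubini_G m1 (f S h) =
  fun y => sqint m1 [set x | S (x, y)] (fun x => h (x, y)).
Proof.
apply/funext => x; rewrite /fubini_G /sqint [RHS]integral_mkcond.
apply: eq_integral => y _; rewrite /f !patchE.
by rewrite (_ : ((y, x) \in S) = (y \in [set y | S (y, x)])) //; apply/idP/idP; rewrite !inE.
Qed.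

Lemma measurable_sqint1 S h : measurable S -> measurable_fun setT h ->
  measurable_fun setT (fun x => sqint m2 [set y | S (x, y)] (fun y => h (x, y))).
Proof.
by move=> mS mh; rewrite -fubini_FE; apply: measurable_fun_fubini_tonelli_F; [exact: mf|exact: f0].
Qed.

Lemma measurable_sqint2 S h : measurable S -> measurable_fun setT h ->
  measurable_fun setT (fun y => sqint m1 [set x | S (x, y)] (fun x => h (x, y))).
Proof.
by move=> mS mh; rewrite -fubini_GE; apply: measurable_fun_fubini_tonelli_G; [exact: mf|exact: f0].
Qed.

Lemma sqint_fubini1 S h : measurable S -> measurable_fun setT h ->
  (sqint (m1 \x m2)%E S h =
   \int[m1]_x sqint m2 [set y | S (x, y)] (fun y => h (x, y)))%E.
Proof.
move=> mS mh; rewrite -fubini_FE /sqint integral_mkcond.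
by rewrite fubini_tonelli1; [|exact: mf|exact: f0].
Qed.

Lemma sqint_fubini2 S h : measurable S -> measurable_fun setT h ->
  (sqint (m1 \x m2)%E S h =
   \int[m2]_y sqint m1 [set x | S (x, y)] (fun x => h (x, y)))%E.
Proof.
move=> mS mh; rewrite -fubini_GE /sqint integral_mkcond.
by rewrite fubini_tonelli2; [|exact: mf|exact: f0].
Qed.

Lemma sqint_set0 d (T : measurableType d) (m : {measure set T -> \bar R}) (k : T -> R) :
  sqint m set0 k = 0%E.
Proof. by rewrite /sqint integral_set0. Qed.

Lemma sqint_rect1 (A : set T1) (B : set T2) h : measurable A -> measurable B ->
  measurable_fun setT h ->
  (sqint (m1 \x m2)%E (A `*` B) h =
   \int[m1]_(x in A) sqint m2 B (fun y => h (x, y)))%E.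
Proof.
move=> mA mB mh; rewrite sqint_fubini1; [|exact: measurableX|exact: mh].
rewrite [RHS]integral_mkcond; apply: eq_integral => x _; rewrite patchE.
case: ifPn; rewrite ?inE ?notin_setE => Ax.
  by congr sqint; apply/seteqP; split => y //= [].
by rewrite -[RHS](sqint_set0 m2 (fun y => h (x, y))); congr sqint; apply/seteqP; split => y //= [].
Qed.

Lemma sqint_rect2 (A : set T1) (B : set T2) h : measurable A -> measurable B ->
  measurable_fun setT h ->
  (sqint (m1 \x m2)%E (A `*` B) h =
   \int[m2]_(y in B) sqint m1 A (fun x => h (x, y)))%E.
Proof.
move=> mA mB mh; rewrite sqint_fubini2; [|exact: measurableX|exact: mh].
rewrite [RHS]integral_mkcond; apply: eq_integral => y _; rewrite patchE.
case: ifPn; rewrite ?inE ?notin_setE => By.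
  by congr sqint; apply/seteqP; split => x //= [].
by rewrite -[RHS](sqint_set0 m1 (fun x => h (x, y))); congr sqint; apply/seteqP; split => x //= [].
Qed.

Lemma measurable_sqint_rect1 (B : set T2) h : measurable B -> measurable_fun setT h ->
  measurable_fun setT (fun x => sqint m2 B (fun y => h (x, y))).
Proof.
move=> mB mh; have := @measurable_sqint1 (setT `*` B) h (measurableX measurableT mB) mh.
congr measurable_fun; apply/funext => x; congr sqint.
by apply/seteqP; split => y //= [].
Qed.

Lemma measurable_sqint_rect2 (A : set T1) h : measurable A -> measurable_fun setT h ->
  measurable_fun setT (fun y => sqint m1 A (fun x => h (x, y))).
Proof.
move=> mA mh; have := @measurable_sqint2 (A `*` setT) h (measurableX mA measurableT) mh.
congr measurable_fun; apply/funext => x; congr sqint.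
by apply/seteqP; split => y //= [].
Qed.
End fubini_sqint.

Section box.
Context (R : realType).

Definition box n (a b : 'rV[R]_n) : set 'rV[R]_n :=
  [set x | forall i, a ord0 i <= x ord0 i <= b ord0 i].

Definition vol n (a b : 'rV[R]_n) : R := \prod_(i < n) (b ord0 i - a ord0 i).

Definition tail n (x : 'rV[R]_n.+1) : 'rV[R]_n := (uncons_rV x).2.

Lemma tailE n (x : 'rV[R]_n.+1) j : tail x ord0 j = x ord0 (lift ord0 j).
Proof.
rewrite /tail /= mxE; congr (x _ _); apply/val_inj.
by rewrite /= /bump leq0n.
Qed.

Lemma consE0 n (p : measurableTypeR R * 'rV[R]_n) : cons_rV p ord0 ord0 = p.1.
Proof. exact: cons_rV0. Qed.

Lemma consES n (p : measurableTypeR R * 'rV[R]_n) j :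
  cons_rV p ord0 (lift ord0 j) = p.2 ord0 j.
Proof.
rewrite -cons_rVS; congr (cons_rV _ _ _); apply/val_inj.
by rewrite /= /bump leq0n.
Qed.

Lemma box_cons n (a b : 'rV[R]_n.+1) (s : R) (y : 'rV[R]_n) :
  box a b (cons_rV (s, y)) <->
  (`[a ord0 ord0, b ord0 ord0] `*` box (tail a) (tail b)) (s, y).
Proof.
split=> [H|[/= H0 H1] i].
  split => /=; first by have := H ord0; rewrite consE0 in_itv.
  by move=> j; have := H (lift ord0 j); rewrite consES !tailE.
case: (unliftP ord0 i) => [j|] ->; last by rewrite consE0; move: H0; rewrite in_itv.
by have := H1 j; rewrite !tailE consES.
Qed.

Lemma vol_cons n (a b : 'rV[R]_n.+1) :
  vol a b = (b ord0 ord0 - a ord0 ord0) * vol (tail a) (tail b).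
Proof.
by rewrite /vol big_ord_recl; congr (_ * _); apply: eq_bigr => j _; rewrite !tailE.
Qed.

Lemma measurable_box n (a b : 'rV[R]_n) : measurable (box a b).
Proof.
have -> : box a b = \bigcap_(i in [set: 'I_n]) (@rV_coord R n i @^-1` `[a ord0 i, b ord0 i]).
  apply/seteqP; split=> x /= H i; first by move=> _; rewrite /rV_coord /= in_itv /=; exact: H.
  by have := H i Logic.I; rewrite /rV_coord /= in_itv.
apply: fin_bigcap_measurable => // i _.
rewrite -[X in measurable X]setTI; apply: measurable_rV_coord => //.
Qed.

Lemma lebesgue_box n (a b : 'rV[R]_n) : (forall i, a ord0 i <= b ord0 i) ->
  borel_lebesgue_rV R n (box a b) = (vol a b)%:E.
Proof.
elim: n a b => [|n IH] a b ab.
  rewrite /vol big_ord0 /= /dirac /= indicE mem_set // => -[] //.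
rewrite /= /lebesgue_cons /pushforward.
have -> : @cons_rV R n @^-1` box a b =
    `[a ord0 ord0, b ord0 ord0] `*` box (tail a) (tail b).
  by apply/seteqP; split=> -[s y] /box_cons.
rewrite product_measure1E //; last exact: measurable_box.
rewrite IH; last by move=> i; rewrite !tailE.
rewrite [X in (X * _)%E](_ : _ = (b ord0 ord0 - a ord0 ord0)%:E).
  by rewrite -EFinM -vol_cons.
exact: lebesgue_segment.
Qed.

Lemma sqint_cons n (E : set 'rV[R]_n.+1) (g : 'rV[R]_n.+1 -> R) :
  measurable E -> measurable_fun setT g ->
  sqint (borel_lebesgue_rV R n.+1) E g =
  sqint (@lebesgue_measure R \x borel_lebesgue_rV R n)%E (@cons_rV R n @^-1` E)
    (g \o @cons_rV R n).
Proof.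
move=> mE mg; rewrite /sqint.
rewrite -(@ge0_integral_pushforward _ _ _ _ R _ (@measurable_cons_rV R n)
  (@lebesgue_measure R \x borel_lebesgue_rV R n)%E E (fun x => ((g x) ^+ 2)%:E)) //.
- exact: measurable_sqr (measurable_funTS mg).
- by move=> x _; rewrite lee_fin sqr_ge0.
Qed.
End box.

(** * Observability on a box *)

Section box_obs.
Context (R : realType) (w : nat -> R) (X : R).
Hypothesis (X0 : 0 <= X).
Notation lam := (@lebesgue_measure R).
Notation leb := (borel_lebesgue_rV R).

(** [G j k] is the [k]-th derivative of [g] in the [j]-th coordinate direction: the
    proof works line by line and sees pure derivatives. *)
Definition pure_derivs n (g : 'rV[R]_n -> R) (G : 'I_n -> nat -> 'rV[R]_n -> R) : Prop :=
  [/\ measurable_fun setT g, forall j k, measurable_fun setT (G j k),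
      forall j x, G j 0%N x = g x &
      forall j x, deriv_chain (fun k t => G j k (x + t *: delta_mx ord0 j))].

Definition box_err n (a b : 'rV[R]_n) (G : 'I_n -> nat -> 'rV[R]_n -> R) k : \bar R :=
  (\sum_(j < n) ((b ord0 j - a ord0 j) ^+ (2 * k))%:E * sqint (leb n) (box a b) (G j k))%E.

(** The factor [2 ^ n] is the density to be spent: each dimension of the induction
    costs half of it. *)
Definition box_obs (gam : R) n (x y : \bar R) (Z : nat -> \bar R) : Prop :=
  exists (g : 'rV[R]_n -> R) G (a b : 'rV[R]_n) (E : set 'rV[R]_n), [/\ pure_derivs g G,
    forall i, a ord0 i < b ord0 i,
    [/\ measurable E, E `<=` box a b & ((gam * 2 ^+ n * vol a b)%:E <= leb n E)%E] &
    [/\ x = sqint (leb n) (box a b) g, y = sqint (leb n) E g &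
        forall k, (box_err a b G k <= Z k)%E]].

Lemma cons_line n (s t : R) (y : 'rV[R]_n) j :
  cons_rV (s, y + t *: delta_mx ord0 j) =
  cons_rV (s, y) + t *: delta_mx ord0 (lift ord0 j).
Proof.
apply/rowP => i; case: (unliftP ord0 i) => [k|] ->; rewrite [RHS]mxE.
  by rewrite !consES /= !mxE (inj_eq lift_inj).
by rewrite !consE0 /= !mxE mulr0 addr0.
Qed.

Lemma cons_line0 n (t : R) (y : 'rV[R]_n) :
  cons_rV (0, y) + t *: delta_mx ord0 ord0 = cons_rV (t, y).
Proof.
apply/rowP => i; case: (unliftP ord0 i) => [k|] ->; rewrite [LHS]mxE.
  by rewrite !consES /= !mxE mulr0 addr0.
by rewrite !consE0 /= !mxE add0r mulr1.
Qed.

Lemma sqint1 d (T : measurableType d) (m : {measure set T -> \bar R}) (D : set T) :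
  measurable D -> sqint m D (fun=> 1) = m D.
Proof.
move=> mD; rewrite /sqint; under eq_integral do rewrite expr1n.
by rewrite integral_cst // mul1e.
Qed.

Lemma box_obs0 (gam : R) : 0 < gam -> ctrl w X 1 (box_obs gam 0).
Proof.
move=> g0; apply: ctrl_refl => // x y Z.
move=> [g [G [a [b [E [[mg _ _ _] _ [mE _ lE] [-> -> _]]]]]]].
have [z Ez] : E !=set0.
  apply/set0P/eqP => E0; move: lE; rewrite E0 measure0 lee_fin leNgt.
  by rewrite /vol big_ord0 expr0 !mulr1 g0.
apply: sqint_subset => //; [exact: measurable_box|exact: measurable_funTS|].
by move=> u _; rewrite [u]thinmx0 -[0](thinmx0 z).
Qed.

Lemma measurable_slice1 n (f : 'rV[R]_n.+1 -> R) (s : R) : measurable_fun setT f ->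
  measurable_fun setT (fun y => f (cons_rV (s, y))).
Proof.
move=> mf; apply: (measurableT_comp mf).
exact: (measurableT_comp (@measurable_cons_rV R n)).
Qed.

(** Write the box as [K1 * B] with [K1] a segment, and call [z] in [B] good if the
    line above it meets [E] with proportion [gam * 2 ^ n]. A line contributes at
    most [l] to the measure of [E] and a bad one at most half of the average, so
    the set [Gd] of good points has density at least [gam * 2 ^ n] in [B]. The
    integral over [K1 * Gd] is controlled by [E] on each good line, and the box by
    [K1 * Gd] on each slice [{s} * B], by the case of dimension [n]; both are then
    integrated. *)
Lemma box_obsS (gam T : R) n : 0 < gam -> 1 <= T ->
  ctrl w X T (segment_obs gam) -> ctrl w X ((6 * T) ^+ n) (box_obs gam n) ->
  ctrl w X ((6 * T) ^+ n.+1) (box_obs gam n.+1).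
Proof.
move=> g0 T1 c1 cn.
have Tn1 : 1 <= (6 * T) ^+ n by rewrite exprn_ege1 //; lra.
rewrite exprS.
apply: (ctrl_comp X0 T1 Tn1 (ctrl_integral (leb n) c1) (ctrl_integral lam cn)).
move=> x y Z y0 Z0 [g [G [a [b [E [[mg mG G0 dG] ab [mE Ebox lE] [xE yE HZ]]]]]]].
set K1 := `[a ord0 ord0, b ord0 ord0]%classic.
set B := box (tail a) (tail b).
set l := b ord0 ord0 - a ord0 ord0.
have l0 : 0 < l by rewrite subr_gt0.
have mB : measurable B by exact: measurable_box.
have mK1 : measurable K1 by exact: measurable_itv.
have mbox : measurable (box a b) by exact: measurable_box.
have preb : @cons_rV R n @^-1` box a b = K1 `*` B.
  by apply/seteqP; split=> -[s z] /box_cons.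
pose S := @cons_rV R n @^-1` E.
have mS : measurable S.
  by rewrite -[S]setTI; apply: measurable_cons_rV.
have SK1 s z : S (s, z) -> K1 s /\ B z by move=> /Ebox /box_cons.
have mcomp (f : 'rV[R]_n.+1 -> R) : measurable_fun setT f ->
    measurable_fun setT (f \o @cons_rV R n).
  by move=> mf; apply: measurableT_comp mf _; exact: measurable_cons_rV.
pose h := g \o @cons_rV R n.
have mh : measurable_fun setT h by exact: mcomp.
pose F z := lam [set s | S (s, z)].
have mSz z : measurable [set s | S (s, z)].
  rewrite -[X in measurable X]setTI.
  exact: (@pair2_measurable _ _ _ _ z _ S).
have FE z : F z = sqint lam [set s | S (s, z)] (fun=> 1) by rewrite sqint1.
have mF : measurable_fun setT F.
  by rewrite (funext FE); apply: (@measurable_sqint2 _ _ _ _ _ _ S (fun=> 1)).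
pose c := gam * 2 ^+ n * l.
have c0 : 0 < c by rewrite !mulr_gt0 // exprn_gt0.
pose Gd := B `&` [set z | (c%:E <= F z)%E].
have mGd : measurable Gd.
  by apply: emeasurable_fun_c_infty => //; exact: measurable_funTS.
have volB : leb n B = (vol (tail a) (tail b))%:E.
  by apply: lebesgue_box => i; rewrite !tailE ltW.
have volB0 : 0 < vol (tail a) (tail b).
  by apply: prodr_gt0 => i _; rewrite !tailE subr_gt0.
have FK z : (F z <= l%:E)%E.
  rewrite -(lebesgue_segment (ltW (ab ord0))).
  by apply: le_measure; rewrite ?inE // => s /SK1[].
(* The good lines have positive proportion. *)
have densG : ((gam * 2 ^+ n * vol (tail a) (tail b))%:E <= leb n Gd)%E.
  have EF : leb n.+1 E = (\int[leb n]_z F z)%E.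
    rewrite -(sqint1 (leb n.+1) mE) sqint_cons // sqint_fubini2; last 2 first.
    - exact: mS.
    - by apply: mcomp.
    by apply: eq_integral => z _; rewrite FE.
  have le1 : (leb n.+1 E <= l%:E * leb n Gd + c%:E * leb n B)%E.
    have mi (D : set 'rV[R]_n) r : measurable D ->
        measurable_fun setT (fun z : 'rV[R]_n => r%:E * (\1_D z)%:E)%E.
      by move=> mD; apply: measurable_funeM; apply/measurable_EFinP; exact: measurable_indic.
    have iE (D : set 'rV[R]_n) r : measurable D -> 0 <= r ->
        (r%:E * leb n D = \int[leb n]_z (r%:E * (\1_D z)%:E))%E.
      move=> mD r0; rewrite ge0_integralZl ?lee_fin //.
        by rewrite integral_indic // setIT.
      by apply/measurable_EFinP; exact: measurable_indic.
    have i0 (D : set 'rV[R]_n) r z : 0 <= r -> (0 <= r%:E * (\1_D z)%:E)%E.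
      by move=> r0; rewrite mule_ge0 // lee_fin.
    rewrite EF !iE ?(ltW l0) ?(ltW c0) //.
    rewrite -ge0_integralD //; last 4 first.
    - by move=> z _; rewrite i0 // ltW.
    - exact: mi.
    - by move=> z _; rewrite i0 // ltW.
    - exact: mi.
    apply: ge0_le_integral => //; first by apply: emeasurable_funD; exact: mi.
    move=> z _; rewrite !indicE.
    have [Bz|nBz] := pselect (B z); last first.
      have -> : F z = 0%E.
        rewrite /F (_ : [set s | S (s, z)] = set0) ?measure0 //.
        by apply/seteqP; split=> // s /SK1[].
      by rewrite adde_ge0 // mule_ge0 // lee_fin ?ltW.
    rewrite (mem_set Bz) mule1; have [cF|cF] := leP c%:E (F z).
      rewrite (_ : z \in Gd) ?mule1; last by rewrite inE.
      by apply: (le_trans (FK z)); rewrite leeDl // lee_fin ltW.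
    by rewrite (ltW (lt_le_trans cF _)) // leeDr // mule_ge0 // lee_fin ?ltW.
  have := le_trans lE le1; rewrite vol_cons -/l volB -EFinM.
  have fGd : leb n Gd \is a fin_num.
    rewrite ge0_fin_numE //; apply: (@le_lt_trans _ _ (leb n B)).
      by apply: le_measure; rewrite ?inE // => z [].
    by rewrite volB ltry.
  rewrite -(fineK fGd) -EFinM -EFinD !lee_fin => H.
  rewrite -(ler_pM2l l0).
  move: H; rewrite /c exprS; set v := vol _ _; set q := fine _.
  rewrite (_ : gam * (2 * 2 ^+ n) * (l * v) = 2 * (gam * 2 ^+ n * l * v)); last by ring.
  rewrite (_ : l * (gam * 2 ^+ n * v) = gam * 2 ^+ n * l * v); last by ring.
  by lra.
have mHc k j : measurable_fun setT (G j k \o @cons_rV R n) by exact: mcomp.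
exists (sqint (lam \x leb n)%E (K1 `*` Gd) h); split; first exact: sqint_ge0.
(* From the good lines to the box, slice by slice. *)
- exists K1, (fun s => sqint (leb n) B (fun z => h (s, z))),
    (fun s => sqint (leb n) Gd (fun z => h (s, z))),
    (fun k s => \sum_(j < n) ((tail b ord0 j - tail a ord0 j) ^+ (2 * k))%:E *
        sqint (leb n) B (fun z => (G (lift ord0 j) k \o @cons_rV R n) (s, z)))%E.
  have mZ k j : measurable_fun setT (fun s => ((tail b ord0 j - tail a ord0 j) ^+ (2 * k))%:E *
        sqint (leb n) B (fun z => (G (lift ord0 j) k \o @cons_rV R n) (s, z)))%E.
    by apply: measurable_funeM; exact: measurable_sqint_rect1.
  have tab j : 0 <= tail b ord0 j - tail a ord0 j by rewrite !tailE subr_ge0 ltW.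
  split.
  + exact: mK1.
  + split.
    * by apply: measurable_funTS; exact: measurable_sqint_rect1.
    * by apply: measurable_funTS; exact: measurable_sqint_rect1.
    * by move=> k; apply: measurable_funTS; apply: emeasurable_sum => j; exact: mZ.
  + split; [by move=> *; exact: sqint_ge0 | by move=> *; exact: sqint_ge0 |].
    move=> k s _; apply: sume_ge0 => j _; rewrite mule_ge0 ?sqint_ge0 //.
    by rewrite lee_fin exprn_ge0.
  + move=> s Ks; exists (fun z => h (s, z)), (fun j k z => G (lift ord0 j) k (cons_rV (s, z))),
      (tail a), (tail b), Gd; split.
    * split.
      - exact: measurable_slice1.
      - by move=> j k; exact: measurable_slice1.
      - by move=> j z; exact: G0.
      - move=> j z; have := dG (lift ord0 j) (cons_rV (s, z)).
        by congr deriv_chain; apply/funext => k; apply/funext => t; rewrite cons_line.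
    * by move=> j; rewrite !tailE.
    * by split => // z [].
    * by split.
  + split.
    * by rewrite xE sqint_cons // preb sqint_rect1.
    * by rewrite -sqint_rect1.
    * move=> k; apply: le_trans (HZ k).
      rewrite ge0_integral_sum //; last 2 first.
      - by move=> j; apply: measurable_funTS; exact: mZ.
      - by move=> j s _; rewrite mule_ge0 ?sqint_ge0 // lee_fin exprn_ge0.
      rewrite /box_err big_ord_recl -[X in (X <= _)%E]add0e; apply: leeD.
        by rewrite mule_ge0 ?sqint_ge0 // lee_fin exprn_ge0 // ltW.
      apply: lee_sum => j _; rewrite ge0_integralZl //; last 3 first.
      - by apply: measurable_funTS; exact: measurable_sqint_rect1.
      - by move=> s _; exact: sqint_ge0.
      - by rewrite lee_fin exprn_ge0.
      by rewrite -sqint_rect1 // !tailE -preb -sqint_cons.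
(* From [E] to the good lines, line by line. *)
- exists Gd, (fun z => sqint lam K1 (fun s => h (s, z))),
    (fun z => sqint lam [set s | S (s, z)] (fun s => h (s, z))),
    (fun k z => (l ^+ (2 * k))%:E * sqint lam K1 (fun s => (G ord0 k \o @cons_rV R n) (s, z)))%E.
  have mZ k : measurable_fun setT (fun z => (l ^+ (2 * k))%:E *
       sqint lam K1 (fun s => (G ord0 k \o @cons_rV R n) (s, z)))%E.
    by apply: measurable_funeM; exact: measurable_sqint_rect2.
  have lk k : (0 <= (l ^+ (2 * k))%:E)%E by rewrite lee_fin exprn_ge0 // ltW.
  split.
  + exact: mGd.
  + split.
    * by apply: measurable_funTS; exact: measurable_sqint_rect2.
    * by apply: measurable_funTS; exact: measurable_sqint2.
    * by move=> k; apply: measurable_funTS; exact: mZ.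
  + split; [by move=> *; exact: sqint_ge0 | by move=> *; exact: sqint_ge0 |].
    by move=> k z _; rewrite mule_ge0 ?sqint_ge0.
  + move=> z [Bz cF]; exists (fun k s => G ord0 k (cons_rV (s, z))),
      (a ord0 ord0), (b ord0 ord0), [set s | S (s, z)]; split.
    * have := dG ord0 (cons_rV (0, z)).
      by congr deriv_chain; apply/funext => k; apply/funext => t; rewrite cons_line0.
    * exact: ab.
    * split; [exact: mSz | by move=> s /= /SK1 [] |].
      apply: le_trans cF; rewrite lee_fin /c -/l.
      rewrite ler_wpM2r ?(ltW l0) // ler_peMr ?(ltW g0) // exprn_ege1 //; lra.
    * split => //.
      - by congr sqint; apply/funext => s; rewrite /h /= G0.
      - by congr sqint; apply/funext => s; rewrite /h /= G0.
  + split.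
    * by rewrite sqint_rect2.
    * rewrite yE sqint_cons // sqint_fubini2 //.
      apply: ge0_subset_integral => //; first exact: measurable_sqint2.
      by move=> *; exact: sqint_ge0.
    * move=> k; apply: le_trans (HZ k).
      apply: (@le_trans _ _ (\int[leb n]_(z in B) ((l ^+ (2 * k))%:E *
         sqint lam K1 (fun s => (G ord0 k \o @cons_rV R n) (s, z))))%E).
        apply: ge0_subset_integral => //; first by apply: measurable_funTS; exact: mZ.
          by move=> *; rewrite mule_ge0 ?sqint_ge0.
        by move=> z [].
      rewrite ge0_integralZl //; last 2 first.
      - by apply: measurable_funTS; exact: measurable_sqint_rect2.
      - by move=> *; exact: sqint_ge0.
      rewrite -sqint_rect2 // -preb -sqint_cons // /box_err big_ord_recl.
      by rewrite leeDl // sume_ge0 // => j _; rewrite mule_ge0 ?sqint_ge0 // lee_fin exprn_ge0 // subr_ge0 ltW.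
Qed.

Lemma box_obs_ctrl (gam T : R) n : 0 < gam -> 1 <= T ->
  ctrl w X T (segment_obs gam) -> ctrl w X ((6 * T) ^+ n) (box_obs gam n).
Proof.
move=> g0 T1 c1; elim: n => [|n IH]; first exact: box_obs0.
exact: box_obsS.
Qed.
End box_obs.

(** * Lebesgue and Borel measure *)

Section lebesgue_borel.
Context (R : realType) (n : nat).
Notation leb := (borel_lebesgue_rV R n).

Lemma borel_lebesgue_measurable (A : set 'rV[R]_n) :
  measurable A -> lebesgue_measurable A.
Proof. by move=> mA; apply: sub_caratheodory; exact: sub_sigma_algebra. Qed.

Lemma lebesgue_rVE (A : set 'rV[R]_n) : measurable A -> lebesgue_rV R n A = leb A.
Proof. by move=> mA; rewrite /lebesgue_rV /completed_measure_extension measurable_mu_extE. Qed.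

(** The two measures live on different sigma-algebras of the same space: the Borel
    one is the image of the completed one under the identity, which is measurable
    from the larger sigma-algebra to the smaller, and integrals are transported. *)
Lemma integral_lebesgue_rV (D : set 'rV[R]_n) (F : 'rV[R]_n -> \bar R) :
  measurable D -> measurable_fun setT F -> (forall x, 0 <= F x)%E ->
  (\int[lebesgue_rV R n]_(x in D) F x = \int[leb]_(x in D) F x)%E.
Proof.
move=> mD mF F0.
pose I := caratheodory_type (leb^*)%mu.
pose phi : I -> 'rV[R]_n := id.
have mphi : measurable_fun setT phi.
  move=> _ Y mY; rewrite setTI; exact: borel_lebesgue_measurable.
have := @ge0_integral_pushforward _ _ _ _ R phi mphi (lebesgue_rV R n) D F mD
  (measurable_funTS mF) (fun y _ => F0 y).
rewrite [X in _ = X -> _](_ : _ = (\int[lebesgue_rV R n]_(x in D) F x)%E) // => <-.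
apply: eq_measure_integral => A mA _; rewrite /pushforward.
exact: lebesgue_rVE.
Qed.

(** Inner regularity. Cover the complement [P - omega] from outside by a Borel set
    of nearly the same measure, which the outer measure permits, and remove the
    cover from [P]. *)
Lemma exists_borel_subset (omega P : set 'rV[R]_n) (c e : R) :
  lebesgue_measurable omega -> measurable P -> (leb P < +oo)%E -> 0 < e ->
  (c%:E <= lebesgue_rV R n (omega `&` P))%E ->
  exists E, [/\ measurable E, E `<=` omega `&` P & ((c - e)%:E <= leb E)%E].
Proof.
move=> mom mP fP e0 cle.
have fPn : leb P \is a fin_num by rewrite ge0_fin_numE.
pose Q := P `\` omega.
have [f1 f2] : (lebesgue_rV R n (omega `&` P) <= leb P)%E /\ (lebesgue_rV R n Q <= leb P)%E.
  by rewrite -(lebesgue_rVE mP); split; apply: le_mu_ext => x [].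
have fQ : lebesgue_rV R n Q \is a fin_num.
  by rewrite ge0_fin_numE ?(le_lt_trans f2) //; exact: mu_ext_ge0.
have decomp : leb P = (lebesgue_rV R n (omega `&` P) + lebesgue_rV R n Q)%E.
  by rewrite -(lebesgue_rVE mP) setIC; exact: mom.
have [_ [F [mF QF] <-] Fe] := lb_ereal_inf_adherent e0 fQ.
pose H := \bigcup_k F k.
have mH : measurable H by exact: bigcupT_measurable.
exists (P `\` H); split.
- exact: measurableD.
- move=> x [Px nHx]; split => //; apply: contrapT => nox; apply: nHx.
  by apply: QF; split.
- have HF : (leb H <= lebesgue_rV R n Q + e%:E)%E.
    apply: ltW; apply: le_lt_trans Fe.
    by apply: measure_sigma_subadditive => //.
  have fH : leb H \is a fin_num.
    rewrite ge0_fin_numE //; apply: (le_lt_trans HF).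
    by rewrite -(fineK fQ) -EFinD ltry.
  have PH : (leb P <= leb (P `\` H) + leb H)%E.
    apply: le_trans (measureU2 _ _ _) => //; last exact: measurableD.
    apply: le_measure; rewrite ?inE //; first by apply: measurableU => //; exact: measurableD.
    by move=> x Px; have [h|h] := pselect (H x); [right | left].
  have fo : lebesgue_rV R n (omega `&` P) \is a fin_num.
    by rewrite ge0_fin_numE ?(le_lt_trans f1) //; exact: mu_ext_ge0.
  have fD : leb (P `\` H) \is a fin_num.
    rewrite ge0_fin_numE //; apply: le_lt_trans fP; apply: le_measure; rewrite ?inE //.
      exact: measurableD.
  move: cle PH HF; rewrite decomp -(fineK fo) -(fineK fD) -(fineK fH) -(fineK fQ).
  by rewrite -!EFinD !lee_fin; lra.
Qed.

(** The sigma-algebra is generated by the coordinates and the topology by the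
    maximum norm: an open set is the countable union of the boxes with rational
    corners that it contains. *)
Lemma measurable_fun_continuous_rV (f : 'rV[R]_n -> R) :
  continuous f -> measurable_fun setT f.
Proof.
move=> cf; apply: (measurability _ (RGenOpens.measurableE R)).
move=> _ [_ [a [b ->]] <-]; rewrite setTI.
set U := f @^-1` _.
have oU : open U by apply: open_comp => [x _|]; [exact: cf | exact: interval_open].
pose qbox (q : 'rV[rat]_n * 'rV[rat]_n) : set 'rV[R]_n :=
  box (map_mx ratr q.1) (map_mx ratr q.2).
have -> : U = \bigcup_q (if `[< qbox q `<=` U >] then qbox q else set0).
  apply/seteqP; split=> [x Ux|x [q _]]; last by case: asboolP => // qU /qU.
  have /nbhs_ballP [e /= e0 eU] : nbhs x U by exact: open_nbhs_nbhs.
  have ql i : exists q : rat, ratr q \in `]x ord0 i - e, x ord0 i[.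
    by apply: rat_in_itvoo; rewrite ltrBlDr ltrDl.
  have qr i : exists q : rat, ratr q \in `]x ord0 i, x ord0 i + e[.
    by apply: rat_in_itvoo; rewrite ltrDl.
  have [l Hl] := choice ql; have [r Hr] := choice qr.
  exists (\row_i l i, \row_i r i) => //.
  have sub : qbox (\row_i l i, \row_i r i) `<=` U.
    move=> y Hy; apply: eU; split => // i j; rewrite ord1.
    have := Hy j; rewrite !mxE /ball /=.
    have := Hl j; have := Hr j; rewrite !in_itv /= => /andP[r1 r2] /andP[l1 l2] /andP[y1 y2].
    by rewrite ltr_norml; apply/andP; split; lra.
  rewrite asboolT // => i; rewrite !mxE.
  have := Hl i; have := Hr i; rewrite !in_itv /= => /andP[r1 r2] /andP[l1 l2].
  by rewrite !ltW.
apply: countable_bigcupT_measurable; first exact: countableP.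
by move=> q; case: asboolP => // _; exact: measurable_box.
Qed.
End lebesgue_borel.

Section L2norm.
Context (R : realType) (d : nat).
Notation normc := ComplexField.Normc.normc.

Lemma poweR2 (x : \bar R) : (0 <= x)%E -> (x `^ 2 = x ^+ 2)%E.
Proof.
case: x => [r| |] //= r0.
  by rewrite powR_mulrn // EFin_expe.
by rewrite mulyy gt_eqF.
Qed.

Lemma L2norm_sqr (D : set 'rV[R]_d) (f : 'rV[R]_d -> R[i]) :
  (L2norm D f ^+ 2 = \int[lebesgue_rV R d]_(x in D) ((normc (f x)) ^+ 2)%:E)%E.
Proof.
rewrite /L2norm -poweR2 ?Lnorm_ge0 // poweR_Lnorm //.
rewrite [RHS]integral_mkcond; apply: eq_integral => x _; rewrite !patchE.
case: ifP => _; last by rewrite abse0 poweR0r.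
rewrite /= ger0_norm; last by case: (f x) => p q; exact: sqrtr_ge0.
by rewrite powR_mulrn //; case: (f x) => p q; exact: sqrtr_ge0.
Qed.

Lemma normc_sqr (a b : R) : (normc (Complex a b)) ^+ 2 = a ^+ 2 + b ^+ 2.
Proof. by rewrite /= sqr_sqrtr // addr_ge0 ?sqr_ge0. Qed.

(** Reduces a complex function to two real ones, to which the estimates apply. *)
Lemma L2norm_sqint (D : set 'rV[R]_d) (f : 'rV[R]_d -> R[i]) :
  measurable D ->
  measurable_fun setT (fun x => complex.Re (f x)) ->
  measurable_fun setT (fun x => complex.Im (f x)) ->
  (L2norm D f ^+ 2 = sqint (borel_lebesgue_rV R d) D (fun x => complex.Re (f x)) +
     sqint (borel_lebesgue_rV R d) D (fun x => complex.Im (f x)))%E.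
Proof.
move=> mD mr mi; rewrite L2norm_sqr.
rewrite (_ : (fun x => _) = (fun x => ((complex.Re (f x)) ^+ 2)%:E + ((complex.Im (f x)) ^+ 2)%:E)%E); last first.
  by apply/funext => x; case: (f x) => a b; rewrite normc_sqr EFinD.
rewrite integral_lebesgue_rV //; last 2 first.
- by apply: emeasurable_funD; exact: measurable_sqr.
- by move=> x; rewrite adde_ge0 // lee_fin sqr_ge0.
rewrite ge0_integralD //.
- by move=> x _; rewrite lee_fin sqr_ge0.
- by apply: measurable_funTS; exact: measurable_sqr.
- by move=> x _; rewrite lee_fin sqr_ge0.
- by apply: measurable_funTS; exact: measurable_sqr.
Qed.

Lemma L2norm_subset (D D' : set 'rV[R]_d) (f : 'rV[R]_d -> R[i]) :
  lebesgue_measurable D -> lebesgue_measurable D' -> D `<=` D' ->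
  measurable_fun setT (fun x => complex.Re (f x)) ->
  measurable_fun setT (fun x => complex.Im (f x)) ->
  (L2norm D f ^+ 2 <= L2norm D' f ^+ 2)%E.
Proof.
move=> mD mD' DD mr mi; rewrite !L2norm_sqr.
apply: ge0_subset_integral; [exact: mD|exact: mD'| |by move=> x _; rewrite lee_fin sqr_ge0|exact: DD].
have mF : measurable_fun setT (fun x => ((normc (f x)) ^+ 2)%:E : \bar R).
  rewrite (_ : (fun x => _) = (fun x => ((complex.Re (f x)) ^+ 2)%:E + ((complex.Im (f x)) ^+ 2)%:E)%E); last first.
    by apply/funext => x; case: (f x) => a b; rewrite normc_sqr EFinD.
  by apply: emeasurable_funD; exact: measurable_sqr.
apply: measurable_funTS => _ Y mY; rewrite setTI.
apply: borel_lebesgue_measurable; rewrite -[X in measurable X]setTI.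
exact: mF.
Qed.
End L2norm.

(** * Covering adapted to the contraction *)

Section enorm.
Context (R : realType) (d : nat).
Implicit Types x y : 'rV[R]_d.

Lemma enorm_ge0 x : 0 <= enorm x.
Proof. exact: sqrtr_ge0. Qed.

Lemma enorm_sqr x : enorm x ^+ 2 = \sum_(i < d) x ord0 i ^+ 2.
Proof. by rewrite sqr_sqrtr // sumr_ge0 // => i _; rewrite sqr_ge0. Qed.

Lemma enorm_coord x i : `|x ord0 i| <= enorm x.
Proof.
rewrite -(@ler_pXn2r _ 2) ?nnegrE ?enorm_ge0 // enorm_sqr real_normK ?num_real //.
by rewrite (bigD1 i) //= lerDl sumr_ge0 // => j _; rewrite sqr_ge0.
Qed.

Lemma enorm_le x c : 0 <= c -> \sum_(i < d) x ord0 i ^+ 2 <= c ^+ 2 -> enorm x <= c.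
Proof. by move=> c0 H; rewrite -(@ler_pXn2r _ 2) ?nnegrE ?enorm_ge0 // enorm_sqr. Qed.

Lemma enorm_lt x c : 0 < c -> \sum_(i < d) x ord0 i ^+ 2 < c ^+ 2 -> enorm x < c.
Proof. by move=> c0 H; rewrite -(@ltr_pXn2r _ 2) ?nnegrE ?enorm_ge0 ?(ltW c0) // enorm_sqr. Qed.

Lemma enorm_perturb x y (r s : R) : enorm x <= r -> 0 <= s ->
  (forall i, `|y ord0 i| <= `|x ord0 i| + s) -> enorm y <= r + d%:R * s.
Proof.
move=> xr s0 H; have r0 : 0 <= r by rewrite (le_trans (enorm_ge0 x)).
have ds0 : 0 <= d%:R * s by rewrite mulr_ge0.
apply: enorm_le; first by rewrite addr_ge0.
apply: (@le_trans _ _ (\sum_(i < d) (x ord0 i ^+ 2 + (2 * r * s + s ^+ 2)))).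
  apply: ler_sum => i _; have xi := le_trans (enorm_coord x i) xr.
  rewrite -[X in X <= _]real_normK ?num_real // -[X in _ <= X + _]real_normK ?num_real //.
  apply: (@le_trans _ _ ((`|x ord0 i| + s) ^+ 2)).
    by rewrite lerXn2r ?nnegrE ?addr_ge0.
  rewrite sqrrD -addrA lerD2l lerD2r -mulrnAl -mulr_natl.
  by rewrite ler_wpM2r // ler_wpM2l.
rewrite big_split /= -enorm_sqr sumr_const card_ord -[X in _ + X]mulr_natl mulrDr.
have h1 : enorm x ^+ 2 <= r ^+ 2 by rewrite lerXn2r ?nnegrE ?enorm_ge0.
have h2 : d%:R * s ^+ 2 <= (d%:R * s) ^+ 2.
  rewrite exprMn ler_wpM2r ?sqr_ge0 // -natrX ler_nat.
  by case: (d) => // k; rewrite -mulnn leq_pmulr.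
rewrite sqrrD; move: h1 h2; set q := enorm x ^+ 2; set v := (d%:R * s) ^+ 2.
rewrite (_ : d%:R * (2 * r * s) = (r * (d%:R * s)) *+ 2); last first.
  by rewrite -[RHS]mulr_natl; ring.
by lra.
Qed.

Lemma measurable_eball x r : 0 < r -> measurable (eball x r).
Proof.
move=> r0.
have mE : measurable_fun setT (fun y : 'rV[R]_d => \sum_(i < d) (y ord0 i - x ord0 i) ^+ 2).
  apply: measurable_sum => i; apply: measurable_funX.
  by apply: measurable_funB => //; exact: (@measurable_rV_coord R d i).
have -> : eball x r = setT `&` (fun y : 'rV[R]_d => \sum_(i < d) (y ord0 i - x ord0 i) ^+ 2)
    @^-1` `]-oo, r ^+ 2[.
  apply/seteqP; split=> y; rewrite /eball /= in_itv /=.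
    move=> H; split => //.
    rewrite (_ : \sum_(i < d) _ = enorm (y - x) ^+ 2).
      by rewrite ltrXn2r // enorm_ge0.
    by rewrite enorm_sqr; apply: eq_bigr => i _; rewrite !mxE.
  move=> [_ H]; apply: enorm_lt => //.
  by apply: le_lt_trans H; apply: ler_sum => i _; rewrite !mxE.
by apply: mE => //; exact: measurable_itv.
Qed.
End enorm.

Lemma modn_close b j j' : (j %% b = j' %% b)%N -> (j < j' + b)%N -> (j' < j + b)%N -> j = j'.
Proof.
wlog le : j j' / (j' <= j)%N.
  by move=> H e h1 h2; case: (leqP j' j) => [/H|/ltnW/H h]; [apply|apply/esym/h].
move=> /eqP; rewrite eqn_mod_dvd // => dv h1 _.
have : (j - j' < b)%N by rewrite ltn_subLR.
case: (posnP (j - j')) => [/eqP|pos]; last by rewrite ltnNge dvdn_leq.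
by rewrite subn_eq0 => le' _; apply/eqP; rewrite eqn_leq le' le.
Qed.

Lemma modz_close (b : nat) (z z' : int) : (z %% b = z' %% b)%Z -> (`|z - z'| < b)%N -> z = z'.
Proof.
move=> /eqP; rewrite eqz_mod_dvd dvdzE absz_nat => dv lt.
apply/eqP; rewrite -subr_eq0 -absz_eq0 -leqn0 leqNgt; apply/negP => pos.
by move: lt; rewrite ltnNge dvdn_leq.
Qed.

Section geometry.
Context (R : realType) (d : nat) (rho : 'rV[R]_d -> R) (L gam : R).
Hypotheses (d0 : (0 < d)%N) (rho0 : forall x, 0 < rho x) (L0 : 0 <= L < 1)
  (rhoL : forall x y, `|rho x - rho y| <= L * enorm (x - y))
  (gam01 : 0 < gam <= 1).
Notation leb := (borel_lebesgue_rV R d).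

(** Small enough for [rho] to vary by a bounded factor on the boxes used near
    [x], which stay in the ball of radius [rho x * (1 + (1 - L) / 2)]. *)
Definition mesh : R := (1 - L) / (4 * d%:R).

Let dR : (0 : R) < d%:R. Proof. by rewrite ltr0n. Qed.

Let d1 : (1 : R) <= d%:R. Proof. by rewrite ler1n. Qed.

Lemma mesh_gt0 : 0 < mesh.
Proof. by case/andP: L0 => ? ?; rewrite divr_gt0 ?mulr_gt0 // subr_gt0. Qed.

Lemma mesh_small : 2 * d%:R * mesh = (1 - L) / 2.
Proof. by rewrite /mesh; field; rewrite gt_eqF. Qed.

(** Number of cells of width at least [mesh * rho x / 2] needed to go from [x] to
    the boundary of the ball of radius [rho x]. *)
Definition side : nat := (Num.truncn (2 / mesh)).+1.

Lemma side_ge : 2 / mesh <= side%:R.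
Proof.
have h : 0 <= 2 / mesh by rewrite divr_ge0 // ltW // mesh_gt0.
by have /andP[_ /ltW] := truncn_itv h.
Qed.

Lemma side2_gt0 : (0 : R) < side%:R + 2.
Proof. by rewrite ltr_wpDl. Qed.

Definition ncells : nat := #|{ffun 'I_d -> 'I_(2 * side)}|.

Lemma ncells_gt0 : (0 < ncells)%N.
Proof. by rewrite /ncells card_ffun !card_ord expn_gt0 muln_gt0. Qed.

(** [gam] times the share of a cube inscribed in the ball, divided by the number of
    cells, by the volume of the largest local box, and by 2 for the passage to a
    Borel subset. *)
Definition density : R :=
  gam / (2 * ncells%:R * (d%:R * ((side%:R + 2) * mesh)) ^+ d).

Lemma density_gt0 : 0 < density.
Proof.
case/andP: gam01 => g0 _; rewrite divr_gt0 // mulr_gt0 ?mulr_gt0 ?ltr0n ?ncells_gt0 //.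
by apply: exprn_gt0; apply: mulr_gt0 => //; apply: mulr_gt0; [exact: side2_gt0|exact: mesh_gt0].
Qed.

Definition local_box_spec (omega : set 'rV[R]_d) (x : 'rV[R]_d) (h : R)
    (K E : set 'rV[R]_d) : Prop :=
  exists a b : 'rV[R]_d, [/\ K = box a b,
    forall i, 0 < b ord0 i - a ord0 i <= (side%:R + 2) * h,
    forall y : 'rV[R]_d, (forall i, `|y ord0 i - x ord0 i| <= h) -> K y,
    forall y, K y -> enorm (y - x) <= rho x * (1 + (1 - L) / 2) &
    [/\ measurable E, E `<=` omega `&` K & ((density * vol a b)%:E <= leb E)%E]].

(** Cut the cube around [B(x, rho x)] into cells of width [h]. One of them holds
    its share of [omega]; the box spanned by that cell and by the cube of half-width
    [h] around [x] covers a whole neighbourhood of [x], with the density of the cell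
    diminished only by the ratio of the volumes. *)
Lemma local_box (omega : set 'rV[R]_d) (x : 'rV[R]_d) (h : R) :
  lebesgue_measurable omega -> gamma_thick gam rho omega ->
  0 < h -> h <= mesh * rho x <= 2 * h ->
  exists K E, local_box_spec omega x h K E.
Proof.
move=> mom thick h0 /andP[h1 h2]; case/andP: (gam01) => g0 _.
set r := rho x in h1 h2 *; have r0 : 0 < r by exact: rho0.
have m0 := mesh_gt0.
have rU : r <= side%:R * h.
  have : 2 / mesh * h <= side%:R * h by rewrite ler_pM2r // side_ge.
  by apply: le_trans; rewrite mulrAC ler_pdivlMr // mulrC.
pose tt (u : {ffun 'I_d -> 'I_(2 * side)}) i : R := h * ((u i)%:R - side%:R).
pose P u : set 'rV[R]_d :=
  box (\row_i (x ord0 i + tt u i)) (\row_i (x ord0 i + tt u i + h)).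
have mP u : measurable (P u) by exact: measurable_box.
pose BB := eball x r.
have mBB : measurable BB by exact: measurable_eball.
pose c := gam * (r / d%:R) ^+ d / ncells%:R.
have nc0 : (0 : R) < ncells%:R by rewrite ltr0n ncells_gt0.
have c0 : 0 < c by rewrite divr_gt0 // mulr_gt0 // exprn_gt0 // divr_gt0.
pose oB := omega `&` BB.
have moB : lebesgue_measurable oB.
  by apply: measurableI => //; exact: borel_lebesgue_measurable.
have cover y : oB y -> exists u, P u y.
  move=> [_ yB].
  have yx i : `|y ord0 i - x ord0 i| < r.
    have := enorm_coord (y - x) i; rewrite !mxE => /le_lt_trans; apply; exact: yB.
  pose q i := (y ord0 i - x ord0 i) / h + side%:R.
  have qh i : q i * h = y ord0 i - x ord0 i + side%:R * h.
    by rewrite /q mulrDl divfK // gt_eqF.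
  have q0 i : 0 <= q i.
    rewrite -(@ler_pM2r _ h) // mul0r qh.
    by have := yx i; rewrite ltr_norml => /andP[? ?]; lra.
  have q2 i : (Num.truncn (q i) < 2 * side)%N.
    rewrite truncn_lt_nat // -(@ltr_pM2r _ h) // qh natrM.
    by have := yx i; rewrite ltr_norml => /andP[? ?]; lra.
  exists [ffun i => Ordinal (q2 i)] => i; rewrite !mxE /tt ffunE /=.
  have /andP[t1 t2] := truncn_itv (q0 i).
  have t3 : (Num.truncn (q i))%:R * h <= q i * h by rewrite ler_pM2r.
  have t4 : q i * h <= ((Num.truncn (q i))%:R + 1) * h by rewrite ler_pM2r // natr1 ltW.
  by move: t3 t4; rewrite qh => t3 t4; apply/andP; split; lra.
(* The ball contains a cube of side [r / d]. *)
have bigB : ((c * ncells%:R)%:E <= lebesgue_rV R d oB)%E.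
  rewrite /c divfK ?gt_eqF //; apply: le_trans (thick x).
  rewrite EFinM; apply: lee_wpmul2l; first by rewrite lee_fin ltW.
  pose ia : 'rV[R]_d := \row_i (x ord0 i - r / (2 * d%:R)).
  pose ib : 'rV[R]_d := \row_i (x ord0 i + r / (2 * d%:R)).
  have volI : vol ia ib = (r / d%:R) ^+ d.
    rewrite /vol (eq_bigr (fun=> r / d%:R)) ?prodr_const ?card_ord // => i _.
    by rewrite !mxE; field; rewrite gt_eqF.
  rewrite -volI -lebesgue_box; last first.
    by move=> i; rewrite !mxE lerD2l (le_trans (y := 0)) // ?oppr_le0 divr_ge0 ?mulr_ge0 // ltW.
  rewrite -lebesgue_rVE; last exact: measurable_box.
  apply: le_mu_ext => y Hy; rewrite /eball /=; apply: enorm_lt => //.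
  apply: (@le_lt_trans _ _ (\sum_(i < d) (r / (2 * d%:R)) ^+ 2)).
    apply: ler_sum => i _; rewrite -[X in X <= _]real_normK ?num_real //.
    rewrite lerXn2r ?nnegrE ?divr_ge0 ?mulr_ge0 ?(ltW r0) //.
    by have := Hy i; rewrite !mxE ler_norml => /andP[? ?]; apply/andP; split; lra.
  rewrite sumr_const card_ord -[X in X < _]mulr_natl.
  rewrite (_ : d%:R * (r / (2 * d%:R)) ^+ 2 = r ^+ 2 / (4 * d%:R)); last first.
    by field; rewrite gt_eqF.
  rewrite ltr_pdivrMr ?mulr_gt0 // ltr_pMr ?exprn_gt0 //; have := d1; lra.
have [|||||u Hu] := @measure_pigeonhole _ _ R (lebesgue_rV R d) _ P oB c.
- exact: ncells_gt0.
- exact: moB.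
- by move=> u; exact: borel_lebesgue_measurable.
- exact: cover.
- exact: bigB.
have [y0 [[_ y0B] y0P]] : (oB `&` P u) !=set0.
  apply/set0P/eqP => e0; move: Hu; rewrite e0 measure0 lee_fin leNgt.
  by rewrite c0.
have tty0 i : `|tt u i| <= `|y0 ord0 i - x ord0 i| + h.
  have := y0P i; rewrite !mxE => /andP[p1 p2].
  rewrite ler_norml; apply/andP; split.
    by have := ler_norm (- (y0 ord0 i - x ord0 i)); rewrite normrN; lra.
  by have := ler_norm (y0 ord0 i - x ord0 i); lra.
pose a : 'rV[R]_d := \row_i (x ord0 i + Num.min (tt u i) 0 - h).
pose b : 'rV[R]_d := \row_i (x ord0 i + Num.max (tt u i) 0 + h).
have ttU i : `|tt u i| <= side%:R * h.
  rewrite /tt normrM (gtr0_norm h0) mulrC ler_pM2r // ler_norml.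
  have : (u i)%:R <= (2 * side)%:R :> R by rewrite ler_nat ltnW.
  by rewrite natrM => H; apply/andP; split; have := ler0n R (u i); lra.
have minmax i : [/\ Num.min (tt u i) 0 <= 0, 0 <= Num.max (tt u i) 0,
     Num.min (tt u i) 0 <= tt u i <= Num.max (tt u i) 0 &
     Num.max (tt u i) 0 - Num.min (tt u i) 0 = `|tt u i|].
  case: (leP (tt u i) 0) => H; first by rewrite (ler0_norm H); split; lra.
  by rewrite (gtr0_norm H); split; lra.
have PK : P u `<=` box a b.
  move=> y Hy i; have := Hy i; rewrite !mxE => /andP[p1 p2].
  by have [m1 m2 /andP[m3 m4] _] := minmax i; apply/andP; split; lra.
have fP : (leb (P u) < +oo)%E.
  rewrite /P lebesgue_box ?ltry // => i; rewrite !mxE lerDl ltW //.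
have c20 : 0 < c / 2 by rewrite divr_gt0.
have [E [mE Esub lE]] := exists_borel_subset moB (mP u) fP c20 Hu.
have sides i : 0 < b ord0 i - a ord0 i <= (side%:R + 2) * h.
  rewrite !mxE; have [m1 m2 m3 m4] := minmax i; have := ttU i.
  by move=> H; apply/andP; split; [move: m1 m2; lra | move: m4 H; lra].
exists (box a b), E; exists a, b; split => //.
- move=> y Hy i; rewrite !mxE; have := Hy i; rewrite ler_norml => /andP[p1 p2].
  by have [m1 m2 _ _] := minmax i; apply/andP; split; lra.
- move=> y Hy.
  apply: (@le_trans _ _ (r + d%:R * (2 * h))).
    apply: (@enorm_perturb _ _ (y0 - x)); [exact: ltW|by rewrite mulr_ge0 // ltW|].
    move=> i; have := Hy i; rewrite !mxE => /andP[p1 p2].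
    have [m1 m2 _ m4] := minmax i; have H := tty0 i.
    by rewrite ler_norml; apply/andP; split; lra.
  rewrite mulrDr mulr1 lerD2l.
  apply: (@le_trans _ _ (2 * d%:R * mesh * r)).
    rewrite (_ : d%:R * (2 * h) = 2 * d%:R * h); last by ring.
    by rewrite -[leRHS]mulrA ler_pM2l ?mulr_gt0.
  by rewrite mesh_small mulrC.
- split => //.
    by move=> y /Esub[[oy _] Py]; split => //; exact: PK.
  apply: le_trans lE; rewrite lee_fin.
  have -> : c - c / 2 = c / 2 by lra.
  apply: (@le_trans _ _ (density * ((side%:R + 2) * mesh * r) ^+ d)).
    rewrite ler_pM2l ?density_gt0 // /vol.
    rewrite -[X in _ <= _ ^+ X]card_ord -prodr_const; apply: ler_prod => i _.
    have /andP[s1 s2] := sides i; rewrite (ltW s1) /= (le_trans s2) //.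
    by rewrite -mulrA ler_pM2l // side2_gt0.
  have E0 (M S D n : R) : M != 0 -> S != 0 -> D != 0 -> n != 0 ->
      gam / (2 * n * (D * (S * M)) ^+ d) * (S * M * r) ^+ d = gam * (r / D) ^+ d / n / 2.
    move=> /(expf_neq0 d) + /(expf_neq0 d) + /(expf_neq0 d); rewrite !exprMn exprVn.
    move: (M ^+ d) (S ^+ d) (D ^+ d) (r ^+ d) => p1 p2 p3 p4 x1 x2 x3 x4.
    by field; rewrite x1 x2 x3 x4.
  by rewrite /density E0 // gt_eqF // side2_gt0.
Qed.

(** On the ball considered, [rho] differs from [rho x] by at most
    [L * (1 + (1 - L) / 2) * rho x], and this factor is at most [(1 + L) / 2]. *)
Lemma rho_near x y : enorm (y - x) <= rho x * (1 + (1 - L) / 2) ->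
  rho x * ((1 - L) / 2) <= rho y <= 2 * rho x.
Proof.
move=> H; case/andP: (L0) => L1 L2.
have r0 := rho0 x.
have h1 : `|rho y - rho x| <= L * (rho x * (1 + (1 - L) / 2)).
  by apply: (le_trans (rhoL y x)); rewrite ler_wpM2l.
have h2 : L * (rho x * (1 + (1 - L) / 2)) <= rho x * ((1 + L) / 2).
  have : 0 <= rho x * (1 - L) * (1 - L) by rewrite !mulr_ge0 ?subr_ge0 ?(ltW r0) ?(ltW L2).
  rewrite -subr_ge0 => h3; rewrite -subr_ge0.
  by rewrite (_ : _ - _ = rho x * (1 - L) * (1 - L) / 2); [lra | field].
have h3 : rho x * ((1 + L) / 2) <= rho x by rewrite ler_piMr ?(ltW r0) //; lra.
move: (le_trans h1 h2); rewrite ler_norml => /andP[h4 h5].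
have h6 : rho x * ((1 - L) / 2) = rho x - rho x * ((1 + L) / 2) by field.
by apply/andP; split; lra.
Qed.

Variable m : R.
Hypotheses (m0 : 0 < m) (rhom : forall x, m <= rho x).

Definition step (j : nat) : R := mesh * (2 ^+ j * m).

Lemma step_gt0 j : 0 < step j.
Proof. by apply: mulr_gt0; [exact: mesh_gt0 | apply: mulr_gt0 => //; exact: exprn_gt0]. Qed.

(** Points are classified by the dyadic scale [j] of [rho] and by a cube of a grid
    whose width is proportional to that scale. *)
Definition grid_cell (j : nat) (z : 'rV[int]_d) (x : 'rV[R]_d) : Prop :=
  2 ^+ j * m <= rho x < 2 ^+ j.+1 * m /\
  forall i, (z ord0 i)%:~R * step j <= x ord0 i < ((z ord0 i)%:~R + 1) * step j.

Lemma in_grid_cell x : exists j z, grid_cell j z x.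
Proof.
have [j /andP[j1 j2]] : exists j, 2 ^+ j * m <= rho x < 2 ^+ j.+1 * m.
  have ex : exists j, rho x < 2 ^+ j.+1 * m.
    exists (Num.truncn (rho x / m)).
    rewrite -ltr_pdivrMr //.
    have h : 0 <= rho x / m by rewrite divr_ge0 // ltW.
    have /andP[_ h2] := truncn_itv h; apply: (lt_le_trans h2).
    by rewrite -natrX ler_nat ltnW // ltn_expl.
  pose j := ex_minn ex; exists j; rewrite /j; case: ex_minnP => k k1 k2.
  rewrite k1 andbT; case: k k1 k2 => [|k] k1 k2; first by rewrite expr0 mul1r.
  by rewrite leNgt; apply/negP => /k2; rewrite ltnn.
exists j, (\row_i Num.floor (x ord0 i / step j)); split; first by rewrite j1.
move=> i; rewrite mxE -ler_pdivlMr ?step_gt0 // -ltr_pdivrMr ?step_gt0 //.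
have := real_floor_itv (num_real (x ord0 i / step j)).
by rewrite intrD.
Qed.

(** One local box for each inhabited grid cell. If two boxes share a point [y], then
    [rho] at their centres is comparable to [rho y], so the scales differ by a
    bounded amount, and within one scale the cubes are at bounded distance. Hence
    among the boxes through [y] the pair (scale, cube) is determined by its residues
    modulo constants, of which there are finitely many. *)
Lemma covering : exists (C : R) (B : nat), 0 < C /\
  forall omega, lebesgue_measurable omega -> gamma_thick gam rho omega ->
  exists K E : nat -> set 'rV[R]_d, [/\
    forall k, (K k = set0 /\ E k = set0) \/ exists a b : 'rV[R]_d,
      [/\ K k = box a b, forall i, a ord0 i < b ord0 i,
        forall y i, K k y -> b ord0 i - a ord0 i <= C * rho y &
        [/\ measurable (E k), E k `<=` omega `&` K k &
           ((density * vol a b)%:E <= leb (E k))%E]],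
    forall x, exists k, K k x &
    forall y N, (#|[set k : 'I_N | `[< K k y >]]%SET| <= B)%N].
Proof.
case/andP: (L0) => L1 L2.
have me0 := mesh_gt0.
have l0 : 0 < 1 - L by rewrite subr_gt0.
pose C := (side%:R + 2) * mesh * (2 / (1 - L)).
have C0 : 0 < C by apply: mulr_gt0; [apply: mulr_gt0 => //; exact: side2_gt0 | exact: divr_gt0].
pose ba := Num.truncn (8 / (1 - L)); pose bz := (Num.truncn (2 + 8 / mesh)).+1.
have baP : 8 / (1 - L) <= 2 ^+ ba.+1.
  have h : 0 <= 8 / (1 - L) by rewrite divr_ge0 // ltW.
  have /andP[_ /ltW h2] := truncn_itv h; apply: (le_trans h2).
  by rewrite -natrX ler_nat ltnW // ltn_expl.
have bzP : 2 + 8 / mesh < bz%:R.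
  have h : 0 <= 2 + 8 / mesh by rewrite addr_ge0 // divr_ge0 // ltW.
  by have /andP[_ h2] := truncn_itv h.
pose IT := ('I_ba.+1 * {ffun 'I_d -> 'I_bz.+1})%type.
exists C, #|{: IT}|; split => // omega mom thick.
(* Numbers that do not encode an inhabited cell receive the empty set. *)
pose idx := (nat * 'rV[int]_d)%type.
pose spec (k : nat) (KE : set 'rV[R]_d * set 'rV[R]_d) : Prop :=
  (exists j z x, [/\ pickle_inv k = Some ((j, z) : idx), grid_cell j z x &
     local_box_spec omega x (step j) KE.1 KE.2]) \/
  [/\ KE.1 = set0, KE.2 = set0 & forall j z x, pickle_inv k = Some ((j, z) : idx) ->
     ~ grid_cell j z x].
have /choice[KE HKE] : forall k, exists KE, spec k KE.
  move=> k.
  have [[j [z [x [e c]]]]|no] := pselect (exists j z x,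
     pickle_inv k = Some ((j, z) : idx) /\ grid_cell j z x).
    have [] := @local_box omega x (step j) mom thick (step_gt0 j).
      case: (c) => /andP[c1 c2] _; rewrite /step; apply/andP; split.
        by rewrite ler_pM2l.
      by rewrite mulrCA ler_pM2l // mulrA -exprS ltW.
    by move=> K [E HE]; exists (K, E); left; exists j, z, x.
  exists (set0, set0); right; split => // j z x e c; apply: no.
  by exists j, z, x.
exists (fun k => (KE k).1), (fun k => (KE k).2); split.
- move=> k; case: (HKE k) => [[j [z [x [e [/andP[c1 c2] _] H]]]]|[-> -> _]]; last by left.
  right; case: H => a [b [EK sides _ near [mE Esub lE]]]; exists a, b; split => //.
    by move=> i; have /andP[+ _] := sides i; rewrite subr_gt0.
  move=> y i Ky; have /andP[_ s2] := sides i; apply: (le_trans s2).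
  have /andP[r1 _] := rho_near (near y Ky).
  rewrite (_ : C * rho y = (side%:R + 2) * (mesh * (2 * rho y / (1 - L)))); last first.
    by rewrite /C; ring.
  rewrite ler_pM2l ?side2_gt0 // /step ler_pM2l //.
  apply: (le_trans c1); rewrite ler_pdivlMr //.
  by move: r1; lra.
- move=> x; have [j [z c]] := in_grid_cell x.
  exists (pickle ((j, z) : idx)); set k := pickle _.
  have ek : pickle_inv k = Some ((j, z) : idx) by rewrite /k pickleK_inv.
  case: (HKE k) => [[j' [z' [x' [e c' H]]]]|[_ _ /(_ j z x ek)]] //.
  move: e; rewrite ek => -[ej ez].
  case: H => a [b [_ _ Hx _ _]]; apply: Hx => i.
  move: c'; rewrite -ej -ez => -[_ /(_ i) /andP[u1 u2]].
  case: c => _ /(_ i) /andP[v1 v2].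
  have := step_gt0 j; move: u2 v2; rewrite !mulrDl !mul1r => u2 v2 s0.
  by rewrite ler_norml; apply/andP; split; lra.
- move=> y N.
  pose phi (k : 'I_N) : IT := match @pickle_inv idx k with
    | Some p => (inord (p.1 %% ba.+1), [ffun i => inord `|(p.2 ord0 i %% bz%:Z)%Z|%N])
    | None => (ord0, [ffun=> ord0]) end.
  apply: (@leq_card_in _ _ phi) => k k'; rewrite !inE => Kk Kk'.
  have dataK (q : 'I_N) : (KE q).1 y -> exists j z x,
     [/\ pickle_inv (q : nat) = Some ((j, z) : idx), grid_cell j z x &
      enorm (y - x) <= rho x * (1 + (1 - L) / 2)].
    case: (HKE q) => [[j [z [x [e c H]]]]|[-> _ _]] // Ky.
    by exists j, z, x; split => //; case: H => a [b [_ _ _ near _]]; exact: near.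
  have [j [z [x [e c n]]]] := dataK k Kk.
  have [j' [z' [x' [e' c' n']]]] := dataK k' Kk'.
  rewrite /phi e e' /= => -[ejj ezz].
  have scale jj zz xx jj' zz' xx' : grid_cell jj zz xx -> grid_cell jj' zz' xx' ->
     enorm (y - xx) <= rho xx * (1 + (1 - L) / 2) ->
     enorm (y - xx') <= rho xx' * (1 + (1 - L) / 2) -> (jj < jj' + ba.+1)%N.
    move=> [/andP[a1 a2] _] [/andP[b1 b2] _] /rho_near /andP[r1 r2] /rho_near /andP[r3 r4].
    rewrite ltnNge; apply/negP => le.
    have : 2 ^+ (jj' + ba.+1) <= 2 ^+ jj :> R by apply: ler_weXn2l => //; lra.
    rewrite exprD => H1.
    have H2 : 2 ^+ jj' * (8 / (1 - L)) <= 2 ^+ jj :> R.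
      by apply: le_trans H1; rewrite ler_pM2l // exprn_gt0.
    have H3 : 2 ^+ jj' * 8 * m <= 2 ^+ jj * m * (1 - L).
      by rewrite -ler_pdivrMr // mulrAC ler_pM2r // -mulrA.
    have H4 : 2 ^+ jj * m * (1 - L) <= rho xx * (1 - L) by rewrite ler_pM2r.
    move: b2; rewrite exprS => b2; move: r1 r4; lra.
  have jj' : j = j'.
    have h1 := scale _ _ _ _ _ _ c c' n n'; have h2 := scale _ _ _ _ _ _ c' c n' n.
    apply: modn_close h1 h2.
    by have := congr1 (@nat_of_ord _) ejj; rewrite !inordK ?ltn_pmod.
  subst j'.
  have s0 := step_gt0 j.
  have dist zz xx : grid_cell j zz xx -> enorm (y - xx) <= rho xx * (1 + (1 - L) / 2) ->
     forall i, `|(zz ord0 i)%:~R * step j - y ord0 i| <= step j + 4 / mesh * step j.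
    move=> [/andP[a1 a2] hz] near i; have /andP[b1 b2] := hz i.
    have := le_trans (enorm_coord (y - xx) i) near; rewrite !mxE => H.
    have H1 : rho xx * (1 + (1 - L) / 2) <= 4 / mesh * step j.
      rewrite (_ : 4 / mesh * step j = 4 * (2 ^+ j * m)); last first.
        by rewrite /step; field; rewrite gt_eqF.
      apply: (@le_trans _ _ (rho xx * 2)); first by rewrite ler_pM2l ?rho0 //; lra.
      by move: a2; rewrite exprS; lra.
    move: (le_trans H H1); rewrite !ler_norml => /andP[H2 H3].
    by move: b2; rewrite mulrDl mul1r => b2; apply/andP; split; lra.
  have zz' : z = z'.
    apply/rowP => i; apply: (@modz_close bz).
      have := congr1 (fun f : {ffun 'I_d -> 'I_bz.+1} => nat_of_ord (f i)) ezz.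
      have mz (u : int) : (`|(u %% bz%:Z)%Z| < bz.+1)%N.
        by rewrite ltnS ltnW // -ltz_nat gez0_abs ?modz_ge0 // ltz_pmod.
      rewrite !ffunE !inordK // => /(congr1 Posz).
      by rewrite !gez0_abs ?modz_ge0.
    have h1 := dist _ _ c n i; have h2 := dist _ _ c' n' i.
    rewrite -(@ltr_nat R) natr_absz -(@ltr_pM2r _ (step j)) //.
    rewrite intr_norm intrD intrN.
    rewrite (_ : `|_| * step j = `|(z ord0 i)%:~R * step j - (z' ord0 i)%:~R * step j|); last first.
      by rewrite -mulrBl normrM (gtr0_norm s0).
    apply: (@le_lt_trans _ _ ((2 + 8 / mesh) * step j)); last by rewrite ltr_pM2r.
    rewrite (_ : (2 + 8 / mesh) * step j = 2 * (step j + 4 / mesh * step j)); last first.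
      by field; rewrite gt_eqF.
    move: h1 h2; rewrite !ler_norml => /andP[h1 h2] /andP[h3 h4].
    by apply/andP; split; lra.
  apply/val_inj => /=.
  have p1 := @pickle_invK idx k; have p2 := @pickle_invK idx k'.
  by move: p1 p2; rewrite e e' /= zz' => -> .
Qed.
End geometry.

(** * Choice of the interpolation order *)

Section numerics.
Context (R : realType) (mu nu delta : R).
Hypotheses (mu01 : 0 < mu <= 1) (nu0 : 0 < nu) (delta01 : 0 <= delta <= 1)
  (s_le1 : mu + delta * nu <= 1).

Local Notation s := (mu + delta * nu).
Local Notation e := (expR (1 : R)).

(** An integer power of [<x>] dominating [<x> ^ (delta * n)]. *)
Definition bracket_order (n : nat) : nat := (Num.truncn (delta * n%:R)).+1.

Lemma bracket_order_ge n : delta * n%:R <= (bracket_order n)%:R.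
Proof.
have h : 0 <= delta * n%:R by case/andP: delta01 => ? _; rewrite mulr_ge0.
by have /andP[_ /ltW] := truncn_itv h.
Qed.

Let trunc_le n : (Num.truncn (delta * n%:R) <= n)%N.
Proof.
case/andP: delta01 => h0 h1.
have h : 0 <= delta * n%:R by rewrite mulr_ge0.
have /andP[h2 _] := truncn_itv h.
by rewrite -(@ler_nat R) (le_trans h2) // ler_piMl.
Qed.

Lemma fact_ge1 n : 1 <= n`!%:R :> R.
Proof. by rewrite ler1n fact_gt0. Qed.

Lemma fact_le_expn q : (q`! <= q ^ q)%N.
Proof.
elim: q => // q IH; rewrite factS expnS leq_mul2l /= (leq_trans IH) //.
by case: q {IH} => // q; rewrite leq_exp2r.
Qed.

Lemma succ_le_exp n : n.+1%:R <= expR n%:R :> R.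
Proof. by rewrite -natr1 addrC expR_ge1Dx. Qed.

(** Trades the factorial of the power of [<x>] for that of the order of derivation;
    it comes from [q! <= q ^ q] with [q <= delta * n] and from [n ^ n <= e ^ n * n!]. *)
Lemma bracket_fact n :
  (bracket_order n)`!%:R <= expR (2 * n%:R) * n`!%:R `^ delta :> R.
Proof.
case/andP: delta01 => h0 h1.
rewrite /bracket_order; set q := Num.truncn _.
have qn : (q <= n)%N by exact: trunc_le.
have qd : q%:R <= delta * n%:R.
  by have /andP[] := truncn_itv (mulr_ge0 h0 (ler0n R n)).
rewrite factS natrM mulrDl mul1r expRD -mulrA; apply: ler_pM => //.
  by apply: le_trans (succ_le_exp n); rewrite ler_nat ltnS.
clearbody q; case: n qn qd => [|n] qn qd.
  by rewrite (_ : q = 0%N) ?fact0 ?powR1 ?expR0 ?mulr1 //; lia.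
have n1 : 1 <= n.+1%:R :> R by rewrite ler1n.
apply: (@le_trans _ _ (n.+1%:R `^ (delta * n.+1%:R))).
  apply: (@le_trans _ _ (n.+1%:R `^ q%:R)); last exact: ler_powR.
  rewrite powR_mulrn // -natrX ler_nat (leq_trans (fact_le_expn q)) //.
  by case: (q) qn => // q' qn; rewrite leq_exp2r.
rewrite mulrC powRrM powR_mulrn //.
apply: (@le_trans _ _ ((expR n.+1%:R * n.+1`!%:R) `^ delta)).
  by rewrite ge0_ler_powR ?nnegrE ?mulr_ge0 ?expR_ge0 ?exprn_ge0 // expnn_le_fact.
rewrite powRM ?expR_ge0 // ler_wpM2r ?powR_ge0 //.
rewrite -[X in _ <= X]powRr1 ?expR_ge0 //; apply: ler_powR => //.
by rewrite expR_ge1.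
Qed.

Variables (W0 c : R).
Hypotheses (W0_ge0 : 0 <= W0) (c_ge0 : 0 <= c).

(** What an error of order [n] costs in units of the weighted supremum, when it is
    scaled by lengths at most [c * <x> ^ delta]; the factor [W0] will count the
    directions and the overlaps. *)
Definition weight (A : R) (n : nat) : R :=
  W0 * c ^+ (2 * n) * (factorial_weight A mu nu (bracket_order n) n) ^+ 2.

Definition weight_base : R := c * expR (2 * nu).

Lemma weight_ge0 A n : 0 <= weight A n.
Proof. by apply: mulr_ge0; [rewrite mulr_ge0 ?exprn_ge0 | exact: sqr_ge0]. Qed.

(** The weight grows like [(n!) ^ (2 * s)] with [s = mu + delta * nu], up to the
    power [2 * n] of a multiple of [A ^ 2]. *)
Lemma weight_le A n : 1 <= A ->
  weight A n <= W0 * A ^+ 2 * (weight_base * A ^+ 2) ^+ (2 * n) * (n`!%:R `^ s) ^+ 2.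
Proof.
move=> A1; have A0 : 0 <= A by rewrite (le_trans ler01).
have f0 : n`!%:R != 0 :> R by rewrite pnatr_eq0 -lt0n fact_gt0.
have fw : factorial_weight A mu nu (bracket_order n) n <=
    A ^+ (2 * n + 1) * expR (2 * nu) ^+ n * n`!%:R `^ s.
  rewrite /factorial_weight powRD ?f0 ?implybT // mulrA.
  rewrite mulrAC [X in _ <= X](_ : _ = A ^+ (2 * n + 1) * n`!%:R `^ mu *
     (expR (2 * nu) ^+ n * n`!%:R `^ (delta * nu))); last by ring.
  apply: ler_pM; rewrite ?mulr_ge0 ?exprn_ge0 ?powR_ge0 //.
    rewrite ler_wpM2r ?powR_ge0 //; apply: ler_weXn2l => //.
    by rewrite /bracket_order addSn mul2n -addnn addn1 ltnS leq_add2r trunc_le.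
  apply: (@le_trans _ _ ((expR (2 * n%:R) * n`!%:R `^ delta) `^ nu)).
    rewrite ge0_ler_powR ?nnegrE ?mulr_ge0 ?expR_ge0 ?powR_ge0 ?(ltW nu0) //.
    exact: bracket_fact.
  have -> : expR (2 * nu) ^+ n = expR (2 * n%:R) `^ nu.
    by rewrite /powR gt_eqF ?expR_gt0 // expRK -expRM_natr; congr expR; ring.
  by rewrite powRM ?expR_ge0 ?powR_ge0 // -powRrM.
have fw0 : 0 <= factorial_weight A mu nu (bracket_order n) n.
  by rewrite /factorial_weight !mulr_ge0 ?exprn_ge0 ?powR_ge0.
have fw2 := lerXn2r 2 (fw0 : _ \in Num.nneg) (le_trans fw0 fw) fw.
rewrite /weight; apply: (le_trans (ler_wpM2l _ fw2)); first by rewrite mulr_ge0 ?exprn_ge0.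
rewrite le_eqVlt; apply/orP; left; apply/eqP.
have x2 (x : R) : x ^+ (2 * n) = (x ^+ n) ^+ 2 by rewrite mulnC exprM.
have A2 : (A ^+ 2) ^+ n = (A ^+ n) ^+ 2 by rewrite -exprM mulnC exprM.
rewrite /weight_base exprD !x2 (exprMn _ _ (A ^+ 2)) A2 (exprMn _ c) expr1.
by ring.
Qed.

Definition order_cst : R := W0 * (4 + 8 * weight_base ^+ 2) + 1.

Lemma weight_base_ge0 : 0 <= weight_base.
Proof. by rewrite mulr_ge0 ?expR_ge0. Qed.

Lemma order_cst_ge1 : 1 <= order_cst.
Proof.
by rewrite lerDr mulr_ge0 // addr_ge0 // mulr_ge0 // exprn_ge0 // weight_base_ge0.
Qed.

(** What is left of the [1 / N!] of the interpolation remainder after the growth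
    [N! ^ s] of the weight: a decay of exponent [1 - s], none at all if [s = 1]. *)
Lemma fact_ratio N : (0 < N)%N ->
  N`!%:R `^ s / N`!%:R <= ((e / N%:R) `^ (1 - s)) ^+ N.
Proof.
move=> N0; have N0R : (0 : R) < N%:R by rewrite ltr0n.
have f1 := fact_ge1 N; have f0 : (0 : R) < N`!%:R by rewrite (lt_le_trans ltr01).
have t0 : 0 <= 1 - s by rewrite subr_ge0.
have -> : N`!%:R `^ s / N`!%:R = (N`!%:R `^ (1 - s))^-1 :> R.
  have fne : N`!%:R != 0 :> R by rewrite gt_eqF.
  rewrite -powRN -[X in _ / X](powRr1 (ltW f0)) -powRN -powRD ?fne ?implybT //.
  by congr powR; ring.
have en0 : 0 <= e / N%:R by rewrite divr_ge0 ?expR_ge0.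
have -> : ((e / N%:R) `^ (1 - s)) ^+ N = ((e / N%:R) ^+ N) `^ (1 - s).
  by rewrite -powR_mulrn ?powR_ge0 // -powRrM [(1 - s) * _]mulrC powRrM powR_mulrn.
rewrite -[X in X <= _]mul1r ler_pdivrMr ?powR_gt0 // -powRM ?exprn_ge0 ?(ltW f0) //.
have p1 : (1 : R) `^ (1 - s) = 1 by rewrite powR1.
rewrite -[X in X <= _]p1 ge0_ler_powR ?nnegrE ?mulr_ge0 ?exprn_ge0 ?(ltW f0) //.
rewrite exprMn exprVn mulrAC ler_pdivlMr ?exprn_gt0 // mul1r.
by have := expnn_le_fact R N; rewrite -[X in expR X](mul1r N%:R) expRM_natr.
Qed.

(** The hypothesis on [N] says that each order brings the remainder down by a factor
    [1 / e]; the remainder at order [N] is then at most [e ^ (-2 * N)] up to a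
    polynomial factor [A ^ 6], and [2 * N] only has to exceed the logarithm of the
    prefactors. *)
Lemma order_error (A theta eta : R) (N : nat) : 1 <= A -> 0 <= theta <= 2 ->
  0 < eta -> (0 < N)%N ->
  (e * weight_base * A ^+ 2 * theta) * (e / N%:R) `^ (1 - s) <= expR (- 1) ->
  ln order_cst + 6 * ln A - ln eta <= 2 * N%:R ->
  4 * theta ^+ (2 * N) / N`!%:R ^+ 2 * weight A N +
  2 * theta ^+ (2 * N.+1) / N`!%:R ^+ 2 * weight A N.+1 <= eta.
Proof.
move=> A1 /andP[th0 th2] eta0 N0 HY HN.
have A0 : 0 <= A by rewrite (le_trans ler01).
have A0' : 0 < A by rewrite (lt_le_trans ltr01).
have wb0 := weight_base_ge0; have s0 : 0 <= s.
  by case/andP: mu01 => /ltW m0 _; case/andP: delta01 => ? _; rewrite addr_ge0 // mulr_ge0 // ltW.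
have f0 : (0 : R) < N`!%:R by rewrite (lt_le_trans ltr01) // fact_ge1.
pose q := N`!%:R `^ s / N`!%:R : R.
have q0 : 0 <= q by rewrite divr_ge0 ?powR_ge0.
pose Y := weight_base * A ^+ 2 * theta.
have Y0 : 0 <= Y by rewrite !mulr_ge0 ?exprn_ge0.
have term1 : 4 * theta ^+ (2 * N) / N`!%:R ^+ 2 * weight A N <=
    4 * W0 * A ^+ 2 * Y ^+ (2 * N) * q ^+ 2.
  apply: (le_trans (ler_wpM2l _ (weight_le N A1))).
    by rewrite !mulr_ge0 ?exprn_ge0 // invr_ge0 exprn_ge0.
  rewrite le_eqVlt; apply/orP; left; apply/eqP.
  rewrite /Y /q [in RHS]exprMn (exprMn _ (N`!%:R `^ s)) exprVn.
  by ring.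
have succ : N.+1`!%:R `^ s / N`!%:R <= expR N%:R * q :> R.
  rewrite factS natrM powRM // /q mulrA ler_wpM2r ?invr_ge0 // ler_wpM2r ?powR_ge0 //.
  apply: (@le_trans _ _ (N.+1%:R `^ 1)); first by apply: ler_powR => //; rewrite ler1n.
  by rewrite powRr1 // succ_le_exp.
have term2 : 2 * theta ^+ (2 * N.+1) / N`!%:R ^+ 2 * weight A N.+1 <=
    2 * W0 * A ^+ 2 * (Y ^+ (2 * N) * Y ^+ 2) * (expR N%:R * q) ^+ 2.
  apply: (le_trans (ler_wpM2l _ (weight_le N.+1 A1))).
    by rewrite !mulr_ge0 ?exprn_ge0 // invr_ge0 exprn_ge0.
  apply: (@le_trans _ _ (2 * W0 * A ^+ 2 * (Y ^+ (2 * N) * Y ^+ 2) *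
       (N.+1`!%:R `^ s / N`!%:R) ^+ 2)).
    rewrite le_eqVlt; apply/orP; left; apply/eqP.
    rewrite -exprD (_ : (2 * N + 2 = 2 * N.+1)%N); last by rewrite mulnS addnC.
    by rewrite /Y [in RHS]exprMn (exprMn _ (N.+1`!%:R `^ s)) exprVn; ring.
  apply: ler_wpM2l; first by rewrite !mulr_ge0 ?exprn_ge0.
  by rewrite lerXn2r ?nnegrE ?mulr_ge0 ?powR_ge0 ?expR_ge0 ?invr_ge0.
have e1 : 1 <= expR N%:R ^+ 2 :> R.
  by rewrite exprn_ege1 // expR_ge1.
have Ysq : Y ^+ 2 <= 4 * weight_base ^+ 2 * A ^+ 4.
  have -> : Y ^+ 2 = weight_base ^+ 2 * A ^+ 4 * theta ^+ 2 by rewrite /Y; ring.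
  have -> : 4 * weight_base ^+ 2 * A ^+ 4 = weight_base ^+ 2 * A ^+ 4 * 2 ^+ 2 by ring.
  by rewrite ler_wpM2l ?mulr_ge0 ?exprn_ge0 // lerXn2r ?nnegrE.
pose E := Y ^+ (2 * N) * (expR N%:R * q) ^+ 2.
have E0 : 0 <= E by rewrite mulr_ge0 ?exprn_ge0 ?mulr_ge0 ?expR_ge0.
have tot : 4 * theta ^+ (2 * N) / N`!%:R ^+ 2 * weight A N +
  2 * theta ^+ (2 * N.+1) / N`!%:R ^+ 2 * weight A N.+1 <= order_cst * A ^+ 6 * E.
  apply: (le_trans (lerD term1 term2)).
  have A6 : A ^+ 2 <= A ^+ 6 by apply: ler_weXn2l.
  have h1 : 4 * W0 * A ^+ 2 * Y ^+ (2 * N) * q ^+ 2 <= 4 * W0 * A ^+ 6 * E.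
    have h : Y ^+ (2 * N) * q ^+ 2 <= E.
      rewrite /E ler_wpM2l ?exprn_ge0 // [X in _ <= X]exprMn.
      by rewrite -[X in X <= _]mul1r ler_wpM2r ?sqr_ge0.
    rewrite [X in X <= _](_ : _ = (4 * W0) * (A ^+ 2 * (Y ^+ (2 * N) * q ^+ 2))); last by ring.
    rewrite [X in _ <= X](_ : _ = (4 * W0) * (A ^+ 6 * E)); last by ring.
    rewrite ler_wpM2l //; first by rewrite mulr_ge0.
    by rewrite ler_pM ?mulr_ge0 ?exprn_ge0.
  have h2 : 2 * W0 * A ^+ 2 * (Y ^+ (2 * N) * Y ^+ 2) * (expR N%:R * q) ^+ 2 <=
      8 * weight_base ^+ 2 * W0 * A ^+ 6 * E.
    rewrite [X in X <= _](_ : _ = 2 * W0 * A ^+ 2 * E * Y ^+ 2); last by rewrite /E; ring.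
    apply: (@le_trans _ _ (2 * W0 * A ^+ 2 * E * (4 * weight_base ^+ 2 * A ^+ 4))).
      by rewrite ler_wpM2l // !mulr_ge0 ?exprn_ge0.
    by rewrite le_eqVlt; apply/orP; left; apply/eqP; ring.
  apply: (le_trans (lerD h1 h2)).
  rewrite -subr_ge0 (_ : _ - _ = A ^+ 6 * E); last by rewrite /order_cst; ring.
  by rewrite mulr_ge0 ?exprn_ge0.
apply: (le_trans tot).
have EE : E <= expR (- (2 * N%:R)).
  have -> : E = ((e * Y) ^+ N * q) ^+ 2.
    rewrite /E -[X in expR X](mul1r N%:R) expRM_natr !exprMn -!exprM mulnC.
    by ring.
  rewrite (_ : - (2 * N%:R) = (- 1) * N%:R * 2%:R); last by ring.
  rewrite !expRM_natr lerXn2r ?nnegrE ?mulr_ge0 ?exprn_ge0 ?expR_ge0 ?mulr_ge0 ?expR_ge0 //.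
  apply: (@le_trans _ _ ((e * Y) ^+ N * ((e / N%:R) `^ (1 - s)) ^+ N)).
    by rewrite ler_wpM2l ?exprn_ge0 ?mulr_ge0 ?expR_ge0 //; exact: fact_ratio.
  rewrite -exprMn lerXn2r ?nnegrE ?mulr_ge0 ?powR_ge0 ?expR_ge0 //.
  by apply: le_trans HY; rewrite /Y !mulrA.
have oc1 := order_cst_ge1; have oc0 := lt_le_trans ltr01 oc1.
apply: (@le_trans _ _ (order_cst * A ^+ 6 * expR (- (2 * N%:R)))).
  by rewrite ler_wpM2l // mulr_ge0 ?exprn_ge0 // ltW.
rewrite -[X in _ <= X](lnK eta0) -[X in X * _ * _](lnK oc0) -[X in _ * X ^+ 6 * _](lnK A0').
rewrite -expRM_natr -!expRD ler_expR.
by move: HN; rewrite (mulrC 6); lra.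
Qed.
End numerics.

Lemma nat_above (R : realType) (q : R) : 0 <= q ->
  exists N : nat, (0 < N)%N /\ q <= N%:R <= q + 1.
Proof.
move=> q0; exists (Num.truncn q).+1; split => //.
have /andP[h1 h2] := truncn_itv q0; rewrite (ltW h2) /=.
by rewrite -natr1 lerD2r.
Qed.

Section orders.
Context (R : realType) (mu nu delta : R).
Hypotheses (mu01 : 0 < mu <= 1) (nu0 : 0 < nu) (delta01 : 0 <= delta <= 1).
Variables (W0 c : R).
Hypotheses (W0_ge0 : 0 <= W0) (c_ge0 : 0 <= c).
Local Notation s := (mu + delta * nu).
Local Notation e := (expR (1 : R)).
Local Notation w := (weight mu nu delta W0 c).
Local Notation wb := (weight_base nu c).
Local Notation oc := (order_cst nu W0 c).

Let oc1 : 0 <= ln oc.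
Proof. by apply: ln_ge0; exact: order_cst_ge1. Qed.

Let wb0 : 0 <= wb. Proof. exact: weight_base_ge0. Qed.

(** If [s < 1], orders [N] from a multiple of [A ^ (2 / (1 - s))] on make
    [A ^ 2 * (e / N) ^ (1 - s)] small, so that one interpolation on the whole segment
    suffices. *)
Lemma good_order_subcritical : s < 1 -> exists T0, 1 <= T0 /\ forall A, 1 <= A ->
  good_order (w A) (A `^ (2 / (1 - s))) 1 T0.
Proof.
move=> s1; set t := 1 - s; have t0 : 0 < t by rewrite subr_gt0.
have s0 : 0 <= s.
  by case/andP: mu01 => /ltW m0 _; case/andP: delta01 => ? _; rewrite addr_ge0 // mulr_ge0 // ltW.
pose c0 := e * (e * e * wb) `^ t^-1.
have c00 : 0 <= c0 by rewrite mulr_ge0 ?expR_ge0 ?powR_ge0.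
exists (c0 + ln oc + 4); split.
  by move: c00 oc1; lra.
move=> A A1 eta /andP[eta0 eta1].
have A0 : 0 < A by rewrite (lt_le_trans ltr01).
set X := A `^ (2 / t).
have AX : A <= X.
  rewrite /X -[X in X <= _]powRr1 ?(ltW A0) //; apply: ler_powR => //.
  by rewrite ler_pdivlMr // mul1r /t; move: s0; lra.
have lnA : ln A <= X.
  have h : ln (1 + (A - 1)) <= A - 1 by apply: le_ln1Dx; lra.
  by move: h AX; rewrite (_ : 1 + (A - 1) = A); [lra | ring].
have lnA0 : 0 <= ln A by exact: ln_ge0.
have le0 : 0 <= - ln eta by rewrite oppr_ge0 ln_le0.
have X0 : 0 <= X by exact: powR_ge0.
pose q := c0 * X + (ln oc + 6 * ln A - ln eta) / 2.
have q0 : 0 <= q.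
  have : 0 <= c0 * X by rewrite mulr_ge0.
  by move: oc1; rewrite /q; lra.
have [N [N0 /andP[qN Nq]]] := nat_above q0.
exists N; split => //.
  apply: (le_trans Nq); rewrite /q.
  have h1 : 0 <= c0 * (1 - ln eta) by rewrite mulr_ge0 //; lra.
  have h2 : 0 <= ln oc * (- ln eta + X) by rewrite mulr_ge0 ?addr_ge0.
  rewrite -subr_ge0.
  rewrite (_ : _ - _ = c0 * (1 - ln eta) + ln oc * (- ln eta + X) + ln oc / 2 +
     3 * (1 - ln eta) + 3 * (X - ln A) + X - ln eta / 2); last by field.
  by move: oc1; lra.
have N0R : (0 : R) < N%:R by rewrite ltr0n.
have s1' : s <= 1 by exact: ltW.
apply: order_error => //; first by rewrite ler01 ler1n.
  set Y := e * wb * A ^+ 2 * 1.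
  have NQ : e * Y <= (N%:R / e) `^ t.
    have -> : e * Y = ((e * Y) `^ t^-1) `^ t.
      by rewrite -powRrM mulVf ?gt_eqF // powRr1 // /Y !mulr_ge0 ?expR_ge0 ?exprn_ge0 ?(ltW A0).
    rewrite ge0_ler_powR ?nnegrE ?powR_ge0 ?divr_ge0 ?expR_ge0 ?(ltW t0) //.
    rewrite ler_pdivlMr ?expR_gt0 //.
    apply: le_trans (_ : c0 * X <= _); last first.
      by apply: le_trans qN; rewrite /q lerDl; move: oc1; lra.
    rewrite (_ : e * Y = e * e * wb * A ^+ 2); last by rewrite /Y; ring.
    rewrite powRM ?exprn_ge0 ?(ltW A0) ?mulr_ge0 ?expR_ge0 //.
    rewrite /X (powRrM A 2) powR_mulrn ?(ltW A0) //.
    by rewrite /c0 le_eqVlt; apply/orP; left; apply/eqP; ring.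
  have e0 : 0 < e by exact: expR_gt0.
  have Ne : (N%:R / e) `^ t * (e / N%:R) `^ t = 1.
    rewrite -powRM ?divr_ge0 ?(ltW e0) // (_ : N%:R / e * _ = 1) ?powR1 //.
    by field; rewrite !gt_eqF.
  have h := ler_wpM2r (powR_ge0 (e / N%:R) t) NQ.
  rewrite Ne in h; rewrite expRN -(@ler_pM2l _ e) // divff ?gt_eqF //.
  by rewrite mulrA.
move: qN; rewrite /q; have : 0 <= c0 * X by rewrite mulr_ge0.
by lra.
Qed.

(** If [s = 1], the order does not help against [A ^ 2]; the subdivision into [M]
    pieces does, with [M] a multiple of [A ^ 2], since it brings a factor [2 / M].
    The order then only depends on the tolerance and on [ln A]. *)
Lemma good_order_critical : s = 1 -> exists T0 Hc, [/\ 1 <= T0, 0 <= Hc & forall A, 1 <= A ->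
  exists M : nat, [/\ (0 < M)%N, M%:R <= Hc * A ^+ 2 &
    good_order (w A) (ln A) (2 / M%:R) T0]].
Proof.
move=> s1.
exists (ln oc + 7), (2 * e ^+ 2 * wb + 1); split.
- by move: oc1; lra.
- by rewrite addr_ge0 ?mulr_ge0 ?exprn_ge0 ?expR_ge0.
move=> A A1; have A0 : 0 < A by rewrite (lt_le_trans ltr01).
have A2 : 1 <= A ^+ 2 by rewrite exprn_ege1.
have q0 : 0 <= 2 * e ^+ 2 * wb * A ^+ 2.
  by rewrite !mulr_ge0 ?exprn_ge0 ?expR_ge0 ?(ltW A0).
have [M [M0 /andP[qM Mq]]] := nat_above q0.
have MR : (0 : R) < M%:R by rewrite ltr0n.
exists M; split => //; first by rewrite mulrDl mul1r; lra.
move=> eta /andP[eta0 eta1].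
have lnA0 : 0 <= ln A by exact: ln_ge0.
have le0 : 0 <= - ln eta by rewrite oppr_ge0 ln_le0.
have q'0 : 0 <= (ln oc + 6 * ln A - ln eta) / 2.
  by move: oc1; lra.
have [N [N0 /andP[qN Nq]]] := nat_above q'0.
exists N; split => //.
  apply: (le_trans Nq).
  have h : 0 <= ln oc * (- ln eta + ln A) by rewrite mulr_ge0 ?addr_ge0.
  rewrite -subr_ge0 (_ : _ - _ = ln oc * (- ln eta + ln A) + ln oc / 2 +
     6 - ln eta * (13 / 2) + 4 * ln A); last by field.
  by move: oc1; lra.
apply: order_error => //; first by rewrite s1.
- rewrite divr_ge0 // ler_pdivrMr // ler_peMr // ler1n //.
- rewrite s1 subrr powRr0 mulr1.
  rewrite expRN -(@ler_pM2l _ e) ?expR_gt0 // divff ?gt_eqF ?expR_gt0 //.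
  rewrite (_ : e * (e * wb * A ^+ 2 * (2 / M%:R)) = 2 * e ^+ 2 * wb * A ^+ 2 / M%:R).
    by rewrite ler_pdivrMr // mul1r.
  by ring.
- by move: qN; lra.
Qed.
End orders.

(** * Sums over a covering, and weighted derivatives *)

Section sums.
Context d (T : measurableType d) (R : realType) (m : {measure set T -> \bar R}).

Let sqE (D : set T) (u : T -> R) : measurable D ->
  sqint m D u = (\int[m]_x ((\1_D x * u x ^+ 2)%:E))%E.
Proof.
move=> mD; rewrite /sqint integral_mkcond; apply: eq_integral => x _.
rewrite patchE indicE; case: ifP => _; first by rewrite mul1r.
by rewrite mul0r.
Qed.

Let msq (D : set T) (u : T -> R) : measurable D -> measurable_fun setT u ->
  measurable_fun setT (fun x => (\1_D x * u x ^+ 2)%:E).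
Proof.
move=> mD mu; apply/measurable_EFinP; apply: measurable_funM.
  exact: measurable_indic.
exact: measurable_funX.
Qed.

Let sq0 (D : set T) (u : T -> R) x : (0 <= (\1_D x * u x ^+ 2)%:E)%E.
Proof. by rewrite lee_fin mulr_ge0 ?sqr_ge0. Qed.

Lemma sqint_cover_le (K : nat -> set T) (u : T -> R) (b : \bar R) :
  (forall k, measurable (K k)) -> measurable_fun setT u ->
  (forall x, exists k, K k x) ->
  (forall N, \sum_(0 <= k < N) sqint m (K k) u <= b)%E -> (sqint m setT u <= b)%E.
Proof.
move=> mK mu cov H.
apply: (@le_trans _ _ (\sum_(k <oo) sqint m (K k) u)%E); last first.
  apply: lime_le; first by apply: is_cvg_nneseries => k _ _; exact: sqint_ge0.
  by apply: nearW => N; exact: H.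
rewrite (@eq_eseriesr _ _ (fun k => \int[m]_x ((\1_(K k) x * u x ^+ 2)%:E))%E); last first.
  by move=> k _; exact: sqE.
rewrite -integral_nneseries //; last by move=> k; exact: msq.
apply: ge0_le_integral => //.
- by move=> x _; rewrite lee_fin sqr_ge0.
- exact: measurable_sqr.
- by apply: ge0_emeasurable_sum => [k x _ _|k _]; [exact: sq0|exact: msq].
- move=> x _; have [k Kx] := cov x.
  apply: (@le_trans _ _ (\1_(K k) x * u x ^+ 2)%:E).
    by rewrite indicE mem_set // mul1r.
  rewrite (@nneseriesD1 _ _ k xpredT) //.
  by rewrite leeDl //; apply: nneseries_ge0 => i _ _; exact: sq0.
Qed.

(** [B] bounds the multiplicity of the family, so the indicators add up to at most
    [B] on [D]. *)
Lemma sqint_overlap (K : nat -> set T) (D : set T) (h : T -> R) (B N : nat) :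
  (forall k, measurable (K k)) -> measurable D -> measurable_fun setT h ->
  (forall k, K k `<=` D) ->
  (forall y, (#|[set k : 'I_N | `[< K k y >]]%SET| <= B)%N) ->
  (\sum_(0 <= k < N) sqint m (K k) h <= B%:R%:E * sqint m D h)%E.
Proof.
move=> mK mD mh KD HB.
rewrite big_mkord (eq_bigr (fun k : 'I_N => \int[m]_x ((\1_(K k) x * h x ^+ 2)%:E))%E); last first.
  by move=> k _; exact: sqE.
rewrite -ge0_integral_sum //; last by move=> k; exact: msq.
rewrite (sqE _ mD) -ge0_integralZl //; last exact: msq.
apply: ge0_le_integral => //.
- by move=> x _; apply: sume_ge0 => k _; exact: sq0.
- by apply: emeasurable_sum => k; exact: msq.
- by apply: measurable_funeM; exact: msq.
- move=> x _; rewrite sumEFin -EFinM lee_fin -mulr_suml [X in _ <= X]mulrA.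
  apply: ler_wpM2r; first exact: sqr_ge0.
  have -> : \sum_(k < N) \1_(K k) x = #|[set k : 'I_N | `[< K k x >]]%SET|%:R :> R.
    rewrite -sum1_card natr_sum [RHS]big_mkcond /=; apply: eq_bigr => k _.
    by rewrite indicE inE; case: (boolP (x \in K k)); rewrite ?inE ?notin_setE => h';
      [rewrite asboolT|rewrite asboolF].
  have [Dx|nDx] := pselect (D x).
    by rewrite indicE (mem_set Dx) mulr1 ler_nat.
  rewrite indicE memNset // mulr0.
  by rewrite eq_card0 // => k; rewrite !inE; apply/asboolP => Kx; exact/nDx/(KD k).
Qed.
End sums.

Section smooth.
Context (R : realType) (d : nat).
Implicit Types (g : 'rV[R]_d -> R).

(** In one direction only; [mpartial_single] identifies it with a [mpartial]. *)
Definition iter_partial g (j : 'I_d) (k : nat) : 'rV[R]_d -> R := iter k (partial j) g.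

Lemma iter_partialE g j k : iter_partial g j k = foldr (@partial R d) g (nseq k j).
Proof. by elim: k => //= k ->. Qed.

Lemma smooth_continuous g j k : smooth g -> continuous (iter_partial g j k).
Proof. by move=> sg; rewrite iter_partialE; case: (sg (nseq k j)). Qed.

Lemma smooth_pure_derivs g : smooth g -> pure_derivs g (iter_partial g).
Proof.
move=> sg; split => //.
- by apply: measurable_fun_continuous_rV; case: (sg [::]).
- by move=> j k; apply: measurable_fun_continuous_rV; exact: smooth_continuous.
move=> j x k t.
have dG : derivable (iter_partial g j k) (x + t *: delta_mx ord0 j) (delta_mx ord0 j).
  by rewrite iter_partialE; case: (sg (nseq k j)) => _; exact.
pose F u := iter_partial g j k (x + u *: delta_mx ord0 j).
have E : (fun h : R => h^-1 *: (F (h *: 1 + t) - F t)) =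
  (fun h : R => h^-1 *: (iter_partial g j k (h *: delta_mx ord0 j + (x + t *: delta_mx ord0 j))
      - iter_partial g j k (x + t *: delta_mx ord0 j))).
  apply/funext => h; rewrite /F; congr (_ *: (iter_partial g j k _ - _)).
  by rewrite scalerDl addrCA /GRing.scale /= mulr1.
split; first by rewrite /derivable /= E.
by rewrite /derive /= E.
Qed.
End smooth.

Section weighted.
Context (R : realType) (d : nat).
Implicit Types (f : 'rV[R]_d -> R[i]).
Notation leb := (borel_lebesgue_rV R d).

Definition single_index (j : 'I_d) (n : nat) : 'I_d -> nat :=
  fun i => if i == j then n else 0%N.

Lemma msize_single j n : msize (single_index j n) = n.
Proof.
rewrite /msize (bigD1 j) //= /single_index eqxx big1 ?addn0 // => i /negbTE ->.
by [].
Qed.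

Lemma mpartial_single (g : 'rV[R]_d -> R) j n :
  mpartial (single_index j n) g = iter_partial g j n.
Proof.
rewrite /mpartial.
suff H (s : seq 'I_d) : uniq s ->
    foldr (fun i => iter (single_index j n i) (@partial R d i)) g s =
    if j \in s then iter_partial g j n else g.
  by rewrite H ?enum_uniq // mem_enum.
elim: s => //= i s IH /andP[ins us]; rewrite IH // inE /single_index.
have [<-|ij] /= := eqVneq i j; first by rewrite (negbTE ins).
by [].
Qed.

Lemma jbracket_ge1 (x : 'rV[R]_d) : 1 <= jbracket x.
Proof. by rewrite /jbracket -[X in X <= _]sqrtr1 ler_sqrt ?addr_ge0 ?sqr_ge0 // lerDl sqr_ge0. Qed.

Lemma measurable_jbracket : measurable_fun setT (@jbracket R d).
Proof.
have -> : @jbracket R d = Num.sqrt \o (fun x : 'rV[R]_d => 1 + \sum_(i < d) x ord0 i ^+ 2).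
  by apply/funext => x; rewrite /jbracket enorm_sqr.
apply: measurableT_comp; first by apply: continuous_measurable_fun; exact: sqrt_continuous.
apply: measurable_funD => //; apply: measurable_sum => i; apply: measurable_funX.
exact: (@measurable_rV_coord R d i).
Qed.

Lemma L2norm_weighted (p : nat) j n f : smooth (fun x => complex.Re (f x)) ->
  smooth (fun x => complex.Im (f x)) ->
  (L2norm setT (weighted_partial p (single_index j n) f) ^+ 2 =
   sqint leb setT (fun x => (jbracket x ^+ p * iter_partial (fun y => complex.Re (f y)) j n x)%R) +
   sqint leb setT (fun x => (jbracket x ^+ p * iter_partial (fun y => complex.Im (f y)) j n x)%R))%E.
Proof.
move=> sr si.
have rE : (fun x => complex.Re (weighted_partial p (single_index j n) f x)) =
    (fun x => jbracket x ^+ p * iter_partial (fun y => complex.Re (f y)) j n x).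
  by apply/funext => x; rewrite /weighted_partial /cpartial !mpartial_single /= mul0r subr0.
have iE : (fun x => complex.Im (weighted_partial p (single_index j n) f x)) =
    (fun x => jbracket x ^+ p * iter_partial (fun y => complex.Im (f y)) j n x).
  by apply/funext => x; rewrite /weighted_partial /cpartial !mpartial_single /= mul0r addr0.
have mG (g : 'rV[R]_d -> R) : smooth g ->
    measurable_fun setT (fun x => jbracket x ^+ p * iter_partial g j n x).
  move=> sg; apply: measurable_funM.
    by apply: measurable_funX; exact: measurable_jbracket.
  by apply: measurable_fun_continuous_rV; exact: smooth_continuous.
by rewrite L2norm_sqint ?rE ?iE //; exact: mG.
Qed.

Lemma L2norm_weighted_le (A mu nu : R) (p : nat) (beta : 'I_d -> nat) f :
  0 < A -> (L2norm setT (weighted_partial p beta f) ^+ 2 <=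
    ((factorial_weight A mu nu p (msize beta)) ^+ 2)%:E * weighted_sup A mu nu f)%E.
Proof.
move=> A0; set W := factorial_weight _ _ _ _ _; set N := L2norm _ _.
have W0 : 0 < W.
  by rewrite /W /factorial_weight !mulr_gt0 ?exprn_gt0 // powR_gt0 // ltr0n fact_gt0.
have : ((N / W%:E) ^+ 2 <= weighted_sup A mu nu f)%E.
  by apply: ereal_sup_ubound; exists (p, beta).
move=> H; apply: (@le_trans _ _ ((W ^+ 2)%:E * (N / W%:E) ^+ 2)%E); last first.
  by apply: lee_wpmul2l => //; rewrite lee_fin sqr_ge0.
rewrite inver gt_eqF // !expe2 muleACA -EFinM.
rewrite (_ : (W ^+ 2)%:E * (N * N * (W^-1 * W^-1)%:E) = (N * N) * ((W ^+ 2)%:E * (W^-1 * W^-1)%:E))%E; last first.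
  by rewrite muleCA.
rewrite -EFinM (_ : W ^+ 2 * (W^-1 * W^-1) = 1) ?mule1 //.
by field; rewrite gt_eqF.
Qed.
End weighted.

(** * The global estimate *)

Lemma sqint_le_scale d (T : measurableType d) (R : realType)
    (m : {measure set T -> \bar R}) (D : set T) (c : R) (f h : T -> R) :
  measurable D -> measurable_fun setT f -> measurable_fun setT h ->
  (forall x, D x -> `|c * f x| <= `|h x|) ->
  ((c ^+ 2)%:E * sqint m D f <= sqint m D h)%E.
Proof.
move=> mD mf mh H; rewrite /sqint -ge0_integralZl ?lee_fin ?sqr_ge0 //; last 2 first.
- exact: measurable_sqr (measurable_funTS mf).
- by move=> x _; rewrite lee_fin sqr_ge0.
apply: ge0_le_integral => //.
- by move=> x _; rewrite -EFinM lee_fin mulr_ge0 ?sqr_ge0.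
- by apply: measurable_funeM; exact: measurable_sqr (measurable_funTS mf).
- exact: measurable_sqr (measurable_funTS mh).
- move=> x Dx; rewrite -EFinM lee_fin -exprMn.
  rewrite -[X in X <= _]real_normK ?num_real // -[X in _ <= X]real_normK ?num_real //.
  by rewrite lerXn2r ?nnegrE // H.
Qed.

Section main_estimate.
Context (R : realType) (d : nat) (mu nu delta : R).
Hypothesis (delta01 : 0 <= delta <= 1).
Notation leb := (borel_lebesgue_rV R d).
Variables (rho : 'rV[R]_d -> R) (R0 C gam X T A eps : R) (B : nat).
Variables (omega : set 'rV[R]_d) (K E : nat -> set 'rV[R]_d).
Hypotheses (R00 : 0 < R0) (rhoR : forall x, rho x <= R0 * jbracket x `^ delta)
  (C0 : 0 < C) (A0 : 0 < A) (eps01 : 0 < eps <= 1)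
  (mom : lebesgue_measurable omega).
Hypothesis cells : forall k, (K k = set0 /\ E k = set0) \/ exists a b : 'rV[R]_d,
      [/\ K k = box a b, forall i, a ord0 i < b ord0 i,
        forall y i, K k y -> b ord0 i - a ord0 i <= C * rho y &
        [/\ measurable (E k), E k `<=` omega `&` K k &
           ((gam * 2 ^+ d * vol a b)%:E <= leb (E k))%E]].
Hypothesis cover : forall x, exists k, K k x.
Hypothesis overlap : forall y N, (#|[set k : 'I_N | `[< K k y >]]%SET| <= B)%N.

Let c : R := C * R0.
Let w := weight mu nu delta (d%:R * B%:R) c A.
Hypothesis obs : ctrl w X T (box_obs gam d).

Let c0 : 0 < c. Proof. exact: mulr_gt0. Qed.

Let Ce : R := expR (T * (1 - ln eps + X)).

Let Ce0 : (0 <= Ce%:E)%E. Proof. by rewrite lee_fin expR_ge0. Qed.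

Let mK k : measurable (K k).
Proof. by case: (cells k) => [[-> _]|[a [b [-> _ _ _]]]] //; exact: measurable_box. Qed.

Let mE k : measurable (E k).
Proof. by case: (cells k) => [[_ ->]|[a [b [_ _ _ []]]]]. Qed.

Let EK k : E k `<=` omega `&` K k.
Proof. by case: (cells k) => [[_ ->]|[a [b [_ _ _ []]]]]. Qed.

Let oE : set 'rV[R]_d := \bigcup_k E k.

Let moE : measurable oE. Proof. exact: bigcupT_measurable. Qed.

(* A derivative of order [n] weighted so as to dominate the errors on all cells. *)
Let V (u : 'rV[R]_d -> R) j n (y : 'rV[R]_d) : R :=
  c ^+ n * (jbracket y ^+ (bracket_order delta n) * iter_partial u j n y).

Let mV u j n : smooth u -> measurable_fun setT (V u j n).
Proof.
move=> su; apply: measurable_funM => //; apply: measurable_funM.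
  by apply: measurable_funX; exact: measurable_jbracket.
by apply: measurable_fun_continuous_rV; exact: smooth_continuous.
Qed.

Let Z u k n : \bar R := (\sum_(j < d) sqint leb (K k) (V u j n))%E.

Let Z0 u k n : (0 <= Z u k n)%E.
Proof. by apply: sume_ge0 => j _; exact: sqint_ge0. Qed.

(** Widths of cells are at most [C * rho y] and thus at most [c * <y> ^ delta] at
    each of their points [y]: this is where the growth of [rho] is used. *)
Lemma width_le (l : R) (y : 'rV[R]_d) n : 0 <= l -> l <= C * rho y ->
  l ^+ n <= c ^+ n * jbracket y ^+ (bracket_order delta n).
Proof.
move=> l0 ly; have j1 := jbracket_ge1 y.
have lc : l <= c * jbracket y `^ delta.
  by apply: (le_trans ly); rewrite /c -mulrA ler_pM2l.
apply: (@le_trans _ _ ((c * jbracket y `^ delta) ^+ n)).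
  by rewrite lerXn2r // nnegrE ?(le_trans l0 lc).
rewrite exprMn ler_wpM2l ?exprn_ge0 ?(ltW c0) //.
rewrite -(powR_mulrn n (powR_ge0 _ _)) -powRrM -powR_mulrn ?(le_trans ler01) //.
by apply: ler_powR => //; exact: bracket_order_ge.
Qed.

Lemma cell_estimate s u k : all (fun p => 0 <= p.2) s ->
  (forall x y Z, (0 <= y)%E -> (forall n, (0 <= Z n)%E) -> box_obs gam d x y Z ->
      (x <= Ce%:E * y + err s Z)%E) -> smooth u ->
  (sqint leb (K k) u <= Ce%:E * sqint leb (E k) u + err s (Z u k))%E.
Proof.
move=> s0 H su.
have rhs0 : (0 <= Ce%:E * sqint leb (E k) u + err s (Z u k))%E.
  by rewrite adde_ge0 ?err_ge0 // mule_ge0 ?sqint_ge0.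
case: (cells k) => [[K0 _]|[a [b [KE ab wid [_ _ dens]]]]].
  by rewrite {1}K0 sqint_set0.
apply: H; [exact: sqint_ge0|exact: Z0|].
exists u, (iter_partial u), a, b, (E k); split => //.
- exact: smooth_pure_derivs.
- by split => //; rewrite -KE => y /EK[].
- split => //; first by rewrite KE.
  move=> n; rewrite /box_err /Z; apply: lee_sum => j _.
  rewrite mulnC exprM KE; apply: sqint_le_scale => //.
  + exact: measurable_box.
  + by apply: measurable_fun_continuous_rV; exact: smooth_continuous.
  + exact: mV.
  + move=> y Ky; rewrite /V mulrA !normrM ler_wpM2r //.
    have l0 : 0 <= b ord0 j - a ord0 j by rewrite subr_ge0 ltW.
    rewrite -normrM ger0_norm ?exprn_ge0 //; apply: le_trans (ler_norm _).
    by apply: width_le => //; apply: wid; rewrite KE.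
Qed.

(** Sum over the cells: the observed parts and the errors are counted at most [B]
    times at each point. *)
Lemma real_estimate s u : all (fun p => 0 <= p.2) s ->
  (forall x y Z, (0 <= y)%E -> (forall n, (0 <= Z n)%E) -> box_obs gam d x y Z ->
      (x <= Ce%:E * y + err s Z)%E) -> smooth u ->
  (sqint leb setT u <= Ce%:E * (B%:R%:E * sqint leb oE u) +
     err s (fun n => \sum_(j < d) (B%:R%:E * sqint leb setT (V u j n))))%E.
Proof.
move=> s0 H su.
have mU : measurable_fun setT u.
  by apply: measurable_fun_continuous_rV; case: (su [::]).
apply: (sqint_cover_le mK mU cover) => N.
apply: (@le_trans _ _ (\sum_(0 <= k < N) (Ce%:E * sqint leb (E k) u + err s (Z u k)))%E).
  by apply: lee_sum => k _; exact: cell_estimate.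
rewrite big_split /=; apply: leeD.
  rewrite -ge0_sume_distrr; last by move=> k _; exact: sqint_ge0.
  apply: lee_wpmul2l => //; apply: sqint_overlap => //; first by move=> k y Ey; exists k.
  move=> y; apply: leq_trans (overlap y N); apply: subset_leq_card.
  by apply/fintype.subsetP => k; rewrite !inE => /EK[].
have -> : (\sum_(0 <= k < N) err s (Z u k) = err s (fun n => \sum_(0 <= k < N) Z u k n))%E.
  rewrite /err exchange_big /=; apply: eq_bigr => p _.
  by rewrite ge0_sume_distrr.
apply: err_le => // n; rewrite /Z exchange_big /=; apply: lee_sum => j _.
by apply: sqint_overlap => //; exact: mV.
Qed.

(** The errors add up to [cost] times the weighted supremum, that is, at most [eps]
    times it, whatever the function: the controlled relation on boxes is used at
    tolerance [eps]. *)
Lemma main_estimate f : schwartz f ->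
  (L2norm setT f ^+ 2 <=
     (Ce * B%:R)%:E * L2norm omega f ^+ 2 + eps%:E * weighted_sup A mu nu f)%E.
Proof.
move=> [sr si _].
have [s [s0 sc H]] := obs eps01.
set fr := fun x => complex.Re (f x) in sr; set fi := fun x => complex.Im (f x) in si.
have mr : measurable_fun setT fr by apply: measurable_fun_continuous_rV; case: (sr [::]).
have mi : measurable_fun setT fi by apply: measurable_fun_continuous_rV; case: (si [::]).
have BB : (0 <= B%:R%:E :> \bar R)%E by rewrite lee_fin.
set S := weighted_sup A mu nu f.
have S0 : (0 <= S)%E.
  pose b0 : 'I_d -> nat := fun=> 0%N.
  apply: (@le_trans _ _ ((L2norm setT (weighted_partial 0 b0 f)
                   / (factorial_weight A mu nu 0 (msize b0))%:E) ^+ 2)%E).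
    by apply: sqre_ge0.
  by apply: ereal_sup_ubound; exists (0%N, b0).
have e1 := real_estimate s0 H sr; have e2 := real_estimate s0 H si.
rewrite L2norm_sqint // -/fr -/fi.
apply: (le_trans (leeD e1 e2)); rewrite addeACA; apply: leeD.
  rewrite -ge0_muleDr ?mule_ge0 ?sqint_ge0 // -ge0_muleDr ?sqint_ge0 //.
  rewrite -L2norm_sqint // EFinM -muleA; apply: lee_wpmul2l => //; apply: lee_wpmul2l => //.
  apply: L2norm_subset => //; first exact: borel_lebesgue_measurable.
  by move=> y [k _ /EK[]].
have -> : (err s (fun n => \sum_(j < d) (B%:R%:E * sqint leb setT (V fr j n))) +
    err s (fun n => \sum_(j < d) (B%:R%:E * sqint leb setT (V fi j n))) =
    err s (fun n => \sum_(j < d) (B%:R%:E * (sqint leb setT (V fr j n) + sqint leb setT (V fi j n)))))%E.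
  rewrite /err -big_split /= big_seq [RHS]big_seq; apply: eq_bigr => p ps.
  have p0 := allP s0 _ ps.
  rewrite -ge0_muleDr; last 2 first.
  - by apply: sume_ge0 => j _; rewrite mule_ge0 ?sqint_ge0.
  - by apply: sume_ge0 => j _; rewrite mule_ge0 ?sqint_ge0.
  congr (_ * _)%E; rewrite -big_split /=; apply: eq_bigr => j _.
  by rewrite -ge0_muleDr ?sqint_ge0.
apply: (@le_trans _ _ (err s (fun n => (w n)%:E * S)%E)).
  apply: err_le => // n.
  have term j : (sqint leb setT (V fr j n) + sqint leb setT (V fi j n) <=
      (c ^+ (2 * n) * (factorial_weight A mu nu (bracket_order delta n) n) ^+ 2)%:E * S)%E.
    have Vsq u : smooth u -> sqint leb setT (V u j n) =
       ((c ^+ (2 * n))%:E * sqint leb setT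
          (fun x => (jbracket x ^+ (bracket_order delta n) * iter_partial u j n x)%R))%E.
      move=> su; rewrite /sqint -ge0_integralZl //.
      - by apply: eq_integral => x _; rewrite -EFinM /V exprMn mulnC exprM.
      - apply: measurable_sqr; apply: measurable_funM.
          by apply: measurable_funX; exact: measurable_jbracket.
        by apply: measurable_fun_continuous_rV; exact: smooth_continuous.
      - by move=> x _; rewrite lee_fin sqr_ge0.
      - by rewrite lee_fin exprn_ge0 // ltW.
    have cn0 : (0 <= (c ^+ (2 * n))%:E)%E by rewrite lee_fin exprn_ge0 // ltW.
    rewrite !Vsq // -ge0_muleDr ?sqint_ge0 // -L2norm_weighted // EFinM -muleA.
    apply: lee_wpmul2l => //.
    by have := @L2norm_weighted_le R d A mu nu (bracket_order delta n) (single_index j n) f A0; rewrite msize_single.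
  apply: (@le_trans _ _ (\sum_(j < d) (B%:R%:E * ((c ^+ (2 * n) *
      (factorial_weight A mu nu (bracket_order delta n) n) ^+ 2)%:E * S)))%E).
    by apply: lee_sum => j _; apply: lee_wpmul2l.
  have sumc (x : \bar R) : (\sum_(j < d) x = d%:R%:E * x)%E.
    by rewrite sumr_const card_ord mule_natl.
  rewrite sumc !muleA -!EFinM.
  by rewrite /w /weight -!mulrA.
have -> : err s (fun n => (w n)%:E * S)%E = ((cost w s)%:E * S)%E.
  rewrite /err /cost -sumEFin big_seq [in RHS]big_seq ge0_sume_distrl.
    by apply: eq_bigr => p ps; rewrite EFinM muleA.
  move=> p ps; rewrite lee_fin mulr_ge0 ?(allP s0 _ ps) //.
  by apply: weight_ge0; rewrite ?mulr_ge0 // ltW.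
by apply: lee_wpmul2r => //; rewrite lee_fin.
Qed.
End main_estimate.

Lemma covered_density (R : realType) (d : nat) (gam dens : R) (a b : 'rV[R]_d) (x : \bar R) :
  gam * 2 ^+ d <= dens -> (forall i, a ord0 i < b ord0 i) ->
  ((dens * vol a b)%:E <= x)%E -> ((gam * 2 ^+ d * vol a b)%:E <= x)%E.
Proof.
move=> gd ab; apply: le_trans; rewrite lee_fin ler_wpM2r //.
by apply: prodr_ge0 => i _; rewrite subr_ge0 ltW.
Qed.

Unset Implicit Arguments.
Theorem theorem2p3 (R : realType) (d : nat) (mu nu delta : R)
    (rho : 'rV[R]_d -> R) (gamma : R) :
  (1 <= d)%N ->
  0 < mu <= 1 -> 0 < nu -> 1 <= mu + nu ->
  0 <= delta -> delta <= (1 - mu) / nu -> (1 - mu) / nu <= 1 ->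
  contraction_mapping rho ->
  (exists m R0 : R, [/\ 0 < m, 0 < R0 &
    forall x, m <= rho x <= R0 * jbracket x `^ delta]) ->
  0 < gamma <= 1 ->
  exists K : R, 1 <= K /\
    forall omega : set 'rV[R]_d,
    lebesgue_measurable omega -> gamma_thick gamma rho omega ->
    forall A eps : R, 1 <= A -> 0 < eps <= 1 ->
    exists C : R, [/\ 0 < C,
      (forall f : 'rV[R]_d -> R[i], schwartz f ->
        (L2norm setT f ^+ 2 <=
         C%:E * L2norm omega f ^+ 2 + eps%:E * weighted_sup A mu nu f)%E),
      (delta < (1 - mu) / nu ->
        C <= expR (K * (1 - ln eps + A `^ (2 / (1 - mu - delta * nu))))) &
      (delta = (1 - mu) / nu ->
        C <= expR (K * (1 - ln eps + ln A) * expR (K * A ^+ 2)))].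
Proof.
move=> d1 mu01 nu0 _ delta0 deltale dle1 [rho0 [L L01 rhoL]] [m [R0 [m0 R00 rhob]]] gam01.
have delta01 : 0 <= delta <= 1 by rewrite delta0 (le_trans deltale).
have s_le1 : mu + delta * nu <= 1.
  by rewrite addrC -lerBrDr -ler_pdivlMr.
have rhom x : m <= rho x by case/andP: (rhob x).
have rhoR x : rho x <= R0 * jbracket x `^ delta by case/andP: (rhob x).
have [C [B [C0 cov]]] := covering d1 rho0 L01 rhoL gam01 m0 rhom.
set dens := density d L gamma in cov.
have dens0 : 0 < dens by exact: density_gt0.
(* The minimum with [1/2] is what [line_chain] asks for. *)
pose gam0 := Num.min (dens / 2 ^+ d) 2^-1.
have p2 : (0 : R) < 2 ^+ d by rewrite exprn_gt0.
have g00 : 0 < gam0 by rewrite lt_min divr_gt0 //= invr_gt0.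
have g0h : 0 < gam0 <= 2^-1 by rewrite g00 ge_min lexx orbT.
have g01 : 0 < gam0 <= 1.
  by rewrite g00 (le_trans (andP g0h).2) // invf_le1 // ler1n.
have g0d : gam0 * 2 ^+ d <= dens.
  by rewrite -ler_pdivlMr // ge_min lexx.
pose c := C * R0; have c0 : 0 <= c by rewrite mulr_ge0 ?(ltW C0) ?(ltW R00).
pose W0 : R := d%:R * B%:R; have W00 : 0 <= W0 by rewrite mulr_ge0.
(* [exp lB] bounds the multiplicity of the covering. *)
pose lB : R := ln B.+1%:R.
have lB0 : 0 <= lB by rewrite ln_ge0 // ler1n.
have BE x : B.+1%:R * expR x = expR (lB + x) :> R.
  by rewrite expRD lnK // posrE ltr0n.
have main (X T : R) (omega : set 'rV[R]_d) (A eps : R) f : 0 <= X -> 1 <= A -> 0 < eps <= 1 ->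
    ctrl (weight mu nu delta W0 c A) X T (box_obs gam0 d) ->
    lebesgue_measurable omega -> gamma_thick gamma rho omega -> schwartz f ->
    (L2norm setT f ^+ 2 <= (B.+1%:R * expR (T * (1 - ln eps + X)))%:E * L2norm omega f ^+ 2
      + eps%:E * weighted_sup A mu nu f)%E.
  move=> X0 A1 eps01 obs mom thick sf.
  have [K [E [cells cover overlap]]] := cov omega mom thick.
  have cells' k : (K k = set0 /\ E k = set0) \/ exists a b : 'rV[R]_d,
      [/\ K k = box a b, forall i, a ord0 i < b ord0 i,
        forall y i, K k y -> b ord0 i - a ord0 i <= C * rho y &
        [/\ measurable (E k), E k `<=` omega `&` K k &
           ((gam0 * 2 ^+ d * vol a b)%:E <= borel_lebesgue_rV R d (E k))%E]].
    case: (cells k) => [|[a [b [h1 h2 h3 [h4 h5 h6]]]]]; [by left|right].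
    by exists a, b; split => //; split => //; exact: covered_density h6.
  have A0 : 0 < A by rewrite (lt_le_trans ltr01).
  have := main_estimate delta01 R00 rhoR C0 A0 eps01 mom cells' cover overlap obs sf.
  move=> /le_trans; apply; apply: leeD => //; apply: lee_wpmul2r.
    by apply: sqre_ge0.
  by rewrite lee_fin mulrC ler_wpM2r ?expR_ge0 // ler_nat.
have U1 (X eps : R) : 0 <= X -> 0 < eps <= 1 -> 1 <= 1 - ln eps + X by move=> X0; exact: gain_ge1.
have gain (T0 : R) : 1 <= T0 -> 1 <= T0 * step_gain gam0.
  by move=> T01; rewrite -[X in X <= _]mulr1 ler_pM // step_gain_ge1.
have [s_lt|s_ge] := ltP (mu + delta * nu) 1.
- have [T0 [T01 HT]] := good_order_subcritical mu01 nu0 delta01 W00 c0 s_lt.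
  have T1 := gain _ T01; set T := T0 * step_gain gam0 in T1.
  have Td1 : 0 <= (6 * T) ^+ d by rewrite exprn_ge0 // mulr_ge0 // (le_trans ler01).
  exists (lB + (6 * T) ^+ d + 1); split; first by lra.
  move=> omega mom thick A eps A1 eps01.
  have X0 : 0 <= A `^ (2 / (1 - (mu + delta * nu))) by exact: powR_ge0.
  have cT := box_obs_ctrl X0 d g00 T1 (segment_obs_step X0 (line_step ler01 g01 (HT A A1))).
  exists (B.+1%:R * expR ((6 * T) ^+ d * (1 - ln eps + A `^ (2 / (1 - (mu + delta * nu)))))).
  split.
  + by rewrite mulr_gt0 ?expR_gt0 ?ltr0n.
  + by move=> f; exact: main.
  + move=> _; rewrite (_ : 1 - mu - delta * nu = 1 - (mu + delta * nu)); last by ring.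
    rewrite BE ler_expR.
    have u1 := U1 _ _ X0 eps01; set U := 1 - ln eps + _ in u1 *.
    have : lB <= lB * U by rewrite ler_peMr.
    by lra.
  + by move=> dE; move: s_lt; rewrite dE divfK ?gt_eqF // addrC subrK ltxx.
- have s1 : mu + delta * nu = 1 by apply/eqP; rewrite eq_le s_le1 s_ge.
  have [T0 [Hc [T01 Hc0 HT]]] := good_order_critical mu01 nu0 delta01 W00 c0 s1.
  have T1 := gain _ T01; set T := T0 * step_gain gam0 in T1.
  have T24 : 1 <= 24 * T by lra.
  have l24 : 0 <= ln (24 * T) by exact: ln_ge0.
  pose K1 := ln (24 * T) * (d%:R * (Hc + 2)).
  have K10 : 0 <= K1 by rewrite !mulr_ge0 // addr_ge0.
  exists (lB + K1 + 1); split; first by lra.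
  move=> omega mom thick A eps A1 eps01.
  have X0 : 0 <= ln A by exact: ln_ge0.
  have [M [M0 MA good]] := HT A A1.
  have th0 : 0 <= 2 / M%:R :> R by rewrite divr_ge0.
  pose T' := (24 * T) ^+ M.+1.
  have T'1 : 1 <= T' by rewrite exprn_ege1.
  have cT := box_obs_ctrl X0 d g00 T'1
    (segment_obs_chain X0 M0 T1 g0h (line_step th0 g01 good)).
  exists (B.+1%:R * expR ((6 * T') ^+ d * (1 - ln eps + ln A))).
  split.
  + by rewrite mulr_gt0 ?expR_gt0 ?ltr0n.
  + by move=> f; exact: main.
  + by move=> dlt; move: s_ge; rewrite leNgt addrC -ltrBrDr -ltr_pdivlMr // dlt.
  + move=> _; rewrite BE ler_expR.
    have u1 := U1 _ _ X0 eps01; set U := 1 - ln eps + _ in u1 *.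
    have A2 : 1 <= A ^+ 2 by rewrite exprn_ege1.
    have T'd : (6 * T') ^+ d <= expR (K1 * A ^+ 2).
      apply: (@le_trans _ _ (((24 * T) ^+ M.+2) ^+ d)).
        have T'0 : 0 <= T' := le_trans ler01 T'1.
        apply: lerXn2r; rewrite ?nnegrE.
        - by rewrite mulr_ge0.
        - by rewrite exprn_ge0 // (le_trans ler01 T24).
        - by rewrite [leRHS]exprS -/T' ler_wpM2r //; lra.
      rewrite -exprM -[X in X ^+ _](lnK (_ : 24 * T \is Num.pos)) ?posrE ?(lt_le_trans ltr01 T24) //.
      rewrite -expRM_natr ler_expR /K1 -!mulrA ler_wpM2l // natrM mulrC ler_wpM2l //.
      have : 2 <= 2 * A ^+ 2 by lra.
      by rewrite mulrDl -natr1 -natr1; move: MA; lra.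
    have E1 : 1 <= expR (K1 * A ^+ 2) by rewrite expR_ge1 mulr_ge0 // (le_trans ler01 A2).
    have E2 : expR (K1 * A ^+ 2) <= expR ((lB + K1 + 1) * A ^+ 2).
      by rewrite ler_expR ler_wpM2r ?(le_trans ler01 A2) //; lra.
    apply: (@le_trans _ _ ((lB + (6 * T') ^+ d) * U)).
      by rewrite [leRHS]mulrDl; apply: lerD => //; rewrite ler_peMr.
    rewrite mulrAC ler_wpM2r ?(le_trans ler01 u1) //.
    apply: (@le_trans _ _ ((lB + 1) * expR (K1 * A ^+ 2))).
      by rewrite [leRHS]mulrDl mul1r; apply: lerD; rewrite ?ler_peMr.
    apply: ler_pM => //; first by rewrite addr_ge0.
    by lra.
Qed.
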